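(* Let $0<\alpha<1$ and $\varphi(z)=(1+(1-z)^{\alpha})^{-1}$ for $z$ in the unit disc $\mathbb{D}$ (principal branch of the power). Then \[ \exp\Big(-\pi(1-\alpha)\sqrt{2n/\alpha}\Big)\ll a_n(C_\varphi)\ll \exp\Big(-\pi(1-\alpha)\sqrt{n/(2\alpha)}\Big). \]
   Context: $C_\varphi f=f\circ\varphi$ acting on the Hardy space $H^2$ of the unit disc; $a_n(T)$ is the $n$th approximation number (operator-norm distance from $T$ to operators of rank $<n$). $f(n)\ll g(n)$ means $f(n)\le Cg(n)$ for all $n$ with a constant $C$ independent of $n$. *)

(* Defs.v *)
From Stdlib Require Import Reals ClassicalEpsilon.
From Coquelicot Require Import Coquelicot.
Open Scope R_scope.

Definition Carg (w : C) : R :=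
  let x := fst w in let y := snd w in
  if Rlt_dec 0 x then atan (y / x)
  else if Rlt_dec x 0 then
    (if Rle_dec 0 y then atan (y / x) + PI else atan (y / x) - PI)
  else if Rlt_dec 0 y then PI / 2
  else if Rlt_dec y 0 then - (PI / 2) else 0.

(** Principal branch of the power w^s = exp (s Log w), w <> 0 (0^s := 0). *)
Definition Cpowr (w : C) (s : R) : C :=
  if Req_EM_T (Cmod w) 0 then RtoC 0
  else Cmult (RtoC (Rpower (Cmod w) s))
             (cos (s * Carg w), sin (s * Carg w)).

Definition phi_alpha (alpha : R) (z : C) : C :=
  Cinv (Cplus (RtoC 1) (Cpowr (Cminus (RtoC 1) z) alpha)).

(** Hardy space H^2 of the disc, identified with sequences of Taylor
    coefficients f(z) = sum a_n z^n with sum |a_n|^2 < oo. *)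
Definition in_H2 (a : nat -> C) : Prop :=
  ex_series (fun n => (Cmod (a n)) ^ 2).

Definition H2norm (a : nat -> C) : R :=
  sqrt (Series (fun n => (Cmod (a n)) ^ 2)).

(** b is the Taylor coefficient sequence (in H^2) of f o phi, where f has
    Taylor coefficients a. *)
Definition is_comp (phi : C -> C) (a b : nat -> C) : Prop :=
  in_H2 b /\
  forall z : C, Cmod z < 1 ->
    exists v : C, is_series (fun n => Cmult (a n) (Cpow (phi z) n)) v /\
                  is_series (fun k => Cmult (b k) (Cpow z k)) v.

(** The composition operator C_phi f = f o phi on H^2 (on coefficient
    sequences; the image is unique when it exists). *)
Definition Comp_op (phi : C -> C) (a : nat -> C) : nat -> C :=
  epsilon (inhabits (fun _ : nat => RtoC 0)) (fun b => is_comp phi a b).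

Fixpoint Csum (f : nat -> C) (m : nat) : C :=
  match m with O => RtoC 0 | S m' => Cplus (Csum f m') (f m') end.

Definition linear_on_H2 (Rop : (nat -> C) -> (nat -> C)) : Prop :=
  forall (a b : nat -> C) (l : C), in_H2 a -> in_H2 b ->
    Rop (fun k => Cplus (a k) (Cmult l (b k))) =
    (fun k => Cplus (Rop a k) (Cmult l (Rop b k))).

Definition rank_lt_on_H2 (Rop : (nat -> C) -> (nat -> C)) (n : nat) : Prop :=
  exists g : nat -> (nat -> C), (forall i, in_H2 (g i)) /\
    forall a, in_H2 a -> exists c : nat -> C,
      forall k, Rop a k = Csum (fun i => Cmult (c i) (g i k)) (n - 1).

Definition approx_number (T : (nat -> C) -> (nat -> C)) (n : nat) : Rbar :=
  Glb_Rbar (fun r : R => 0 <= r /\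
    exists Rop, linear_on_H2 Rop /\ rank_lt_on_H2 Rop n /\
      forall a, in_H2 a ->
        in_H2 (fun k => Cminus (T a k) (Rop a k)) /\
        H2norm (fun k => Cminus (T a k) (Rop a k)) <= r * H2norm a).

(* Main.v *)
(** Write [u = (1 - z)^al], so that [phi = 1 / (1 + u)] and [u] lies in the sector [|arg u| < al PI / 2].

    Upper bound.  If [B] is a Blaschke product of degree [n - 1], every [f] in [H^2] is the sum of an element of an
    [(n - 1)]-dimensional space and of [B g] with [||g|| <= ||f||], so that [a_n] is at most the norm of
    [g |-> (B o phi) (g o phi)].  The image under [phi] of arc length on the circle lives on two rays, where it has
    density [s^(1/al - 1) ds] in [s = |u|]; by a Schur test this norm is [O(sup |B o phi| |1 - z|^((1 - al) / 2))].
    The zeros of [B] are [1 / (1 + e^(-y))] with [y] distributed with the linearly decreasing density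
    [A - y / (PI^2 al)], completed by [O(A)] zeros at [y = 0] which repair the edge effect at [y = 0]; then
    [-log |B|] compensates [x (1 - al) / (2 al)], where [|u| = e^(-x)], up to a bounded error.  The potential
    of the zeros is computed by differentiating it in the argument [th] of [u]: each term becomes
    the derivative of [t |-> atan (sinh t / sin th)].

    Lower bound.  For points [z_1, ..., z_n] with images [w_i = phi z_i],
    [n a_n >= min_j sqrt ((1 - |z_j|^2) / (1 - |w_j|^2)) prod_(i <> j) |(w_i - w_j) / (1 - conj w_i w_j)|].
    One takes [u_i] in geometric progression on a ray whose argument is slightly smaller than [al PI / 2] and
    optimizes the ratio; this gives an exponent strictly better than the required one, which absorbs the factor [n]. *)
Require Import Defs.
From Stdlib Require Import Reals Lra Lia ClassicalEpsilon FunctionalExtensionality Classical.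
From Coquelicot Require Import Coquelicot.
Open Scope R_scope.

(** Both leading constants come from a balance. The potential (PI / 2 - th0) PI (A - kap x), with
    th0 = al PI / 2, must compensate the weight (1 - al) x / (2 al): this forces kap, the mass J =
    A^2 / (2 kap) then forces A, and the exponent of the upper bound follows. The O(sqrt J)
    additional zeros are harmless because sqrt (J + K sqrt J) - sqrt J is bounded. In the lower
    bound the product costs 2 (PI^2 / 4 - th^2) / h and the ratio costs (1 - al) n h / (2 al); at th
    = al PI / 2 the best h gives PI (1 - al) sqrt ((1 + al) n / al), and 1 + al < 2 is the slack.
    The operator acts on coefficient sequences, so f o phi has to be built as a sequence: power
    series carry majorants of their absolute sums, which survive products and substitution. Boundary
    integrals become sums over equally spaced points of circles of radius r < 1, with bounds
    independent of r and of the number of points. Division and multiplication by Blaschke factors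
    are explicit recursions on coefficients, whose norm bounds telescope. *)

Ltac pos :=
  first [ lra | apply Cmod_ge_0 | apply exp_pos | apply pow2_ge_0 | apply sqrt_pos | apply pos_INR
        | apply lt_0_INR; lia
        | apply Rmult_lt_0_compat; pos | apply Rmult_le_pos; pos
        | apply Rdiv_lt_0_compat; pos | apply Rdiv_le_0_compat; pos | apply Rinv_0_lt_compat; pos
        | apply pow_lt; pos | apply pow_le; pos | apply sqrt_lt_R0; pos | apply Rlt_le; pos ].

(** * Finite sums *)

Fixpoint rsum (f : nat -> R) (n : nat) : R :=
  match n with O => 0 | S m => rsum f m + f m end.

Lemma rsum_ext_lt f g n : (forall k, (k < n)%nat -> f k = g k) -> rsum f n = rsum g n.
Proof.
  induction n as [|n IH]; intros H; simpl; [reflexivity|].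
  rewrite IH, H; auto.
Qed.

Lemma rsum_le f g n : (forall k, (k < n)%nat -> f k <= g k) -> rsum f n <= rsum g n.
Proof.
  induction n as [|n IH]; intros H; simpl; [lra|].
  apply Rplus_le_compat; auto.
Qed.

Lemma rsum_plus f g n : rsum (fun k => f k + g k) n = rsum f n + rsum g n.
Proof. induction n as [|n IH]; simpl; [lra|]. rewrite IH; ring. Qed.

Lemma rsum_scal c f n : rsum (fun k => c * f k) n = c * rsum f n.
Proof. induction n as [|n IH]; simpl; [lra|]. rewrite IH; ring. Qed.

Lemma rsum_const c n : rsum (fun _ => c) n = INR n * c.
Proof. induction n as [|n IH]; [simpl; lra|]. rewrite S_INR; simpl; rewrite IH; ring. Qed.

Lemma rsum_nonneg f n : (forall k, (k < n)%nat -> 0 <= f k) -> 0 <= rsum f n.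
Proof.
  intros H. replace 0 with (rsum (fun _ => 0) n).
  - now apply rsum_le.
  - rewrite rsum_const; ring.
Qed.

Lemma rsum_mono f n m :
  (forall k, 0 <= f k) -> (n <= m)%nat -> rsum f n <= rsum f m.
Proof.
  intros H Hnm; induction Hnm; [lra|]. simpl; specialize (H m); lra.
Qed.

Lemma rsum_swap (f : nat -> nat -> R) n m :
  rsum (fun i => rsum (f i) m) n = rsum (fun j => rsum (fun i => f i j) n) m.
Proof.
  induction n as [|n IH]; simpl.
  - rewrite rsum_const; ring.
  - now rewrite IH, <- rsum_plus.
Qed.

Lemma rsum_add f n m : rsum f (n + m) = rsum f n + rsum (fun k => f (n + k)%nat) m.
Proof.
  induction m as [|m IH]; [rewrite Nat.add_0_r; simpl; lra|].
  rewrite Nat.add_succ_r; simpl; rewrite IH; ring.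
Qed.

Lemma rsum_shift f n : rsum f (S n) = f O + rsum (fun k => f (S k)) n.
Proof. generalize (rsum_add f 1 n); simpl; lra. Qed.

Lemma rsum_le_term f n i :
  (forall k, 0 <= f k) -> (i < n)%nat -> f i <= rsum f n.
Proof.
  intros H Hi. apply Rle_trans with (rsum f (S i)).
  - simpl. generalize (rsum_nonneg f i (fun k _ => H k)); lra.
  - now apply rsum_mono.
Qed.

Lemma rsum_sum_n f n : sum_n f n = rsum f (S n).
Proof.
  induction n as [|n IH].
  - rewrite sum_O. symmetry. apply Rplus_0_l.
  - rewrite sum_Sn, IH. reflexivity.
Qed.

Lemma is_series_rsum f l : is_series f l -> is_lim_seq (rsum f) l.
Proof.
  intros H. apply is_lim_seq_incr_1.
  apply is_lim_seq_ext with (sum_n f); [intros n; apply rsum_sum_n|exact H].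
Qed.

Lemma rsum_is_series f (l : R) : is_lim_seq (rsum f) l -> is_series f l.
Proof.
  intros H. apply is_lim_seq_incr_1 in H.
  assert (H2 : is_lim_seq (sum_n f) l); [|exact H2].
  eapply is_lim_seq_ext; [|exact H]. intros n; simpl. now rewrite rsum_sum_n.
Qed.

Lemma rsum_le_Series f n :
  (forall k, 0 <= f k) -> ex_series f -> rsum f n <= Series f.
Proof.
  intros H Hex. apply (is_lim_seq_incr_compare (rsum f)).
  - apply is_series_rsum, Series_correct, Hex.
  - intros k; simpl; specialize (H k); lra.
Qed.

Lemma bounded_ex_series f M :
  (forall k, 0 <= f k) -> (forall n, rsum f n <= M) -> ex_series f /\ Series f <= M.
Proof.
  intros H HM.
  destruct (ex_finite_lim_seq_incr (rsum f) M) as [l Hl].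
  - intros k; simpl; specialize (H k); lra.
  - exact HM.
  - assert (Hs := rsum_is_series _ _ Hl). split; [now exists l|].
    rewrite (is_series_unique _ _ Hs).
    apply (is_lim_seq_le (rsum f) (fun _ => M) l M); auto.
    apply is_lim_seq_const.
Qed.

Lemma le_lim_seq (u : nat -> R) (c l : R) : (forall n, c <= u n) -> is_lim_seq u l -> c <= l.
Proof.
  intros H Hu. exact (is_lim_seq_le (fun _ => c) u c l H (is_lim_seq_const c) Hu).
Qed.

(** Induction step: with P = x^2 and Q = y^2, the cross term 2 x y a b is absorbed by 0 <= (x b - y
    a)^2. The square roots leave the splitting of each summand into [p] and [q] free, as a Schur
    test requires. *)
Lemma rsum_cauchy_schwarz (p q : nat -> R) n :
  (forall k, 0 <= p k) -> (forall k, 0 <= q k) ->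
  (rsum (fun k => sqrt (p k) * sqrt (q k)) n) ^ 2 <= rsum p n * rsum q n.
Proof.
  intros Hp Hq. induction n as [|n IH]; simpl rsum; [lra|].
  set (X := rsum (fun k => sqrt (p k) * sqrt (q k)) n) in *.
  assert (HP := rsum_nonneg p n (fun k _ => Hp k)).
  assert (HQ := rsum_nonneg q n (fun k _ => Hq k)).
  assert (Ha := sqrt_sqrt _ (Hp n)). assert (Hb := sqrt_sqrt _ (Hq n)).
  assert (Ha0 := sqrt_pos (p n)). assert (Hb0 := sqrt_pos (q n)).
  set (a := sqrt (p n)) in *. set (b := sqrt (q n)) in *.
  set (P := rsum p n) in *. set (Q := rsum q n) in *.
  assert (HX : X <= sqrt P * sqrt Q).
  { rewrite <- sqrt_mult by assumption.
    apply Rle_trans with (Rabs X); [apply Rle_abs|].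
    rewrite <- sqrt_Rsqr_abs. apply sqrt_le_1_alt. unfold Rsqr; lra. }
  assert (HsP := sqrt_sqrt _ HP). assert (HsQ := sqrt_sqrt _ HQ).
  assert (HsP0 := sqrt_pos P). assert (HsQ0 := sqrt_pos Q).
  set (x := sqrt P) in *. set (y := sqrt Q) in *.
  rewrite <- HsP, <- HsQ, <- Ha, <- Hb.
  assert (0 <= a * b) by (apply Rmult_le_pos; assumption).
  assert (X * (a * b) <= x * y * (a * b)) by (apply Rmult_le_compat_r; assumption).
  assert (0 <= (x * b - y * a) ^ 2) by apply pow2_ge_0.
  rewrite <- HsP, <- HsQ in IH. nra.
Qed.

Lemma Csum_ext_lt f g n : (forall k, (k < n)%nat -> f k = g k) -> Csum f n = Csum g n.
Proof.
  induction n as [|n IH]; intros H; simpl; [reflexivity|].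
  rewrite IH, H; auto.
Qed.

Lemma Csum_plus f g n : Csum (fun k => f k + g k)%C n = (Csum f n + Csum g n)%C.
Proof. induction n as [|n IH]; simpl; [ring|]. rewrite IH; ring. Qed.

Lemma Csum_scal c f n : Csum (fun k => c * f k)%C n = (c * Csum f n)%C.
Proof. induction n as [|n IH]; simpl; [ring|]. rewrite IH; ring. Qed.

Lemma Csum_zero n : Csum (fun _ => RtoC 0) n = 0.
Proof. induction n as [|n IH]; simpl; [reflexivity|]. rewrite IH; ring. Qed.

Lemma Csum_swap (f : nat -> nat -> C) n m :
  Csum (fun i => Csum (f i) m) n = Csum (fun j => Csum (fun i => f i j) n) m.
Proof.
  induction n as [|n IH]; simpl.
  - now rewrite Csum_zero.
  - now rewrite IH, <- Csum_plus.
Qed.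

Lemma Csum_add f n m : Csum f (n + m) = (Csum f n + Csum (fun k => f (n + k)%nat) m)%C.
Proof.
  induction m as [|m IH]; [rewrite Nat.add_0_r; simpl; ring|].
  rewrite Nat.add_succ_r; simpl; rewrite IH; ring.
Qed.

Lemma Csum_shift f n : Csum f (S n) = (f O + Csum (fun k => f (S k)) n)%C.
Proof. change (S n) with (1 + n)%nat; rewrite Csum_add; simpl; ring. Qed.

Lemma Csum_single f n i :
  (i < n)%nat -> (forall k, (k < n)%nat -> k <> i -> f k = RtoC 0) -> Csum f n = f i.
Proof.
  induction n as [|n IH]; intros Hi H; [lia|]. simpl.
  destruct (Nat.eq_dec i n) as [->|Hne].
  - rewrite (Csum_ext_lt f (fun _ => RtoC 0)).
    + rewrite Csum_zero; ring.
    + intros k Hk; apply H; lia.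
  - rewrite IH by (try lia; intros; apply H; lia). rewrite (H n) by lia. ring.
Qed.

Lemma Cmod_Csum f n : Cmod (Csum f n) <= rsum (fun k => Cmod (f k)) n.
Proof.
  induction n as [|n IH]; simpl; [rewrite Cmod_0; lra|].
  eapply Rle_trans; [apply Cmod_triangle|lra].
Qed.

(** * Complex series *)

(** Convergence is read off the real sequence of error moduli, so that real limit theorems apply
    directly; [is_series_cser] links it to the notion used in [is_comp]. *)
Definition cser (a : nat -> C) (v : C) : Prop :=
  is_lim_seq (fun N => Cmod (Csum a N - v)) 0.

(** A total function, because [Series] always returns a value; it is the sum only once some
    [cser a v] is known. *)
Definition Cser (a : nat -> C) : C :=
  (Series (fun n => fst (a n)), Series (fun n => snd (a n))).

Lemma Csum_sum_n (a : nat -> C) n :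
  @sum_n C_NormedModule a n = Csum a (S n).
Proof.
  induction n as [|n IH].
  - rewrite sum_O. symmetry. apply Cplus_0_l.
  - rewrite sum_Sn, IH. reflexivity.
Qed.

Lemma is_series_cser (a : nat -> C) (v : C) : is_series a v <-> cser a v.
Proof.
  unfold cser. split; intros H.
  - apply is_lim_seq_incr_1. apply is_lim_seq_spec. intros eps.
    assert (H2 := proj1 (filterlim_locally_ball_norm _ _) H eps).
    destruct H2 as [N HN]. exists N. intros n Hn. specialize (HN n Hn).
    unfold ball_norm in HN. rewrite Rminus_0_r, Rabs_pos_eq by apply Cmod_ge_0.
    rewrite <- Csum_sum_n. exact HN.
  - apply (proj2 (filterlim_locally_ball_norm _ _)). intros eps.
    apply is_lim_seq_incr_1, is_lim_seq_spec in H.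
    destruct (H eps) as [N HN]. exists N. intros n Hn. specialize (HN n Hn).
    rewrite Rminus_0_r, Rabs_pos_eq in HN by apply Cmod_ge_0.
    unfold ball_norm. rewrite Csum_sum_n. exact HN.
Qed.

Lemma cser_components (a : nat -> C) (v : C) :
  cser a v <-> is_series (fun n => fst (a n)) (fst v) /\ is_series (fun n => snd (a n)) (snd v).
Proof.
  assert (E1 : forall n, fst (Csum a n) = rsum (fun n => fst (a n)) n).
  { induction n as [|n IH]; simpl; [reflexivity|]. now rewrite IH. }
  assert (E2 : forall n, snd (Csum a n) = rsum (fun n => snd (a n)) n).
  { induction n as [|n IH]; simpl; [reflexivity|]. now rewrite IH. }
  split.
  - intros H.
    assert (K : forall u : nat -> R, (forall n, Rabs (u n) <= Cmod (Csum a n - v)) -> is_lim_seq u 0).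
    { intros u Hu. apply is_lim_seq_abs_0. eapply is_lim_seq_le_le; [|apply is_lim_seq_const|exact H].
      intros n. split; [apply Rabs_pos|apply Hu]. }
    assert (K2 : forall u (l : R), is_lim_seq (fun n => u n - l) 0 -> is_lim_seq u l).
    { intros u l Hu. generalize (is_lim_seq_plus' _ _ _ _ Hu (is_lim_seq_const l)). rewrite Rplus_0_l.
      apply is_lim_seq_ext. intros; ring. }
    split; apply rsum_is_series, K2, K; intros n; [rewrite <- E1|rewrite <- E2].
    + exact (re_le_Cmod (Csum a n - v)%C).
    + eapply Rle_trans; [apply Rmax_r|exact (Rmax_Cmod (Csum a n - v)%C)].
  - intros [H1 H2]. apply is_series_rsum in H1. apply is_series_rsum in H2. unfold cser.
    apply is_lim_seq_le_le with (fun _ => 0)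
      (fun n => Rabs (rsum (fun n => fst (a n)) n - fst v) + Rabs (rsum (fun n => snd (a n)) n - snd v)).
    + intros n; split; [apply Cmod_ge_0|]. rewrite <- E1, <- E2.
      replace (Csum a n - v)%C with
        (RtoC (fst (Csum a n) - fst v) + Ci * RtoC (snd (Csum a n) - snd v))%C.
      * eapply Rle_trans; [apply Cmod_triangle|].
        rewrite Cmod_mult, Cmod_Ci, !Cmod_R; lra.
      * apply injective_projections; simpl; ring.
    + apply is_lim_seq_const.
    + generalize (is_lim_seq_plus' _ _ _ _
        (is_lim_seq_abs _ _ (is_lim_seq_minus' _ _ _ _ H1 (is_lim_seq_const (fst v))))
        (is_lim_seq_abs _ _ (is_lim_seq_minus' _ _ _ _ H2 (is_lim_seq_const (snd v))))).
      rewrite !Rminus_diag, Rabs_R0, Rplus_0_l. auto.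
Qed.

Lemma cser_Cser a v : cser a v -> Cser a = v.
Proof.
  intros H. apply cser_components in H as [H1 H2]. unfold Cser.
  rewrite (is_series_unique _ _ H1), (is_series_unique _ _ H2). now destruct v.
Qed.

Lemma cser_unique a v w : cser a v -> cser a w -> v = w.
Proof. intros H1 H2. now rewrite <- (cser_Cser _ _ H1), <- (cser_Cser _ _ H2). Qed.

Lemma cser_ext a b v : (forall k, a k = b k) -> cser a v -> cser b v.
Proof. intros H. now replace b with a by (apply functional_extensionality; auto). Qed.

Lemma cser_plus a b v w : cser a v -> cser b w -> cser (fun k => a k + b k)%C (v + w)%C.
Proof.
  rewrite !cser_components. intros [A1 A2] [B1 B2]. split; simpl.
  - exact (is_series_plus _ _ _ _ A1 B1).
  - exact (is_series_plus _ _ _ _ A2 B2).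
Qed.

Lemma cser_scal (c : C) a v : cser a v -> cser (fun k => c * a k)%C (c * v)%C.
Proof.
  unfold cser. intros H.
  apply is_lim_seq_ext with (fun N => Cmod c * Cmod (Csum a N - v)).
  - intros n. rewrite Csum_scal, <- Cmod_mult. f_equal. ring.
  - rewrite <- (Rmult_0_r (Cmod c)). apply (is_lim_seq_scal_l _ (Cmod c) 0). exact H.
Qed.

Lemma cser_minus a b v w : cser a v -> cser b w -> cser (fun k => a k - b k)%C (v - w)%C.
Proof.
  intros A B. apply (cser_scal (- (1))%C) in B. replace (v - w)%C with (v + - (1) * w)%C by ring.
  eapply cser_ext; [|exact (cser_plus _ _ _ _ A B)]. intros k; simpl; ring.
Qed.

Lemma cser_shift a v : cser (fun k => a (S k)) v <-> cser a (a O + v)%C.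
Proof.
  unfold cser.
  assert (E : forall N, Cmod (Csum (fun k => a (S k)) N - v) = Cmod (Csum a (S N) - (a O + v))).
  { intros N. rewrite Csum_shift. f_equal. ring. }
  split; intros H; [apply is_lim_seq_incr_1|apply is_lim_seq_incr_1 in H].
  - eapply is_lim_seq_ext; [exact E|exact H].
  - eapply is_lim_seq_ext; [|exact H]. intros; symmetry; apply E.
Qed.

Lemma cser_finite a n : (forall k, (n <= k)%nat -> a k = RtoC 0) -> cser a (Csum a n).
Proof.
  intros H. unfold cser. apply is_lim_seq_ext_loc with (fun _ => 0); [|apply is_lim_seq_const].
  exists n. intros m Hm. replace m with (n + (m - n))%nat by lia. rewrite Csum_add.
  rewrite (Csum_ext_lt (fun k => a (n + k)%nat) (fun _ => RtoC 0)) by (intros; apply H; lia).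
  rewrite Csum_zero. replace (Csum a n + 0 - Csum a n)%C with (RtoC 0) by ring.
  symmetry. apply Cmod_0.
Qed.

Lemma cser_Cmod_le a v M : cser a v -> (forall N, Cmod (Csum a N) <= M) -> Cmod v <= M.
Proof.
  intros H HM.
  apply (is_lim_seq_le (fun _ => Cmod v) (fun N => M + Cmod (Csum a N - v)) (Cmod v) M).
  - intros N. specialize (HM N).
    replace v with (Csum a N - (Csum a N - v))%C at 1 by ring.
    eapply Rle_trans; [apply Cmod_triangle|]. rewrite Cmod_opp. lra.
  - apply is_lim_seq_const.
  - generalize (is_lim_seq_plus' _ _ _ _ (is_lim_seq_const M) H). now rewrite Rplus_0_r.
Qed.

Lemma abs_cser a M :
  (forall N, rsum (fun k => Cmod (a k)) N <= M) -> cser a (Cser a).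
Proof.
  intros HM.
  destruct (bounded_ex_series (fun k => Cmod (a k)) M) as [He _]; auto.
  { intros; apply Cmod_ge_0. }
  apply cser_components. unfold Cser; simpl. split; apply Series_correct.
  - apply ex_series_Rabs, (ex_series_le (K := R_AbsRing) (V := R_CompleteNormedModule)) with (2 := He).
    intros n. change (Rabs (Rabs (fst (a n))) <= Cmod (a n)). rewrite Rabs_Rabsolu. apply re_le_Cmod.
  - apply ex_series_Rabs, (ex_series_le (K := R_AbsRing) (V := R_CompleteNormedModule)) with (2 := He).
    intros n. change (Rabs (Rabs (snd (a n))) <= Cmod (a n)). rewrite Rabs_Rabsolu.
    eapply Rle_trans; [apply Rmax_r|apply Rmax_Cmod].
Qed.

Lemma Cmod_Cser_le a M :
  (forall N, rsum (fun k => Cmod (a k)) N <= M) -> Cmod (Cser a) <= M.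
Proof.
  intros H. apply (cser_Cmod_le _ _ _ (abs_cser _ _ H)).
  intros N; eapply Rle_trans; [apply Cmod_Csum|apply H].
Qed.

Lemma cser_tail a v n : cser a v -> cser (fun k => a (n + k)%nat) (v - Csum a n)%C.
Proof.
  induction n as [|n IH]; intros H; simpl.
  - replace (v - 0)%C with v by ring. exact H.
  - apply IH in H.
    apply (cser_ext (fun k => a (n + S k)%nat)); [intros k; f_equal; lia|].
    apply (proj2 (cser_shift (fun k => a (n + k)%nat) _)). rewrite Nat.add_0_r.
    replace (a n + (v - (Csum a n + a n)))%C with (v - Csum a n)%C by ring. exact H.
Qed.

Lemma series_tail_small (al : nat -> R) M (eps : posreal) :
  (forall k, 0 <= al k) -> (forall N, rsum al N <= M) ->
  exists n, forall N, rsum (fun k => al (n + k)%nat) N <= eps.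
Proof.
  intros H HM. destruct (bounded_ex_series al M H HM) as [He _].
  assert (HL := is_series_rsum _ _ (Series_correct _ He)).
  apply is_lim_seq_spec in HL. destruct (HL eps) as [n Hn]. exists n. intros N.
  specialize (Hn n (Nat.le_refl n)). apply Rabs_def2 in Hn as [_ Hn].
  assert (H2 := rsum_le_Series al (n + N) H He). rewrite rsum_add in H2. lra.
Qed.

(** Dominated convergence for a double array: rows beyond some [n0] are controlled by the tail of
    [al], uniformly in the truncation [K], and the finitely many remaining rows converge one by one.
    The last clause supplies the majorant of the rearranged series. *)
Lemma cser_fubini (a : nat -> nat -> C) (al : nat -> R) (M : R) :
  (forall n N, rsum (fun k => Cmod (a n k)) N <= al n) ->
  (forall N, rsum al N <= M) ->
  exists v, cser (fun n => Cser (a n)) v /\ cser (fun k => Cser (fun n => a n k)) v /\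
    (forall N, rsum (fun k => Cmod (Cser (fun n => a n k))) N <= M).
Proof.
  intros Ha HM.
  assert (al0 : forall n, 0 <= al n) by (intros n; apply (Ha n O)).
  assert (Hterm : forall n k, Cmod (a n k) <= al n).
  { intros n k. eapply Rle_trans; [|apply (Ha n (S k))].
    apply (rsum_le_term (fun k => Cmod (a n k))); [intros; apply Cmod_ge_0|lia]. }
  assert (Hcol : forall k N, rsum (fun n => Cmod (a n k)) N <= M).
  { intros k N. eapply Rle_trans; [|apply (HM N)]. apply rsum_le; auto. }
  assert (Hrow : forall n, cser (a n) (Cser (a n))) by (intros n; eapply abs_cser, Ha).
  assert (Hcs : forall k, cser (fun n => a n k) (Cser (fun n => a n k))).
  { intros k; eapply abs_cser, Hcol. }
  assert (HS : forall n, Cmod (Cser (a n)) <= al n) by (intros n; apply Cmod_Cser_le, Ha).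
  assert (HSs : forall N, rsum (fun n => Cmod (Cser (a n))) N <= M).
  { intros N; eapply Rle_trans; [|apply (HM N)]; apply rsum_le; auto. }
  (* Finitely many columns may be summed before the rows, so a partial sum over columns differs from
     [v] by a series of row tails. *)
  assert (HT : forall K, cser (fun n => Csum (a n) K) (Csum (fun k => Cser (fun n => a n k)) K)).
  { induction K as [|K IH]; simpl.
    - apply (cser_finite _ O). auto.
    - exact (cser_plus _ _ _ _ IH (Hcs K)). }
  exists (Cser (fun n => Cser (a n))). split; [|split].
  - eapply abs_cser, HSs.
  - set (v := Cser (fun n => Cser (a n))).
    assert (Hv : cser (fun n => Cser (a n)) v) by (eapply abs_cser, HSs).
    assert (HD : forall K, cser (fun n => (Csum (a n) K - Cser (a n))%C)
       (Csum (fun k => Cser (fun n => a n k)) K - v)%C).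
    { intros K. apply cser_minus; auto. }
    assert (Hd : forall K n, Cmod (Csum (a n) K - Cser (a n)) <= al n).
    { intros K n. assert (Ht := cser_tail _ _ K (Hrow n)).
      rewrite <- Cmod_opp. replace (- (Csum (a n) K - Cser (a n)))%C with (Cser (a n) - Csum (a n) K)%C by ring.
      apply (cser_Cmod_le _ _ _ Ht). intros N. eapply Rle_trans; [apply Cmod_Csum|].
      eapply Rle_trans; [|apply (Ha n (K + N)%nat)]. rewrite rsum_add.
      assert (0 <= rsum (fun k => Cmod (a n k)) K) by (apply rsum_nonneg; intros; apply Cmod_ge_0).
      lra. }
    unfold cser. apply is_lim_seq_spec. intros eps.
    assert (He2 : 0 < eps / 4) by (destruct eps; simpl; lra).
    destruct (series_tail_small al M (mkposreal _ He2) al0 HM) as [n0 Hn0]. simpl in Hn0.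
    assert (HF : is_lim_seq (fun K => rsum (fun n => Cmod (Csum (a n) K - Cser (a n))) n0) 0).
    { clear -Hrow. induction n0 as [|n0 IH]; simpl; [apply is_lim_seq_const|].
      generalize (is_lim_seq_plus' _ _ _ _ IH (Hrow n0)). now rewrite Rplus_0_r. }
    apply is_lim_seq_spec in HF. destruct (HF (mkposreal _ He2)) as [K0 HK0]; simpl in HK0.
    exists K0. intros K HK. specialize (HK0 K HK).
    rewrite Rminus_0_r in HK0 |- *. rewrite Rabs_pos_eq by apply Cmod_ge_0.
    apply Rle_lt_trans with (eps / 4 + eps / 4); [|destruct eps; simpl; lra].
    apply (cser_Cmod_le _ _ _ (HD K)). intros N.
    eapply Rle_trans; [apply Cmod_Csum|].
    apply Rle_trans with (rsum (fun n => Cmod (Csum (a n) K - Cser (a n))) (n0 + N)).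
    { apply rsum_mono; [intros; apply Cmod_ge_0|lia]. }
    rewrite rsum_add. apply Rplus_le_compat.
    + apply Rle_trans with (2 := Rlt_le _ _ HK0). apply Rle_abs.
    + eapply Rle_trans; [|apply (Hn0 N)]. apply rsum_le. intros; apply Hd.
  - intros K.
    assert (HK : forall N, rsum (fun k => Cmod (Csum (fun n => a n k) N)) K <= M).
    { intros N. eapply Rle_trans.
      { apply rsum_le. intros k _. apply Cmod_Csum. }
      rewrite rsum_swap. eapply Rle_trans; [|apply (HM N)]. apply rsum_le; intros; apply Ha. }
    assert (HL : is_lim_seq (fun N => rsum (fun k => Cmod (Csum (fun n => a n k) N - Cser (fun n => a n k))) K) 0).
    { clear -Hcs. induction K as [|K IH]; simpl; [apply is_lim_seq_const|].
      generalize (is_lim_seq_plus' _ _ _ _ IH (Hcs K)). now rewrite Rplus_0_r. }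
    generalize (is_lim_seq_plus' _ _ _ _ (is_lim_seq_const M) HL). rewrite Rplus_0_r. intros HL2.
    apply (le_lim_seq _ _ _) with (2 := HL2).
    intros N. eapply Rle_trans; [|apply Rplus_le_compat_r, (HK N)].
    rewrite <- rsum_plus. apply rsum_le. intros k _.
    replace (Cser (fun n => a n k)) with (Csum (fun n => a n k) N - (Csum (fun n => a n k) N - Cser (fun n => a n k)))%C at 1 by ring.
    eapply Rle_trans; [apply Cmod_triangle|]. rewrite Cmod_opp. lra.
Qed.

(** * Power series on the unit disc *)

(** Besides the expansion of [F], the predicate carries a majorant of the absolute sums on each
    circle. Majorants multiply and compose, and they provide the domination needed by
    [cser_fubini]. *)
Definition psr (c : nat -> C) (F : C -> C) (nu : R -> R) : Prop :=
  (forall z, Cmod z < 1 -> cser (fun k => c k * z ^ k)%C (F z)) /\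
  (forall r, 0 <= r < 1 -> forall N, rsum (fun k => Cmod (c k) * r ^ k) N <= nu r).

Lemma psr_intro c F nu :
  (forall z, Cmod z < 1 -> cser (fun k => c k * z ^ k)%C (F z) /\
     forall N, rsum (fun k => Cmod (c k * z ^ k)) N <= nu (Cmod z)) -> psr c F nu.
Proof.
  intros H. split; [intros; now apply H|]. intros r Hr N.
  assert (Hm : Cmod r = r) by (rewrite Cmod_R, Rabs_pos_eq; lra).
  destruct (H (RtoC r)) as [_ HN]; [rewrite Hm; lra|]. specialize (HN N). rewrite Hm in HN.
  rewrite (rsum_ext_lt _ (fun k => Cmod (c k * r ^ k))); [exact HN|].
  intros k _. now rewrite Cmod_mult, Cmod_pow, Hm.
Qed.

Definition conv (c d : nat -> C) (k : nat) : C :=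
  Csum (fun i => c i * d (k - i)%nat)%C (S k).

(** The Cauchy product consists of the column sums of an array whose row [n] is c n z^n times the
    second series, shifted by [n] places. *)
Lemma psr_mult c d F G mu nu :
  psr c F mu -> psr d G nu -> psr (conv c d) (fun z => F z * G z)%C (fun r => mu r * nu r).
Proof.
  intros [HF1 HF2] [HG1 HG2].
  assert (key : forall z, Cmod z < 1 ->
    let a := fun n k => if (k <? n)%nat then RtoC 0 else (c n * z ^ n * (d (k - n)%nat * z ^ (k - n)))%C in
    (forall n, cser (a n) (c n * z ^ n * G z)%C) /\
    (forall k, cser (fun n => a n k) (conv c d k * z ^ k)%C) /\
    (forall n N, rsum (fun k => Cmod (a n k)) N <= Cmod (c n) * Cmod z ^ n * nu (Cmod z))).
  { intros z Hz a. split; [|split].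
    - intros n.
      assert (H := cser_scal (c n * z ^ n)%C _ _ (HG1 z Hz)).
      unfold cser. apply (is_lim_seq_incr_n _ n).
      eapply is_lim_seq_ext; [|exact H]. intros N. simpl. f_equal. f_equal.
      rewrite Nat.add_comm, Csum_add.
      rewrite (Csum_ext_lt (a n) (fun _ => RtoC 0) n).
      2:{ intros k Hk. unfold a. now rewrite (proj2 (Nat.ltb_lt k n) Hk). }
      rewrite Csum_zero, Cplus_0_l. apply Csum_ext_lt. intros k _. unfold a.
      rewrite (proj2 (Nat.ltb_ge (n + k) n)) by lia.
      now replace (n + k - n)%nat with k by lia.
    - intros k. replace (conv c d k * z ^ k)%C with (Csum (fun n => a n k) (S k)).
      + apply cser_finite. intros n Hn. unfold a. now rewrite (proj2 (Nat.ltb_lt k n)) by lia.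
      + unfold conv. rewrite Cmult_comm, <- Csum_scal. apply Csum_ext_lt. intros i Hi. unfold a.
        rewrite (proj2 (Nat.ltb_ge k i)) by lia.
        replace (z ^ k)%C with (z ^ i * z ^ (k - i))%C; [ring|].
        rewrite <- Cpow_add_r. f_equal. lia.
    - intros n N.
      assert (Hn : rsum (fun k => Cmod (a n k)) n = 0).
      { rewrite (rsum_ext_lt _ (fun _ => 0)); [rewrite rsum_const; ring|].
        intros k Hk. unfold a. rewrite (proj2 (Nat.ltb_lt k n) Hk). apply Cmod_0. }
      apply Rle_trans with (rsum (fun k => Cmod (a n k)) (n + N)).
      { apply rsum_mono; [intros; apply Cmod_ge_0|lia]. }
      rewrite rsum_add, Hn, Rplus_0_l.
      rewrite (rsum_ext_lt _ (fun k => (Cmod (c n) * Cmod z ^ n) * (Cmod (d k) * Cmod z ^ k))).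
      + rewrite rsum_scal. apply Rmult_le_compat_l.
        * pos.
        * apply HG2. split; [apply Cmod_ge_0|assumption].
      + intros k _. unfold a. rewrite (proj2 (Nat.ltb_ge (n + k) n)) by lia.
        replace (n + k - n)%nat with k by lia. now rewrite !Cmod_mult, !Cmod_pow. }
  apply psr_intro. intros z Hz. destruct (key z Hz) as (K1 & K2 & K3). clear key.
  set (a := fun n k : nat => if (k <? n)%nat then RtoC 0 else (c n * z ^ n * (d (k - n)%nat * z ^ (k - n)))%C) in *.
  assert (Hr : 0 <= Cmod z < 1) by (split; [apply Cmod_ge_0|assumption]).
  assert (nu0 : 0 <= nu (Cmod z)) by apply (HG2 _ Hr O).
  destruct (cser_fubini a (fun n => Cmod (c n) * Cmod z ^ n * nu (Cmod z)) (mu (Cmod z) * nu (Cmod z)) K3)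
    as (v & V1 & V2 & V3).
  { intros N. rewrite (rsum_ext_lt _ (fun n => nu (Cmod z) * (Cmod (c n) * Cmod z ^ n))) by (intros; ring).
    rewrite rsum_scal, Rmult_comm. apply Rmult_le_compat_r; auto. }
  assert (E : forall k, Cser (fun n => a n k) = (conv c d k * z ^ k)%C) by (intros k; apply cser_Cser, K2).
  split.
  - apply (cser_ext _ _ _ E). replace (F z * G z)%C with v; [exact V2|].
    apply (cser_unique (fun n => Cser (a n))); [exact V1|].
    apply (cser_ext (fun n => G z * (c n * z ^ n))%C).
    + intros n. rewrite (cser_Cser (a n) _ (K1 n)). ring.
    + rewrite (Cmult_comm (F z)). apply cser_scal, HF1, Hz.
  - intros N. rewrite (rsum_ext_lt _ (fun k => Cmod (Cser (fun n => a n k)))).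
    + apply V3.
    + intros; now rewrite E.
Qed.

Fixpoint convpow (c : nat -> C) (n : nat) : nat -> C :=
  match n with
  | O => fun k => match k with O => RtoC 1 | S _ => RtoC 0 end
  | S m => conv c (convpow c m)
  end.

Lemma psr_pow c F nu n :
  psr c F nu -> psr (convpow c n) (fun z => F z ^ n)%C (fun r => nu r ^ n).
Proof.
  intros H. induction n as [|n IH]; simpl.
  - split.
    + intros z Hz.
      assert (Hf := cser_finite (fun k => (match k with O => RtoC 1 | S _ => RtoC 0 end * z ^ k)%C) 1).
      simpl in Hf. replace (0 + 1 * 1)%C with (RtoC 1) in Hf by ring. apply Hf.
      intros [|k] Hk; [lia|ring].
    + intros r Hr N. destruct N as [|N]; [simpl; lra|]. rewrite rsum_shift.
      rewrite (rsum_ext_lt _ (fun _ => 0)) by (intros; rewrite Cmod_0; ring).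
      rewrite rsum_const, Cmod_1. simpl. lra.
  - exact (psr_mult _ _ _ _ _ _ H IH).
Qed.

Definition comp_coef (a c : nat -> C) (k : nat) : C :=
  Cser (fun n => a n * convpow c n k)%C.

(** Expands F^n by [psr_pow] and exchanges the sums over [n] and [k]. The hypothesis on [B] asks for
    absolute convergence of the outer series at the majorant [nu r], not merely at [F z]. *)
Lemma psr_comp a c F f nu B :
  psr c F nu ->
  (forall r, 0 <= r < 1 -> forall N, rsum (fun n => Cmod (a n) * nu r ^ n) N <= B r) ->
  (forall z, Cmod z < 1 -> cser (fun n => a n * F z ^ n)%C (f z)) ->
  psr (comp_coef a c) f B.
Proof.
  intros HF HB Hf.
  apply psr_intro. intros z Hz.
  assert (Hr : 0 <= Cmod z < 1) by (split; [apply Cmod_ge_0|assumption]).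
  assert (nu0 : 0 <= nu (Cmod z)) by apply (proj2 HF _ Hr O).
  destruct (cser_fubini (fun n k => a n * (convpow c n k * z ^ k))%C
    (fun n => Cmod (a n) * nu (Cmod z) ^ n) (B (Cmod z))) as (v & V1 & V2 & V3).
  { intros n N. rewrite (rsum_ext_lt _ (fun k => Cmod (a n) * (Cmod (convpow c n k) * Cmod z ^ k))).
    - rewrite rsum_scal. apply Rmult_le_compat_l; [apply Cmod_ge_0|].
      apply (psr_pow c F nu n HF); auto.
    - intros k _. now rewrite !Cmod_mult, Cmod_pow. }
  { apply HB, Hr. }
  assert (E : forall k, Cser (fun n => a n * (convpow c n k * z ^ k))%C = (comp_coef a c k * z ^ k)%C).
  (* For z <> 0, convergence of the series defining the coefficient is recovered by dividing by z^k;
     at z = 0 only k = 0 survives. *)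
  { intros k. destruct (Ceq_dec z 0) as [->|Hz0].
    - destruct k as [|k].
      + simpl. unfold comp_coef. rewrite Cmult_1_r. f_equal. apply functional_extensionality.
        intros n. ring.
      + simpl. rewrite !Cmult_0_l, Cmult_0_r. apply cser_Cser.
        apply (cser_finite _ O). intros; ring.
    - apply cser_Cser. rewrite Cmult_comm.
      assert (Hzk : (z ^ k)%C <> 0) by now apply Cpow_nz.
      assert (Hpos : 0 < Cmod (z ^ k)) by now apply Cmod_gt_0.
      apply (cser_ext (fun n => z ^ k * (a n * convpow c n k))%C); [intros; ring|].
      apply cser_scal, (abs_cser _ (B (Cmod z) / Cmod (z ^ k))).
      intros N. apply Rmult_le_reg_r with (Cmod (z ^ k)); [exact Hpos|].
      unfold Rdiv. rewrite Rmult_assoc, Rinv_l, Rmult_1_r by lra.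
      rewrite Rmult_comm, <- rsum_scal.
      eapply Rle_trans; [|apply (HB (Cmod z) Hr N)]. apply rsum_le. intros n _.
      rewrite Cmod_mult.
      replace (Cmod (z ^ k) * (Cmod (a n) * Cmod (convpow c n k)))
        with (Cmod (a n) * (Cmod (convpow c n k) * Cmod z ^ k)) by (rewrite Cmod_pow; ring).
      apply Rmult_le_compat_l; [apply Cmod_ge_0|].
      destruct (psr_pow c F nu n HF) as [_ HP].
      eapply Rle_trans; [|apply (HP _ Hr (S k))].
      apply (rsum_le_term (fun k => Cmod (convpow c n k) * Cmod z ^ k)); [|lia].
      intros i; pos. }
  split.
  - apply (cser_ext _ _ _ E). replace (f z) with v; [exact V2|].
    apply (cser_unique _ _ _ V1).
    apply (cser_ext (fun n => a n * F z ^ n)%C); [|apply Hf, Hz].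
    intros n. symmetry. apply cser_Cser. apply cser_scal, (psr_pow c F nu n HF), Hz.
  - intros N. rewrite (rsum_ext_lt _ (fun k => Cmod (Cser (fun n => a n * (convpow c n k * z ^ k))%C))).
    + apply V3.
    + intros; now rewrite E.
Qed.

(** * The binomial series and the symbol *)

Lemma is_derive_Rplus (f g : R -> R) x a b :
  is_derive f x a -> is_derive g x b -> is_derive (fun t => f t + g t) x (a + b).
Proof. exact (is_derive_plus (K := R_AbsRing) (V := R_NormedModule) f g x a b). Qed.

Lemma is_derive_Rminus (f g : R -> R) x a b :
  is_derive f x a -> is_derive g x b -> is_derive (fun t => f t - g t) x (a - b).
Proof. exact (is_derive_minus (K := R_AbsRing) (V := R_NormedModule) f g x a b). Qed.

(** Taylor coefficients of [(1 - z)^al]. *)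
Fixpoint bcoef (al : R) (k : nat) : R :=
  match k with O => 1 | S j => bcoef al j * ((INR j - al) / INR (S j)) end.

Lemma bcoef_S al k : INR (S k) * bcoef al (S k) = (INR k - al) * bcoef al k.
Proof.
  change (bcoef al (S k)) with (bcoef al k * ((INR k - al) / INR (S k))).
  field. apply not_0_INR; lia.
Qed.

Lemma bcoef_neg al k : 0 < al < 1 -> -1 <= bcoef al (S k) <= 0.
Proof.
  intros Ha. induction k as [|k IH].
  - simpl. lra.
  - change (bcoef al (S (S k))) with (bcoef al (S k) * ((INR (S k) - al) / INR (S (S k)))).
    assert (H1 : 0 <= (INR (S k) - al) / INR (S (S k)) <= 1).
    { rewrite (S_INR (S k)), S_INR. assert (0 <= INR k) by apply pos_INR. split.
      - apply Rdiv_le_0_compat; lra.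
      - apply Rle_div_l; lra. }
    nra.
Qed.

Lemma bcoef_abs al k : 0 < al < 1 -> Rabs (bcoef al k) <= 1.
Proof.
  intros Ha. destruct k as [|k].
  - simpl. rewrite Rabs_R1; lra.
  - apply Rabs_le. generalize (bcoef_neg al k Ha); lra.
Qed.

Lemma CV_radius_gt_1 (a : nat -> R) (m : R) :
  0 <= m < 1 -> (forall k, Rabs (a k) <= m ^ k) ->
  forall t, 0 <= t <= 1 -> Rbar_lt (Rabs t) (CV_radius a).
Proof.
  intros Hm Ha t Ht. destruct (CV_radius_bounded a) as [Hub _].
  (* An intermediate radius: it exceeds 1 because m < 1, and m times it is at most 1. *)
  apply Rbar_lt_le_trans with (Finite (2 / (1 + m))).
  - simpl. rewrite Rabs_pos_eq by lra. apply Rle_lt_trans with 1; [lra|].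
    apply Rlt_div_r; lra.
  - apply Hub. exists 1. intros n. rewrite Rabs_mult, <- RPow_abs.
    rewrite (Rabs_pos_eq (2 / (1 + m))) by pos.
    apply Rle_trans with (m ^ n * (2 / (1 + m)) ^ n).
    + apply Rmult_le_compat_r; [apply pow_le, Rdiv_le_0_compat; lra|apply Ha].
    + assert (0 <= 2 / (1 + m)) by pos.
      rewrite <- Rpow_mult_distr. apply Rle_trans with (1 ^ n); [|rewrite pow1; lra].
      apply pow_incr. split; [pos|].
      replace (m * (2 / (1 + m))) with (2 * m / (1 + m)) by (field; lra).
      apply Rle_div_l; lra.
Qed.

Lemma snd_le_Cmod (c : C) : Rabs (snd c) <= Cmod c.
Proof. eapply Rle_trans; [apply Rmax_r|apply Rmax_Cmod]. Qed.

Lemma fst_le_Cmod (c : C) : Rabs (fst c) <= Cmod c.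
Proof. exact (re_le_Cmod c). Qed.

(** Division of e + i f by c - i s in real coordinates; it is used with c - i s = 1 - t z. *)
Lemma solve_rotation (c s a b e f : R) :
  0 < c ^ 2 + s ^ 2 -> c * a + s * b = e -> c * b - s * a = f ->
  a = (c * e - s * f) / (c ^ 2 + s ^ 2) /\ b = (c * f + s * e) / (c ^ 2 + s ^ 2).
Proof. intros H <- <-. split; field; lra. Qed.

(** With [z = x + i y], both the binomial series at [t z], with parts [PSeries A t] and [PSeries B t], and
    [(1 - t z)^al = 1 / (U t + i V t)] solve [(1 - t z) Y' = - al z Y]. *)
Section BinomialODE.
Variables (al x y : R).
Hypothesis Hal : 0 < al < 1.
Hypothesis Hz : Cmod (x, y) < 1.

Let A k := bcoef al k * fst ((x, y) ^ k)%C.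
Let B k := bcoef al k * snd ((x, y) ^ k)%C.

Lemma binom_A_bound k : Rabs (A k) <= Cmod (x, y) ^ k.
Proof.
  unfold A. rewrite Rabs_mult, <- Cmod_pow.
  generalize (bcoef_abs al k Hal), (fst_le_Cmod ((x, y) ^ k)%C), (Rabs_pos (fst ((x, y) ^ k)%C)).
  intros; nra.
Qed.

Lemma binom_B_bound k : Rabs (B k) <= Cmod (x, y) ^ k.
Proof.
  unfold B. rewrite Rabs_mult, <- Cmod_pow.
  generalize (bcoef_abs al k Hal), (snd_le_Cmod ((x, y) ^ k)%C), (Rabs_pos (snd ((x, y) ^ k)%C)).
  intros; nra.
Qed.

Let Hm : 0 <= Cmod (x, y) < 1.
Proof. split; [apply Cmod_ge_0|exact Hz]. Qed.

Let radA := CV_radius_gt_1 A _ Hm binom_A_bound.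
Let radB := CV_radius_gt_1 B _ Hm binom_B_bound.

(** The recursion [bcoef_S] reads Y' = z (t Y' - al Y) for Y = PSeries A + i PSeries B; this
    evaluates the real combinations that occur on its right side. *)
Lemma binom_lin_comb (a b : nat -> R) t u v :
  Rbar_lt (Rabs t) (CV_radius a) -> Rbar_lt (Rabs t) (CV_radius b) ->
  PSeries (fun k => u * (INR k * a k - al * a k) + v * (INR k * b k - al * b k)) t
  = u * (t * PSeries (PS_derive a) t - al * PSeries a t)
    + v * (t * PSeries (PS_derive b) t - al * PSeries b t).
Proof.
  intros Ra Rb.
  assert (Hi : forall c, Rbar_lt (Rabs t) (CV_radius c) ->
    ex_pseries (fun k => INR k * c k) t /\ PSeries (fun k => INR k * c k) t = t * PSeries (PS_derive c) t).
  { intros c Rc. rewrite <- PSeries_incr_1.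
    assert (E : forall k, @PS_incr_1 R_AbsRing R_NormedModule (PS_derive c) k = INR k * c k).
    { intros [|k]; [symmetry; apply Rmult_0_l|reflexivity]. }
    split.
    - eapply ex_pseries_ext; [exact E|]. apply CV_radius_inside.
      rewrite CV_radius_incr_1, CV_radius_derive. exact Rc.
    - apply PSeries_ext. intros; now rewrite E. }
  assert (Hc : forall c w, Rbar_lt (Rabs t) (CV_radius c) ->
     is_pseries (fun k => w * (INR k * c k - al * c k)) t
       (w * (t * PSeries (PS_derive c) t - al * PSeries c t))).
  { intros c w Rc. destruct (Hi c Rc) as [E1 E2].
    assert (P1 := PSeries_correct _ _ E1).
    assert (P2 := PSeries_correct _ _ (CV_radius_inside _ _ Rc)).
    rewrite E2 in P1.
    assert (P3 := is_pseries_scal (-al) _ t _ (Rmult_comm _ _) P2).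
    assert (P4 := is_pseries_plus _ _ _ _ _ P1 P3).
    assert (P5 := is_pseries_scal w _ t _ (Rmult_comm _ _) P4).
    replace (w * (t * PSeries (PS_derive c) t - al * PSeries c t))
      with (@scal R_AbsRing R_NormedModule w (plus (t * PSeries (PS_derive c) t) (scal (-al) (PSeries c t)))).
    - eapply is_pseries_ext; [|exact P5]. intros n.
      change (w * (INR n * c n + - al * c n) = w * (INR n * c n - al * c n)). ring.
    - change (w * (t * PSeries (PS_derive c) t + - al * PSeries c t) = w * (t * PSeries (PS_derive c) t - al * PSeries c t)). ring. }
  apply is_pseries_unique. exact (is_pseries_plus _ _ _ _ _ (Hc a u Ra) (Hc b v Rb)).
Qed.

Lemma binom_ode t : 0 <= t <= 1 ->
  PSeries (PS_derive A) t =
    x * (t * PSeries (PS_derive A) t - al * PSeries A t)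
    + - y * (t * PSeries (PS_derive B) t - al * PSeries B t) /\
  PSeries (PS_derive B) t =
    x * (t * PSeries (PS_derive B) t - al * PSeries B t)
    + y * (t * PSeries (PS_derive A) t - al * PSeries A t).
Proof.
  intros Ht. split.
  - rewrite <- binom_lin_comb by auto. apply PSeries_ext. intros k.
    unfold PS_derive, A, B. rewrite <- Rmult_assoc, bcoef_S.
    change ((x, y) ^ S k)%C with ((x, y) * (x, y) ^ k)%C. simpl fst. ring.
  - rewrite <- binom_lin_comb by auto. apply PSeries_ext. intros k.
    unfold PS_derive, A, B. rewrite <- Rmult_assoc, bcoef_S.
    change ((x, y) ^ S k)%C with ((x, y) * (x, y) ^ k)%C. simpl snd. ring.
Qed.

Let q t := (1 - t * x) ^ 2 + (t * y) ^ 2.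
Let th t := atan (- (t * y) / (1 - t * x)).
Let U t := exp (- (al / 2) * ln (q t)) * cos (al * th t).
Let V t := - (exp (- (al / 2) * ln (q t)) * sin (al * th t)).

Let tx_lt t : 0 <= t <= 1 -> 0 < 1 - t * x.
Proof.
  intros Ht. assert (H := fst_le_Cmod (x, y)). simpl in H.
  assert (Rabs x < 1) by lra. apply Rabs_def2 in H0. nra.
Qed.

(** Here U + i V = exp (- al log (1 - t z)), with q = |1 - t z|^2 and th = arg (1 - t z); the
    formulas are Y' = al z Y / (1 - t z) in real coordinates. *)
Lemma binom_UV_derive t : 0 <= t <= 1 ->
  is_derive U t (- al * (- x * (1 - t * x) + t * y ^ 2) / q t * U t - al * y / q t * V t) /\
  is_derive V t (- al * (- x * (1 - t * x) + t * y ^ 2) / q t * V t + al * y / q t * U t).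
Proof.
  intros Ht. assert (H1 := tx_lt t Ht).
  assert (Hq : 0 < q t) by (unfold q; nra).
  unfold U, V, th, q in *. split; (auto_derive; [repeat split; lra|]);
    change (1 + - (t * x)) with (1 - t * x);
    change (- (t * y) * / (1 - t * x)) with (- (t * y) / (1 - t * x));
    change ((1 - t * x) * ((1 - t * x) * 1) + t * y * (t * y * 1)) with ((1 - t * x) ^ 2 + (t * y) ^ 2);
    generalize (exp (- (al / 2) * ln ((1 - t * x) ^ 2 + (t * y) ^ 2)))
      (cos (al * atan (- (t * y) / (1 - t * x)))) (sin (al * atan (- (t * y) / (1 - t * x))));
    intros e c s; unfold Rsqr; field; split; nra.
Qed.

(** The product (PSeries A + i PSeries B) (U + i V) has derivative 0 on [0, 1] and equals 1 at t =
    0; the two claims are its real and imaginary parts at t = 1. *)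
Lemma binom_const :
  PSeries A 1 * U 1 - PSeries B 1 * V 1 = 1 /\ PSeries A 1 * V 1 + PSeries B 1 * U 1 = 0.
Proof.
  assert (HA0 : PSeries A 0 = 1).
  { rewrite PSeries_0. unfold A. simpl. ring. }
  assert (HB0 : PSeries B 0 = 0).
  { rewrite PSeries_0. unfold B. simpl. ring. }
  assert (Hq0 : q 0 = 1) by (unfold q; ring).
  assert (Hth0 : th 0 = 0).
  { unfold th. replace (- (0 * y) / (1 - 0 * x)) with 0 by field. apply atan_0. }
  assert (HU0 : U 0 = 1).
  { unfold U. rewrite Hq0, ln_1, Hth0, !Rmult_0_r, exp_0, cos_0. ring. }
  assert (HV0 : V 0 = 0).
  { unfold V. rewrite Hq0, ln_1, Hth0, !Rmult_0_r, exp_0, sin_0. ring. }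
  assert (D : forall t, 0 <= t <= 1 ->
    is_derive (PSeries A) t (PSeries (PS_derive A) t) /\ is_derive (PSeries B) t (PSeries (PS_derive B) t)).
  { intros t Ht. split; apply is_derive_PSeries; auto. }
  assert (K : forall t, 0 <= t <= 1 ->
    is_derive (fun t => PSeries A t * U t - PSeries B t * V t) t 0 /\
    is_derive (fun t => PSeries A t * V t + PSeries B t * U t) t 0).
  { intros t Ht. destruct (D t Ht) as [DA DB]. destruct (binom_ode t Ht) as [O1 O2].
    assert (H1 := tx_lt t Ht). assert (Hq : 0 < q t) by (unfold q; nra).
    destruct (binom_UV_derive t Ht) as [DU DV].
    set (a := PSeries A t). set (b := PSeries B t). fold a b in O1, O2.
    destruct (solve_rotation (1 - t * x) (t * y) (PSeries (PS_derive A) t) (PSeries (PS_derive B) t)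
        (- al * (x * a - y * b)) (- al * (x * b + y * a))) as [Ea Eb]; [exact Hq|lra|lra|].
    fold (q t) in Ea, Eb. split; evar_last.
    - apply is_derive_Rminus.
      + apply (is_derive_mult _ _ _ _ _ DA DU). intros; apply Rmult_comm.
      + apply (is_derive_mult _ _ _ _ _ DB DV). intros; apply Rmult_comm.
    - unfold minus, plus, opp, mult; simpl. fold a b. rewrite Ea, Eb. field. lra.
    - apply is_derive_Rplus.
      + apply (is_derive_mult _ _ _ _ _ DA DV). intros; apply Rmult_comm.
      + apply (is_derive_mult _ _ _ _ _ DB DU). intros; apply Rmult_comm.
    - unfold minus, plus, opp, mult; simpl. fold a b. rewrite Ea, Eb. field. lra. }
  split.
  - transitivity (PSeries A 0 * U 0 - PSeries B 0 * V 0); [|rewrite HA0, HB0, HU0, HV0; ring].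
    symmetry. apply (eq_is_derive (fun t => PSeries A t * U t - PSeries B t * V t)); [|lra].
    intros t Ht. now apply K.
  - transitivity (PSeries A 0 * V 0 + PSeries B 0 * U 0); [|rewrite HA0, HB0, HU0, HV0; ring].
    symmetry. apply (eq_is_derive (fun t => PSeries A t * V t + PSeries B t * U t)); [|lra].
    intros t Ht. now apply K.
Qed.

(** Divides 1 by U + i V = m e^(- i al th) at t = 1. The quotient e^(i al th) / m is the principal
    power because 1 - z lies in the right half-plane, where [Carg] is an arctangent. *)
Lemma Cpowr_one_minus_components :
  fst (Cpowr (1 - (x, y))%C al) = PSeries A 1 /\ snd (Cpowr (1 - (x, y))%C al) = PSeries B 1.
Proof.
  destruct binom_const as [H1 H2].
  assert (Hx := tx_lt 1 (conj Rle_0_1 (Rle_refl 1))). rewrite Rmult_1_l in Hx.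
  assert (Hq : 0 < q 1) by (unfold q; nra).
  assert (HC : Cmod (1 - (x, y)) = sqrt (q 1)).
  { unfold Cmod, q. simpl. f_equal. ring. }
  assert (Hs : 0 < sqrt (q 1)) by now apply sqrt_lt_R0.
  unfold Cpowr. rewrite HC. destruct (Req_EM_T (sqrt (q 1)) 0) as [E|_]; [lra|].
  assert (HArg : Carg (1 - (x, y))%C = th 1).
  { unfold Carg. simpl fst. simpl snd. destruct (Rlt_dec 0 (1 + - x)) as [_|n]; [|lra].
    unfold th. f_equal. field. lra. }
  rewrite HArg.
  assert (HR : Rpower (sqrt (q 1)) al = / exp (- (al / 2) * ln (q 1))).
  { rewrite <- exp_Ropp. unfold Rpower. f_equal. rewrite <- Rpower_sqrt by assumption.
    unfold Rpower. rewrite ln_exp. field. }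
  rewrite HR. simpl fst. simpl snd.
  set (m := exp (- (al / 2) * ln (q 1))) in *.
  assert (Hmp : 0 < m) by apply exp_pos.
  unfold U, V in H1, H2. fold m in H1, H2.
  set (c := cos (al * th 1)) in *. set (s := sin (al * th 1)) in *.
  assert (Hcs : c * c + s * s = 1).
  { generalize (sin2_cos2 (al * th 1)). fold c s. unfold Rsqr. lra. }
  set (a := PSeries A 1) in *. set (b := PSeries B 1) in *.
  clearbody c s a b. clear -H1 H2 Hcs Hmp.
  assert (E1 : a = / m * c).
  { apply Rmult_eq_reg_l with m; [|lra]. rewrite <- Rmult_assoc, Rinv_r by lra.
    replace (m * a) with (m * a * (c * c + s * s)) by (rewrite Hcs; ring).
    transitivity (c * (a * (m * c) - b * - (m * s)) - s * (a * - (m * s) + b * (m * c))); [ring|].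
    rewrite H1, H2. ring. }
  assert (E2 : b = / m * s).
  { apply Rmult_eq_reg_l with m; [|lra]. rewrite <- Rmult_assoc, Rinv_r by lra.
    replace (m * b) with (m * b * (c * c + s * s)) by (rewrite Hcs; ring).
    transitivity (s * (a * (m * c) - b * - (m * s)) + c * (a * - (m * s) + b * (m * c))); [ring|].
    rewrite H1, H2. ring. }
  rewrite E1, E2. split; ring.
Qed.

Lemma binom_cser_xy : cser (fun k => RtoC (bcoef al k) * (x, y) ^ k)%C (Cpowr (1 - (x, y))%C al).
Proof.
  destruct Cpowr_one_minus_components as [E1 E2].
  apply cser_components. rewrite E1, E2. split.
  - assert (H := PSeries_correct A 1 (CV_radius_inside _ _ (radA 1 (conj Rle_0_1 (Rle_refl 1))))).
    apply (is_series_ext (fun k => scal (pow_n 1 k) (A k))); [|exact H].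
    intros n. rewrite pow_n_pow, pow1. unfold A, scal; simpl; unfold mult; simpl. ring.
  - assert (H := PSeries_correct B 1 (CV_radius_inside _ _ (radB 1 (conj Rle_0_1 (Rle_refl 1))))).
    apply (is_series_ext (fun k => scal (pow_n 1 k) (B k))); [|exact H].
    intros n. rewrite pow_n_pow, pow1. unfold B, scal; simpl; unfold mult; simpl. ring.
Qed.

End BinomialODE.

Lemma binom_cser al z : 0 < al < 1 -> Cmod z < 1 ->
  cser (fun k => RtoC (bcoef al k) * z ^ k)%C (Cpowr (1 - z)%C al).
Proof. destruct z as [x y]. intros. now apply binom_cser_xy. Qed.

(** * The symbol: sector, modulus and power series *)

Lemma one_minus_pos z : Cmod z < 1 -> 0 < fst (1 - z)%C.
Proof.
  intros Hz. assert (H := fst_le_Cmod z). assert (Rabs (fst z) < 1) by lra.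
  apply Rabs_def2 in H0. simpl. lra.
Qed.

Lemma Cmod_pos_of_fst w : 0 < fst w -> 0 < Cmod w.
Proof.
  intros H. eapply Rlt_le_trans; [exact H|]. eapply Rle_trans; [apply Rle_abs|apply fst_le_Cmod].
Qed.

Lemma one_minus_Cmod z : Cmod z < 1 -> 0 < Cmod (1 - z) <= 2.
Proof.
  intros Hz. split; [apply Cmod_pos_of_fst, one_minus_pos, Hz|].
  eapply Rle_trans; [apply Cmod_triangle|]. rewrite Cmod_opp, Cmod_1. lra.
Qed.

Lemma Cmod_polar (r t : R) : 0 <= r -> Cmod (r * cos t, r * sin t) = r.
Proof.
  intros Hr. unfold Cmod. simpl.
  replace (r * cos t * (r * cos t * 1) + r * sin t * (r * sin t * 1))
    with (r * r * (Rsqr (sin t) + Rsqr (cos t))) by (unfold Rsqr; ring).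
  rewrite sin2_cos2, Rmult_1_r. now apply sqrt_square.
Qed.

Lemma Cpowr_right al w : 0 < fst w ->
  Cpowr w al = (Rpower (Cmod w) al * cos (al * atan (snd w / fst w)),
                Rpower (Cmod w) al * sin (al * atan (snd w / fst w))).
Proof.
  intros Hw. assert (Hm := Cmod_pos_of_fst w Hw). unfold Cpowr.
  destruct (Req_EM_T (Cmod w) 0) as [E|_]; [lra|].
  assert (HA : Carg w = atan (snd w / fst w)).
  { unfold Carg. destruct (Rlt_dec 0 (fst w)) as [_|n]; [reflexivity|lra]. }
  rewrite HA. apply injective_projections; simpl; ring.
Qed.

Lemma exp_mono x y : x <= y -> exp x <= exp y.
Proof. intros [H| ->]; [left; now apply exp_increasing|lra]. Qed.

Lemma Rpower_pos x a : 0 < Rpower x a.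
Proof. apply exp_pos. Qed.

Lemma Cmod_Cpowr al w : 0 < fst w -> Cmod (Cpowr w al) = Rpower (Cmod w) al.
Proof.
  intros H. rewrite Cpowr_right by assumption. apply Cmod_polar, Rlt_le, Rpower_pos.
Qed.

Lemma cos_half_pos al : 0 < al < 1 -> 0 < cos (al * (PI / 2)) < 1.
Proof.
  intros Ha. assert (HP := PI_RGT_0). split.
  - apply cos_gt_0; nra.
  - rewrite <- cos_0. apply cos_decreasing_1; nra.
Qed.

Lemma fst_Cpowr_ge al w : 0 < al < 1 -> 0 < fst w ->
  cos (al * (PI / 2)) * Rpower (Cmod w) al <= fst (Cpowr w al).
Proof.
  intros Ha H. rewrite Cpowr_right by assumption. simpl fst.
  rewrite Rmult_comm. apply Rmult_le_compat_l; [apply Rlt_le, Rpower_pos|].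
  assert (HP := PI_RGT_0). destruct (atan_bound (snd w / fst w)) as [B1 B2].
  set (t := atan _) in *.
  assert (Rabs t <= PI / 2) by (apply Rabs_le; lra).
  assert (E : cos (al * t) = cos (al * Rabs t)).
  { unfold Rabs. destruct (Rcase_abs t); [|reflexivity].
    rewrite <- cos_neg. f_equal. ring. }
  rewrite E. assert (0 <= Rabs t) by apply Rabs_pos.
  apply cos_decr_1; nra.
Qed.

(** The real part of 1 + u suffices. The bound depends on z only through |1 - z|, which reduces the
    later embedding to a kernel in one real variable. *)
Lemma phi_mod_le al z : 0 < al < 1 -> Cmod z < 1 ->
  Cmod (phi_alpha al z) <= / (1 + cos (al * (PI / 2)) * Rpower (Cmod (1 - z)) al).
Proof.
  intros Ha Hz. assert (H := one_minus_pos z Hz). assert (F := fst_Cpowr_ge al _ Ha H).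
  assert (Hs := Rpower_pos (Cmod (1 - z)) al).
  destruct (cos_half_pos al Ha) as [Hc _].
  set (u := Cpowr (1 - z)%C al) in *. set (s := Rpower _ _) in *. set (c := cos _) in *.
  assert (Hcs : 0 < c * s) by pos.
  assert (H1 : 1 + c * s <= Cmod (1 + u)).
  { apply Rle_trans with (fst (1 + u)%C); [simpl; lra|].
    eapply Rle_trans; [apply Rle_abs|apply fst_le_Cmod]. }
  unfold phi_alpha. fold u. rewrite Cmod_inv.
  - apply Rinv_le_contravar; lra.
  - intros E. rewrite E, Cmod_0 in H1. lra.
Qed.

Lemma inv_lt_1 x : 1 < x -> 0 < / x < 1.
Proof.
  intros Hx. split; [apply Rinv_0_lt_compat; lra|].
  apply Rlt_le_trans with (/ 1); [apply Rinv_lt_contravar; lra|rewrite Rinv_1; lra].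
Qed.

Lemma phi_mod_lt al z : 0 < al < 1 -> Cmod z < 1 -> Cmod (phi_alpha al z) < 1.
Proof.
  intros Ha Hz. eapply Rle_lt_trans; [apply phi_mod_le; assumption|].
  destruct (cos_half_pos al Ha) as [Hc _].
  assert (Hs := Rpower_pos (Cmod (1 - z)) al).
  assert (H := Rmult_lt_0_compat _ _ Hc Hs).
  apply inv_lt_1. lra.
Qed.

Lemma Cpow_small_lim w : Cmod w < 1 -> is_lim_seq (fun n => Cmod w ^ n) 0.
Proof.
  intros H. apply is_lim_seq_geom. rewrite Rabs_pos_eq by apply Cmod_ge_0. exact H.
Qed.

Lemma cser_geom w : Cmod w < 1 -> cser (fun n => w ^ n)%C (/ (1 - w))%C.
Proof.
  intros H.
  assert (Hne : (1 - w)%C <> 0).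
  { intros E. assert (w = 1) by (replace w with (1 - (1 - w))%C by ring; rewrite E; ring).
    subst w. rewrite Cmod_1 in H. lra. }
  unfold cser.
  apply is_lim_seq_ext with (fun n => / Cmod (1 - w) * Cmod w ^ n).
  - intros n. rewrite <- Cmod_inv, <- Cmod_pow, <- Cmod_mult by assumption.
    rewrite <- Cmod_opp. f_equal.
    assert (E : Csum (fun n => w ^ n)%C n = ((1 - w ^ n) / (1 - w))%C).
    { induction n as [|n IH]; simpl; [field; auto|]. rewrite IH. field. auto. }
    rewrite E. field. auto.
  - rewrite <- (Rmult_0_r (/ Cmod (1 - w))).
    apply (is_lim_seq_scal_l _ (/ Cmod (1 - w)) 0), Cpow_small_lim, H.
Qed.

Lemma rsum_geom_le x n : 0 <= x < 1 -> rsum (fun k => x ^ k) n <= / (1 - x).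
Proof.
  intros Hx. assert (E : rsum (fun k => x ^ k) n = (1 - x ^ n) / (1 - x)).
  { induction n as [|n IH]; simpl; [field; lra|]. rewrite IH. field. lra. }
  rewrite E. unfold Rdiv. rewrite <- (Rmult_1_l (/ (1 - x))) at 2.
  apply Rmult_le_compat_r; [pos|].
  assert (0 <= x ^ n) by (apply pow_le; lra). lra.
Qed.

(** [1 - (1 - z)^al] has nonnegative coefficients with sum at most [1]; hence so has
    [phi_alpha al = sum_n 2^(-n-1) (1 - (1 - z)^al)^n]. *)
Lemma phi_psr al : 0 < al < 1 ->
  exists c nu, psr c (phi_alpha al) nu /\ forall r, 0 <= r < 1 -> 0 <= nu r < 1.
Proof.
  intros Ha.
  set (p := fun k => match k with O => RtoC 0 | S j => RtoC (- bcoef al (S j)) end).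
  set (P := fun z => (1 - Cpowr (1 - z) al)%C).
  (* [nu] is [P] on the real axis: the coefficients of [P] being nonnegative, its value at r is its
     own majorant. *)
  set (nu := fun r => 1 - Rpower (1 - r) al).
  assert (Hnu : forall r, 0 <= r < 1 -> 0 <= nu r < 1).
  { intros r Hr. unfold nu. assert (H := Rpower_pos (1 - r) al). split; [|lra].
    destruct (Rle_lt_or_eq_dec 0 r) as [H0|<-]; [lra| |].
    - unfold Rpower. assert (ln (1 - r) <= 0) by (rewrite <- ln_1; left; apply ln_increasing; lra).
      assert (exp (al * ln (1 - r)) <= exp 0) by (apply exp_mono; nra). rewrite exp_0 in H2. lra.
    - rewrite Rminus_0_r. unfold Rpower. rewrite ln_1, Rmult_0_r, exp_0. lra. }
  assert (HP : psr p P nu).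
  { assert (HPz : forall z, Cmod z < 1 -> cser (fun k => p k * z ^ k)%C (P z)).
    { intros z Hz. assert (H := binom_cser al z Ha Hz).

      replace (P z) with ((RtoC 0 * z ^ 0) + P z)%C by (simpl; ring).
      apply (proj1 (cser_shift (fun k => p k * z ^ k)%C (P z))).
      apply (cser_ext (fun k => - (1) * (RtoC (bcoef al (S k)) * z ^ S k))%C).
      { intros k. unfold p. rewrite RtoC_opp. ring. }
      replace (P z) with (- (1) * (Cpowr (1 - z) al - 1))%C by (unfold P; ring).
      apply cser_scal.
      apply (proj2 (cser_shift (fun k => RtoC (bcoef al k) * z ^ k)%C _)).
      simpl. replace (1 * 1 + (Cpowr (1 - z) al - 1))%C with (Cpowr (1 - z) al) by ring. exact H. }
    split; [exact HPz|].
    intros r Hr N.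
    assert (Hm : Cmod r = r) by (rewrite Cmod_R, Rabs_pos_eq; lra).
    assert (H := HPz (RtoC r) ltac:(rewrite Hm; lra)).
    apply cser_components in H as [H _].
    assert (E : fst (P (RtoC r)) = nu r).
    { assert (Hw : (1 - r)%C = RtoC (1 - r)) by now rewrite RtoC_minus.
      unfold P, nu. rewrite Hw, Cpowr_right by (simpl; lra). simpl.
      rewrite Cmod_R, Rabs_pos_eq by lra. unfold Rdiv. rewrite Rmult_0_l, atan_0, Rmult_0_r, cos_0. ring. }
    rewrite E in H. apply is_series_rsum in H.
    assert (Hn : forall k, fst (p k * r ^ k)%C = Cmod (p k) * r ^ k).
    { intros k. rewrite <- RtoC_pow. unfold p. destruct k as [|k].
      - simpl. rewrite Cmod_0. ring.
      - rewrite Cmod_R, Rabs_pos_eq by (generalize (bcoef_neg al k Ha); lra). simpl. ring. }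
    rewrite (rsum_ext_lt _ (fun k => fst (p k * r ^ k)%C)) by (intros; now rewrite Hn).
    apply (is_lim_seq_incr_compare _ _ H). intros n. cbn [rsum].
    assert (0 <= fst (p n * r ^ n)%C); [|lra]. rewrite Hn.
    pos. }
  set (a := fun n => RtoC ((/ 2) ^ S n)).
  (* The sum of 2^(-n-1) nu^n. It stays below 1 because nu < 1, which allows the symbol to be
     substituted into any series with bounded coefficients. *)
  exists (comp_coef a p), (fun r => / (2 - nu r)). split.
  - apply (psr_comp a p P _ nu _ HP).
    + intros r Hr N. specialize (Hnu r Hr).
      rewrite (rsum_ext_lt _ (fun n => / 2 * (nu r / 2) ^ n)).
      * rewrite rsum_scal. replace (/ (2 - nu r)) with (/ 2 * / (1 - nu r / 2)) by (field; lra).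
        apply Rmult_le_compat_l; [lra|]. apply rsum_geom_le. lra.
      * intros n _. unfold a. rewrite Cmod_R, Rabs_pos_eq by (apply pow_le; lra).
        unfold Rdiv. rewrite Rpow_mult_distr. simpl. ring.
    + intros z Hz.
      assert (HPb : Cmod (P z) <= 1).
      { assert (Hr : 0 <= Cmod z < 1) by (split; [apply Cmod_ge_0|assumption]).
        apply Rle_trans with (nu (Cmod z)); [|specialize (Hnu _ Hr); lra].
        destruct HP as [H1 H2]. apply (cser_Cmod_le _ _ _ (H1 z Hz)). intros N.
        eapply Rle_trans; [apply Cmod_Csum|]. eapply Rle_trans; [|apply (H2 _ Hr N)].
        apply rsum_le. intros k _. rewrite Cmod_mult, Cmod_pow. lra. }
      assert (Hg := cser_geom (RtoC (/ 2) * P z)%C).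
      assert (Hh : Cmod (RtoC (/ 2) * P z) < 1).
      { rewrite Cmod_mult, Cmod_R, Rabs_pos_eq by lra. lra. }
      specialize (Hg Hh). apply (cser_scal (RtoC (/ 2))) in Hg.
      eapply cser_ext; [|replace (phi_alpha al z) with (RtoC (/ 2) * / (1 - RtoC (/ 2) * P z))%C; [exact Hg|]].
      * intros n. unfold a. rewrite Cpow_mult_l, RtoC_pow. simpl. ring.
      * unfold phi_alpha, P. set (u := Cpowr (1 - z) al).
        assert (Hu : (1 + u)%C <> 0).
        { assert (F := fst_Cpowr_ge al _ Ha (one_minus_pos z Hz)). fold u in F.
          assert (0 < cos (al * (PI / 2)) * Rpower (Cmod (1 - z)) al).
          { apply Rmult_lt_0_compat; [apply cos_half_pos, Ha|apply Rpower_pos]. }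
          intros E. assert (E2 : fst (1 + u)%C = 0) by now rewrite E. simpl in E2. lra. }
        rewrite RtoC_inv by lra. replace (RtoC 2) with (1 + 1)%C by (rewrite <- RtoC_plus; f_equal; ring).
        field. exact Hu.
  - intros r Hr. specialize (Hnu r Hr). generalize (inv_lt_1 (2 - nu r) ltac:(lra)). lra.
Qed.

Lemma rsum_geom_majorized (h : nat -> C) w M : (forall k, Cmod (h k) <= M) -> Cmod w < 1 ->
  forall N, rsum (fun k => Cmod (h k * w ^ k)) N <= M * / (1 - Cmod w).
Proof.
  intros H Hw N. assert (HM : 0 <= M) by (eapply Rle_trans; [apply Cmod_ge_0|apply (H O)]).
  apply Rle_trans with (rsum (fun k => M * Cmod w ^ k) N).
  - apply rsum_le. intros k _. rewrite Cmod_mult, Cmod_pow.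
    apply Rmult_le_compat_r; [apply pow_le, Cmod_ge_0|apply H].
  - rewrite rsum_scal. apply Rmult_le_compat_l; [exact HM|].
    apply rsum_geom_le. split; [apply Cmod_ge_0|exact Hw].
Qed.

Lemma in_H2_bound a : in_H2 a -> forall n, Cmod (a n) <= H2norm a.
Proof.
  intros H n. unfold H2norm. rewrite <- (sqrt_pow2 (Cmod (a n))) by apply Cmod_ge_0.
  apply sqrt_le_1_alt.
  eapply Rle_trans; [|apply (rsum_le_Series (fun n => Cmod (a n) ^ 2) (S n))].
  - apply (rsum_le_term (fun n => Cmod (a n) ^ 2)); [intros; apply pow2_ge_0|lia].
  - intros; apply pow2_ge_0.
  - exact H.
Qed.

Lemma H2norm_pos a : 0 <= H2norm a.
Proof. apply sqrt_pos. Qed.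

Lemma H2_abs_bound a w : in_H2 a -> Cmod w < 1 ->
  forall N, rsum (fun n => Cmod (a n * w ^ n)) N <= H2norm a * / (1 - Cmod w).
Proof.
  intros Ha Hw. apply rsum_geom_majorized; [now apply in_H2_bound|exact Hw].
Qed.

Definition hval (a : nat -> C) (w : C) : C := Cser (fun n => a n * w ^ n)%C.

Lemma hval_cser a w : in_H2 a -> Cmod w < 1 -> cser (fun n => a n * w ^ n)%C (hval a w).
Proof. intros Ha Hw. eapply abs_cser. apply H2_abs_bound; assumption. Qed.

(** The majorant of the symbol stays below 1 and the coefficients of [a] are bounded by its norm.
    Square summability of [b] is a separate matter, settled by [carleson]. *)
Lemma comp_phi_psr al a : 0 < al < 1 -> in_H2 a ->
  exists b nu, psr b (fun z => hval a (phi_alpha al z)) nu.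
Proof.
  intros Hal Ha. destruct (phi_psr al Hal) as (c & nu & Hc & Hnu).
  exists (comp_coef a c), (fun r => H2norm a * / (1 - nu r)).
  apply (psr_comp a c (phi_alpha al) (fun z => hval a (phi_alpha al z)) nu _ Hc).
  - intros r Hr N. specialize (Hnu r Hr).
    apply Rle_trans with (rsum (fun n => H2norm a * nu r ^ n) N).
    + apply rsum_le. intros n _. apply Rmult_le_compat_r; [apply pow_le; lra|now apply in_H2_bound].
    + rewrite rsum_scal. apply Rmult_le_compat_l; [apply H2norm_pos|]. now apply rsum_geom_le.
  - intros z Hz. apply hval_cser; [exact Ha|]. now apply phi_mod_lt.
Qed.

(** * Discrete Parseval inequality on circles *)

Definition cpt (r t : R) : C := (r * cos t, r * sin t).

Lemma cpt_pow r t k : (cpt r t ^ k)%C = cpt (r ^ k) (INR k * t).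
Proof.
  induction k as [|k IH].
  - simpl. unfold cpt. rewrite Rmult_0_l, cos_0, sin_0, Rmult_0_r, Rmult_1_r. reflexivity.
  - rewrite S_INR, Rmult_plus_distr_r, Rmult_1_l.
    simpl Cpow. rewrite IH. unfold cpt. rewrite cos_plus, sin_plus.
    apply injective_projections; simpl; ring.
Qed.

Lemma Cmod_cpt r t : 0 <= r -> Cmod (cpt r t) = r.
Proof. apply Cmod_polar. Qed.

(** Together with their negatives these angles are 2 M equally spaced ones that avoid 0. The point
    at node [j] and its mirror image have the same distance from 1, at least of order (j + 1) /
    M. *)
Definition nodes (M j : nat) : R := INR (2 * j + 1) * (PI / INR (2 * M)).

Lemma cos_nodes_sum M m : (0 < m < 2 * M)%nat ->
  rsum (fun j => cos (INR m * nodes M j)) M = 0.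
Proof.
  intros Hm. set (b := INR m * (PI / INR (2 * M))).
  assert (HM : 0 < INR (2 * M)) by pos.
  assert (HP := PI_RGT_0).
  assert (Hb : 0 < b < PI).
  { assert (H1 : 0 < INR m) by pos.
    assert (H2 : INR m < INR (2 * M)) by (apply lt_INR; lia). unfold b. split.
    - apply Rmult_lt_0_compat; [lra|apply Rdiv_lt_0_compat; lra].
    - replace (INR m * (PI / INR (2 * M))) with (INR m / INR (2 * M) * PI) by (field; lra).
      rewrite <- (Rmult_1_l PI) at 2. apply Rmult_lt_compat_r; [lra|]. apply Rlt_div_l; lra. }
  assert (Hs : 0 < sin b) by (apply sin_gt_0; lra).
  (* Telescoping: 2 sin b cos ((2 j + 1) b) = sin ((2 j + 2) b) - sin (2 j b). At the end the sine
     of an integer multiple of PI remains. *)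
  assert (T : forall N, 2 * sin b * rsum (fun j => cos (INR m * nodes M j)) N = sin (INR (2 * N) * b)).
  { induction N as [|N IH].
    - simpl rsum. rewrite Nat.mul_0_r. simpl INR. rewrite Rmult_0_l, sin_0. ring.
    - cbn [rsum]. rewrite Rmult_plus_distr_l, IH.
      replace (INR m * nodes M N) with (INR (2 * N + 1) * b) by (unfold nodes, b; ring).
      replace (2 * S N)%nat with (2 * N + 2)%nat by lia. rewrite !plus_INR. simpl (INR 1). simpl (INR 2).
      set (X := INR (2 * N)).
      replace ((X + (1 + 1)) * b) with ((X + 1) * b + b) by ring.
      replace (X * b) with ((X + 1) * b - b) by ring. rewrite sin_plus, sin_minus. ring. }
  specialize (T M).
  replace (INR (2 * M) * b) with (IZR (Z.of_nat m) * PI) in T.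
  - rewrite (sin_eq_0_1 (IZR (Z.of_nat m) * PI)) in T by (eexists; reflexivity).
    apply Rmult_integral in T as [T|T]; [lra|exact T].
  - rewrite <- INR_IZR_INZ. unfold b. field. lra.
Qed.

Definition dot (a b : C) : R := fst a * fst b + snd a * snd b.

Lemma dot_sum f b n : dot (Csum f n) b = rsum (fun k => dot (f k) b) n.
Proof.
  induction n as [|n IH]; cbn [rsum Csum].
  - unfold dot; simpl; ring.
  - rewrite <- IH. unfold dot; simpl; ring.
Qed.

Lemma Cmod2_dot a : Cmod a ^ 2 = dot a a.
Proof. rewrite Cmod2_alt. unfold dot, Re, Im. ring. Qed.

Lemma Cmod2_plus a b : Cmod (a + b) ^ 2 = Cmod a ^ 2 + Cmod b ^ 2 + 2 * dot a b.
Proof. rewrite !Cmod2_dot. unfold dot; simpl; ring. Qed.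

Lemma dot_cpt_sym (u v : C) r t l n : (l < n)%nat ->
  dot (u * cpt r t ^ l)%C (v * cpt r t ^ n)%C + dot (u * cpt r (- t) ^ l)%C (v * cpt r (- t) ^ n)%C
  = 2 * dot u v * r ^ l * r ^ n * cos (INR (n - l) * t).
Proof.
  intros Hl. rewrite !cpt_pow. unfold cpt, dot.
  replace (INR n * - t) with (- (INR n * t)) by ring. replace (INR l * - t) with (- (INR l * t)) by ring.
  rewrite !cos_neg, !sin_neg.
  rewrite minus_INR by lia. rewrite Rmult_minus_distr_r, cos_minus. simpl. ring.
Qed.

Definition psum (F : nat -> C) (N : nat) (z : C) : C := Csum (fun k => F k * z ^ k)%C N.

(** Exact because no aliasing occurs with at most 2 M coefficients: adding mirror nodes turns the
    cross terms into multiples of cos ((n - l) t) with 0 < n - l < 2 M, which sum to 0. *)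
Lemma parseval_nodes F r M N : 0 <= r -> (N <= 2 * M)%nat ->
  rsum (fun j => Cmod (psum F N (cpt r (nodes M j))) ^ 2 + Cmod (psum F N (cpt r (- nodes M j))) ^ 2) M
  = 2 * INR M * rsum (fun k => Cmod (F k) ^ 2 * r ^ (2 * k)) N.
Proof.
  intros Hr. induction N as [|N IH]; intros HN.
  - unfold psum. cbn [rsum Csum]. rewrite Cmod_0. rewrite rsum_const. ring.
  - unfold psum in *. cbn [rsum Csum].
    rewrite (rsum_ext_lt _ (fun j =>
      (Cmod (Csum (fun k => F k * cpt r (nodes M j) ^ k)%C N) ^ 2
        + Cmod (Csum (fun k => F k * cpt r (- nodes M j) ^ k)%C N) ^ 2)
      + (2 * (Cmod (F N) ^ 2 * r ^ (2 * N))
      + rsum (fun l => 2 * (2 * dot (F l) (F N) * r ^ l * r ^ N) * cos (INR (N - l) * nodes M j)) N))).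
    2:{ intros j _. rewrite !Cmod2_plus, !dot_sum, !Cmod_mult, !Cmod_pow, !Cmod_cpt by assumption.
        rewrite (rsum_ext_lt (fun l => 2 * (2 * dot (F l) (F N) * r ^ l * r ^ N) * cos (INR (N - l) * nodes M j))
          (fun l => 2 * (dot (F l * cpt r (nodes M j) ^ l)%C (F N * cpt r (nodes M j) ^ N)%C
            + dot (F l * cpt r (- nodes M j) ^ l)%C (F N * cpt r (- nodes M j) ^ N)%C))).
        - rewrite rsum_scal, rsum_plus. rewrite pow_mult, !Rpow_mult_distr.
          rewrite <- !pow_mult. rewrite (Nat.mul_comm N 2). ring.
        - intros l Hl. rewrite dot_cpt_sym by assumption. ring. }
    rewrite rsum_plus, IH by lia. rewrite rsum_plus, rsum_const, rsum_swap.
    rewrite (rsum_ext_lt (fun l => rsum _ M) (fun _ => 0)).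
    + rewrite rsum_const. ring.
    + intros l Hl. rewrite rsum_scal, cos_nodes_sum by lia. ring.
Qed.

Lemma is_lim_seq_rsum (u : nat -> nat -> R) (l : nat -> R) m :
  (forall j, (j < m)%nat -> is_lim_seq (u j) (l j)) ->
  is_lim_seq (fun K => rsum (fun j => u j K) m) (rsum l m).
Proof.
  induction m as [|m IH]; intros H; cbn [rsum]; [apply is_lim_seq_const|].
  apply is_lim_seq_plus'; auto.
Qed.

Lemma lim_seq_le_const (u : nat -> R) (c l : R) : (forall n, u n <= c) -> is_lim_seq u l -> l <= c.
Proof.
  intros H Hu. exact (is_lim_seq_le u (fun _ => c) l c H Hu (is_lim_seq_const c)).
Qed.

(** The hypothesis bounds the mean of |f|^2 over the 2 M nodes by X / 2. The factor 2 is spent on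
    |p|^2 <= 2 |f|^2 + 2 d^2, where [p] is the partial sum to which the exact identity applies and
    [d] bounds the tail. *)
Lemma parseval_circle F f nu r X : psr F f nu -> 0 <= r < 1 ->
  (forall M, (0 < M)%nat -> rsum (fun j => Cmod (f (cpt r (nodes M j))) ^ 2 + Cmod (f (cpt r (- nodes M j))) ^ 2) M
     <= INR M * X) ->
  forall K, rsum (fun k => Cmod (F k) ^ 2 * r ^ (2 * k)) K <= X.
Proof.
  intros [HF1 HF2] Hr HX K.
  apply le_epsilon. intros e He.
  (* With d = min 1 (e / 2) one has 2 d^2 <= 2 d <= e. *)
  assert (He2 : 0 < Rmin 1 (e / 2)) by (apply Rmin_glb_lt; lra).
  destruct (series_tail_small (fun k => Cmod (F k) * r ^ k) (nu r) (mkposreal _ He2)) as [n0 Hn0].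
  { intros; pos. }
  { apply HF2, Hr. }
  simpl in Hn0. set (M := S (n0 + K)).
  assert (HM : 0 < INR M) by pos.
  apply Rle_trans with (rsum (fun k => Cmod (F k) ^ 2 * r ^ (2 * k)) (2 * M)).
  { apply rsum_mono; [intros; pos|lia]. }
  assert (Hpt : forall t, Cmod (psum F (2 * M) (cpt r t)) ^ 2 <= 2 * Cmod (f (cpt r t)) ^ 2 + e).
  { intros t. assert (Hm := Cmod_cpt r t (proj1 Hr)).
    assert (Ht := cser_tail _ _ (2 * M) (HF1 (cpt r t) ltac:(rewrite Hm; lra))).
    assert (B : Cmod (f (cpt r t) - psum F (2 * M) (cpt r t)) <= Rmin 1 (e / 2)).
    { apply (cser_Cmod_le _ _ _ Ht). intros N. eapply Rle_trans; [apply Cmod_Csum|].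
      assert (Hn := Hn0 (2 * M - n0 + N)%nat). rewrite rsum_add in Hn.
      rewrite (rsum_ext_lt _ (fun k => Cmod (F (n0 + (2 * M - n0 + k))%nat) * r ^ (n0 + (2 * M - n0 + k)))).
      - assert (0 <= rsum (fun k => Cmod (F (n0 + k)%nat) * r ^ (n0 + k)) (2 * M - n0)); [|lra].
        apply rsum_nonneg. intros; pos.
      - intros k _. rewrite Cmod_mult, Cmod_pow, Hm.
        replace (n0 + (2 * M - n0 + k))%nat with (2 * M + k)%nat by lia. reflexivity. }
    set (p := psum F (2 * M) (cpt r t)) in *. set (v := f (cpt r t)) in *.
    assert (T : Cmod p <= Cmod v + Rmin 1 (e / 2)).
    { replace p with (v - (v - p))%C by ring. eapply Rle_trans; [apply Cmod_triangle|].
      rewrite Cmod_opp. lra. }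
    assert (Hmin1 := Rmin_l 1 (e / 2)). assert (Hmin2 := Rmin_r 1 (e / 2)).
    assert (0 <= Cmod p) by apply Cmod_ge_0. assert (0 <= Cmod v) by apply Cmod_ge_0.
    set (d := Rmin 1 (e / 2)) in *. clearbody d.
    assert (Cmod p ^ 2 <= (Cmod v + d) ^ 2) by (apply pow_incr; lra).
    assert (0 <= (Cmod v - d) ^ 2) by apply pow2_ge_0. nra. }
  assert (P := parseval_nodes F r M (2 * M) (proj1 Hr) (le_n _)).
  apply Rmult_le_reg_l with (2 * INR M); [lra|]. rewrite <- P.
  apply Rle_trans with (rsum (fun j => 2 * (Cmod (f (cpt r (nodes M j))) ^ 2 + Cmod (f (cpt r (- nodes M j))) ^ 2) + 2 * e) M).
  - apply rsum_le. intros j _. generalize (Hpt (nodes M j)), (Hpt (- nodes M j)). lra.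
  - rewrite rsum_plus, rsum_scal, rsum_const. specialize (HX M ltac:(lia)). lra.
Qed.

Lemma parseval_disc F f nu X : psr F f nu ->
  (forall r M, 0 <= r < 1 -> (0 < M)%nat ->
     rsum (fun j => Cmod (f (cpt r (nodes M j))) ^ 2 + Cmod (f (cpt r (- nodes M j))) ^ 2) M <= INR M * X) ->
  in_H2 F /\ H2norm F <= sqrt X.
Proof.
  intros HF HX.
  assert (B : forall K, rsum (fun k => Cmod (F k) ^ 2) K <= X).
  { intros K. set (rn := fun n => 1 - / (INR n + 1)).
    assert (Hrn : forall n, 0 <= rn n < 1).
    { intros n. unfold rn. assert (0 <= INR n) by apply pos_INR.
      assert (0 < / (INR n + 1)) by pos.
      assert (/ (INR n + 1) <= / 1) by (apply Rinv_le_contravar; lra). rewrite Rinv_1 in *. lra. }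
    assert (L : is_lim_seq rn 1).
    { unfold rn. replace (Finite 1) with (Finite (1 - 0)) by (f_equal; ring).
      apply is_lim_seq_minus'; [apply is_lim_seq_const|].
      apply is_lim_seq_ext with (fun n => / INR (S n)); [intros; now rewrite S_INR|].
      apply (is_lim_seq_incr_1 (fun n => / INR n)).
      apply (is_lim_seq_inv INR p_infty); [apply is_lim_seq_INR|discriminate]. }
    assert (Lp : forall m, is_lim_seq (fun n => rn n ^ m) 1).
    { induction m as [|m IH]; [apply is_lim_seq_const|].
      generalize (is_lim_seq_mult' _ _ _ _ L IH). rewrite Rmult_1_l. auto. }
    apply (lim_seq_le_const (fun n => rsum (fun k => Cmod (F k) ^ 2 * rn n ^ (2 * k)) K)).
    - intros n. apply (parseval_circle F f nu (rn n) X HF (Hrn n)). intros; apply HX; auto.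
    - apply is_lim_seq_rsum. intros k _.
      generalize (is_lim_seq_scal_l _ (Cmod (F k) ^ 2) _ (Lp (2 * k)%nat)). simpl Rbar_mult.
      now rewrite Rmult_1_r. }
  destruct (bounded_ex_series (fun k => Cmod (F k) ^ 2) X) as [E1 E2]; [intros; apply pow2_ge_0|exact B|].
  split; [exact E1|]. apply sqrt_le_1_alt, E2.
Qed.

(** * A Carleson-type embedding *)

Lemma Rpower_anti x y a : 0 < x <= y -> a <= 0 -> Rpower y a <= Rpower x a.
Proof.
  intros Hx Ha. unfold Rpower. apply exp_mono.
  assert (ln x <= ln y); [|nra].
  destruct (Rle_lt_or_eq_dec x y (proj2 Hx)) as [H| ->]; [left; now apply ln_increasing|lra].
Qed.

(** * Riemann sums with an arctangent primitive *)

Section AtanSum.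
Variables (a B : R).
Hypothesis Ha : 0 < a <= 1 / 2.
Hypothesis HB : 0 < B.

(** The integrand of both sums in the Schur test: a = 1/2 for the rows, a = al / 2 for the columns.
    The substitution v = sqrt B d^a gives the primitive [V], up to the factor a sqrt B. *)
Let G d := Rpower d (a - 1) / (1 + B * Rpower d (2 * a)).
Let V d := atan (sqrt B * Rpower d a).

Lemma atan_sum_G_pos d : 0 < G d.
Proof.
  unfold G. apply Rdiv_lt_0_compat; [apply Rpower_pos|].
  generalize (Rmult_lt_0_compat _ _ HB (Rpower_pos d (2 * a))); lra.
Qed.

Lemma atan_sum_G_anti x y : 0 < x <= y -> G y <= G x.
Proof.
  intros H. unfold G, Rdiv.
  assert (Hx := Rpower_pos x (2 * a)). assert (Hy := Rpower_pos y (2 * a)).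
  assert (Rpower x (2 * a) <= Rpower y (2 * a)) by (apply Rle_Rpower_l; lra).
  apply Rmult_le_compat.
  - pos.
  - left. apply Rinv_0_lt_compat. nra.
  - apply Rpower_anti; lra.
  - apply Rinv_le_contravar; nra.
Qed.

Lemma atan_sum_V_derive d : 0 < d -> is_derive V d (a * sqrt B * G d).
Proof.
  intros Hd.
  assert (Hs := sqrt_sqrt B (Rlt_le _ _ HB)). assert (Hs0 := sqrt_lt_R0 B HB).
  unfold V, G. unfold Rpower. auto_derive; [exact Hd|].
  set (b := sqrt B) in *. rewrite <- Hs.
  replace (exp ((a - 1) * ln d)) with (exp (a * ln d) / d).
  2:{ replace ((a - 1) * ln d) with (a * ln d + - ln d) by ring.
      rewrite exp_plus, exp_Ropp, exp_ln by assumption. reflexivity. }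
  replace (exp (2 * a * ln d)) with (exp (a * ln d) * exp (a * ln d)).
  2:{ rewrite <- exp_plus. f_equal. ring. }
  assert (He := exp_pos (a * ln d)). set (e := exp (a * ln d)) in *.
  assert (0 < b * b * (e * e)) by pos.
  field. split; nra.
Qed.

Lemma atan_sum_step x y : 0 < x < y -> a * sqrt B * ((y - x) * G y) <= V y - V x.
Proof.
  intros H.
  destruct (MVT_gen V x y (fun d => a * sqrt B * G d)) as (c & Hc & E).
  - intros d Hd. rewrite Rmin_left in Hd by lra. apply atan_sum_V_derive. lra.
  - intros d Hd. rewrite Rmin_left in Hd by lra.
    apply continuity_pt_filterlim. apply (ex_derive_continuous V).
    eexists. apply atan_sum_V_derive. lra.
  - rewrite Rmin_left, Rmax_right in Hc by lra. rewrite E.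
    assert (Hs0 := sqrt_lt_R0 B HB). assert (G y <= G c) by (apply atan_sum_G_anti; lra).
    replace (a * sqrt B * G c * (y - x)) with (a * sqrt B * ((y - x) * G c)) by ring.
    apply Rmult_le_compat_l; [pos|]. apply Rmult_le_compat_l; lra.
Qed.

Lemma atan_sum h M : 0 < h ->
  rsum (fun j => h * G (INR (S j) * h)) M <= PI / (a * sqrt B).
Proof.
  intros Hh.
  assert (Hs0 := sqrt_lt_R0 B HB).
  assert (Hab : 0 < a * sqrt B) by pos.
  assert (HV : forall d, 0 < V d < PI / 2).
  { intros d. unfold V. split; [|apply atan_bound].
    rewrite <- atan_0. apply atan_increasing. pos. }
  destruct M as [|M].
  { simpl. apply Rdiv_le_0_compat; [left; apply PI_RGT_0|exact Hab]. }
  (* [G] is singular at 0, so the first term is compared with the interval [h / 2, h] of half the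
     length; hence the factor 2. *)
  assert (K : a * sqrt B * rsum (fun j => h * G (INR (S j) * h)) (S M) <= 2 * V (INR (S M) * h)).
  { induction M as [|M IH].
    - cbn [rsum]. simpl INR. rewrite Rplus_0_l, Rmult_1_l.
      assert (H := atan_sum_step (h / 2) h ltac:(lra)). generalize (HV (h / 2)). nra.
    - replace (rsum (fun j => h * G (INR (S j) * h)) (S (S M)))
        with (rsum (fun j => h * G (INR (S j) * h)) (S M) + h * G (INR (S (S M)) * h)) by reflexivity.
      assert (H0 : 0 < INR (S M)) by pos.
      assert (HS : INR (S (S M)) = INR (S M) + 1) by apply S_INR.
      assert (H := atan_sum_step (INR (S M) * h) (INR (S (S M)) * h)).
      rewrite HS in *.
      assert (H1 : 0 < INR (S M) * h < (INR (S M) + 1) * h) by nra.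
      specialize (H H1).
      replace ((INR (S M) + 1) * h - INR (S M) * h) with h in H by ring.
      assert (0 <= a * sqrt B * (h * G ((INR (S M) + 1) * h))).
      { apply Rmult_le_pos; [lra|]. apply Rmult_le_pos; [lra|left; apply atan_sum_G_pos]. }
      lra. }
  apply Rmult_le_reg_l with (a * sqrt B); [exact Hab|].
  eapply Rle_trans; [exact K|]. generalize (HV (INR (S M) * h)). intros [_ H].
  replace (a * sqrt B * (PI / (a * sqrt B))) with PI by (field; lra). lra.
Qed.

End AtanSum.

(** * The Schur test on circles *)

Lemma inv_pow_le x n : 0 < x -> x <= 2 -> (/ (1 + x)) ^ n <= 3 / (1 + INR (S n) * x).
Proof.
  intros Hx Hx2.
  (* Bernoulli at exponent n + 1 rather than n, so that the denominator fits [wt n]; the additional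
     factor 1 + x is at most 3. *)
  assert (Hb : 1 + INR (S n) * x <= (1 + x) ^ S n).
  { apply (poly (S n) x Hx). }
  assert (H0 : 0 < INR (S n)) by pos.
  assert (Hp : 0 < INR (S n) * x) by pos.
  rewrite pow_inv. apply Rle_div_r; [lra|].
  assert (Hn : 0 < (1 + x) ^ n) by (apply pow_lt; lra).
  apply Rmult_le_reg_l with ((1 + x) ^ n); [exact Hn|].
  rewrite <- Rmult_assoc, Rinv_r, Rmult_1_l by lra. eapply Rle_trans; [exact Hb|].
  simpl. rewrite Rmult_comm. apply Rmult_le_compat_l; lra.
Qed.

(** The test sequence of the Schur test. *)
Definition wt (n : nat) : R := / sqrt (INR (S n)).

Lemma wt_pos n : 0 < wt n.
Proof. apply Rinv_0_lt_compat, sqrt_lt_R0, lt_0_INR. lia. Qed.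

(** A sum of [G] with a = 1/2, B = x and step 1. *)
Lemma schur_row x N : 0 < x <= 2 ->
  rsum (fun n => (/ (1 + x)) ^ n * wt n) N <= 6 * PI / sqrt x.
Proof.
  intros Hx.
  assert (H := atan_sum (1 / 2) x ltac:(lra) ltac:(lra) 1 N ltac:(lra)).
  replace (6 * PI / sqrt x) with (3 * (PI / (1 / 2 * sqrt x))).
  2:{ field. apply Rgt_not_eq, sqrt_lt_R0; lra. }
  eapply Rle_trans; [|apply Rmult_le_compat_l; [lra|exact H]].
  rewrite <- rsum_scal. apply rsum_le. intros n _.
  assert (H0 : 0 < INR (S n)) by pos.
  rewrite Rmult_1_r, Rmult_1_l.
  replace (Rpower (INR (S n)) (1 / 2 - 1)) with (wt n).
  2:{ unfold wt. rewrite <- Rpower_sqrt, <- Rpower_Ropp by assumption. f_equal. field. }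
  replace (2 * (1 / 2)) with 1 by field. rewrite Rpower_1 by assumption.
  assert (W := wt_pos n).
  replace (3 * (wt n / (1 + x * INR (S n)))) with (3 / (1 + INR (S n) * x) * wt n).
  2:{ field. assert (0 < x * INR (S n)) by pos. lra. }
  apply Rmult_le_compat_r; [lra|]. apply inv_pow_le; lra.
Qed.

(** From sin x >= x - x^3 / 6 and x <= 2, the latter by PI <= 4. *)
Lemma sin_ge_third x : 0 <= x <= PI / 2 -> x / 3 <= sin x.
Proof.
  intros Hx. assert (HP := PI_4).
  destruct (sin_bound x 0) as [H _]; [lra|lra|].
  unfold sin_approx in H. simpl in H. unfold sin_term in H. simpl in H.
  assert (0 <= x <= 2) by lra. eapply Rle_trans; [|exact H].
  field_simplify. nra.
Qed.

Lemma Cmod_one_minus_cpt r t : 0 <= r < 1 -> 0 <= t <= PI -> t / 6 <= Cmod (1 - cpt r t).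
Proof.
  intros Hr Ht. apply Rle_trans with (sin (t / 2)).
  { replace (t / 6) with (t / 2 / 3) by field. apply sin_ge_third. lra. }
  apply Rsqr_incr_0_var; [|apply Cmod_ge_0].
  unfold Rsqr. replace (Cmod (1 - cpt r t) * Cmod (1 - cpt r t)) with (Cmod (1 - cpt r t) ^ 2) by ring.
  rewrite Cmod2_dot. unfold dot, cpt. simpl.
  assert (Hc : cos t = 1 - 2 * (sin (t / 2) * sin (t / 2))).
  { rewrite <- Rmult_assoc, <- cos_2a_sin. f_equal. field. }
  assert (Hs : sin t * sin t = 1 - cos t * cos t).
  { generalize (sin2_cos2 t). unfold Rsqr. lra. }
  assert (HB := SIN_bound (t / 2)). set (s := sin (t / 2)) in *.
  replace ((1 + - (r * cos t)) * (1 + - (r * cos t)) + (0 + - (r * sin t)) * (0 + - (r * sin t)))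
    with (1 - 2 * r * cos t + r * r * (cos t * cos t) + r * r * (sin t * sin t)) by ring.
  rewrite Hs, Hc. assert (HS : 0 <= s * s <= 1) by nra. set (S := s * s) in *.
  (* With S = sin^2 (t / 2), the difference |1 - cpt r t|^2 - S is the sum of this term and the
     next. *)
  assert (H1 : 0 <= (1 - S) * (1 - r) ^ 2) by (apply Rmult_le_pos; [lra|apply pow2_ge_0]).
  assert (H2 : 0 <= S * (r * r + 2 * r)) by (apply Rmult_le_pos; nra). lra.
Qed.

Lemma Cmod_one_minus_cpt_neg r t : Cmod (1 - cpt r (- t)) = Cmod (1 - cpt r t).
Proof.
  rewrite <- Cmod_conj. f_equal. unfold cpt, Cconj. rewrite cos_neg, sin_neg.
  apply injective_projections; simpl; ring.
Qed.

Lemma nodes_range M j : (j < M)%nat ->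
  0 < INR (S j) * (PI / (12 * INR M)) /\ INR (S j) * (PI / (12 * INR M)) <= nodes M j / 6 /\ nodes M j <= PI.
Proof.
  intros Hj. assert (HM : 0 < INR M) by pos. assert (HP := PI_RGT_0).
  assert (H0 : 0 <= INR j) by apply pos_INR.
  assert (Hd : 0 < PI / (12 * INR M)) by pos.
  unfold nodes. rewrite S_INR, plus_INR, !mult_INR. simpl (INR 2). simpl (INR 1).
  split; [|split].
  - apply Rmult_lt_0_compat; lra.
  - replace (((1 + 1) * INR j + 1) * (PI / ((1 + 1) * INR M)) / 6)
      with ((2 * INR j + 1) * (PI / (12 * INR M))) by (field; lra).
    apply Rmult_le_compat_r; lra.
  - assert (INR j + 1 <= INR M) by (rewrite <- S_INR; apply le_INR; lia).
    replace (((1 + 1) * INR j + 1) * (PI / ((1 + 1) * INR M)))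
      with ((2 * INR j + 1) / (2 * INR M) * PI) by (field; lra).
    rewrite <- (Rmult_1_l PI) at 2. apply Rmult_le_compat_r; [lra|]. apply Rle_div_l; lra.
Qed.

Lemma Rpower_le_2 al d : 0 < al < 1 -> 0 < d <= 2 -> Rpower d al <= 2.
Proof.
  intros Ha Hd. apply Rle_trans with (Rpower 2 al); [apply Rle_Rpower_l; lra|].
  rewrite <- (Rpower_1 2) at 2 by lra. apply Rle_Rpower; lra.
Qed.

(** [D j] stands for [|1 - z_j|]. *)
Lemma schur_col al c n M (D : nat -> R) : 0 < al < 1 -> 0 < c < 1 -> (0 < M)%nat ->
  (forall j, (j < M)%nat -> INR (S j) * (PI / (12 * INR M)) <= D j <= 2) ->
  rsum (fun j => Rpower (D j) (- (1 - al)) * / sqrt (c * Rpower (D j) al)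
                 * (/ (1 + c * Rpower (D j) al)) ^ n) M
  <= INR M * (72 / (c * al)) * wt n.
Proof.
  intros Ha Hc HM HD.
  assert (HMp : 0 < INR M) by pos. assert (HP := PI_RGT_0).
  set (h := PI / (12 * INR M)) in *.
  assert (Hh : 0 < h) by pos.
  assert (HSn : 0 < INR (S n)) by pos.
  (* For x = c D^al, [inv_pow_le] replaces the n-th power by 3 / (1 + B D^al), the denominator of
     [G] for a = al / 2. *)
  set (B := INR (S n) * c). assert (HB : 0 < B) by pos.
  assert (Hsc : 0 < sqrt c) by (apply sqrt_lt_R0; lra).
  assert (Hsn : 0 < sqrt (INR (S n))) by (apply sqrt_lt_R0; lra).
  assert (HS := atan_sum (al / 2) B ltac:(lra) HB h M Hh). cbv beta in HS.
  apply Rle_trans with (3 / sqrt c / h * (PI / (al / 2 * sqrt B))).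
  - eapply Rle_trans; [|apply Rmult_le_compat_l; [|exact HS]].
    2:{ left. repeat apply Rdiv_lt_0_compat; lra. }
    rewrite <- rsum_scal. apply rsum_le. intros j Hj. specialize (HD j Hj).
    set (d := INR (S j) * h) in *.
    assert (Hd : 0 < d) by (pos).
    apply Rle_trans with (3 / sqrt c * (Rpower (D j) (al / 2 - 1) / (1 + B * Rpower (D j) (2 * (al / 2))))).
    + set (x := Rpower (D j) al). assert (Hx : 0 < x) by apply Rpower_pos.
      assert (Hx2 : x <= 2) by (apply Rpower_le_2; lra).
      rewrite sqrt_mult by lra.
      replace (sqrt x) with (Rpower (D j) (al / 2)).
      2:{ rewrite <- Rpower_sqrt by exact Hx. unfold x. rewrite Rpower_mult. f_equal. }
      replace (Rpower (D j) (al / 2 - 1)) with (Rpower (D j) (- (1 - al)) * / Rpower (D j) (al / 2)).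
      2:{ rewrite <- Rpower_Ropp, <- Rpower_plus. f_equal. field. }
      replace (2 * (al / 2)) with al by field. fold x.
      assert (Hw := Rpower_pos (D j) (- (1 - al))). assert (Hv := Rpower_pos (D j) (al / 2)).
      set (w := Rpower (D j) (- (1 - al))) in *. set (v := Rpower (D j) (al / 2)) in *.
      assert (Hcx : 0 < c * x <= 2) by nra.
      assert (I := inv_pow_le (c * x) n ltac:(lra) ltac:(lra)).
      rewrite Rinv_mult.
      assert (Hpos : 0 < w * (/ sqrt c * / v)).
      { repeat apply Rmult_lt_0_compat; try apply Rinv_0_lt_compat; lra. }
      eapply Rle_trans; [apply Rmult_le_compat_l; [lra|exact I]|].
      right. unfold B. field. repeat split; try lra.
      assert (H0 : 0 < INR (S n) * c * x) by exact (Rmult_lt_0_compat _ _ HB Hx). lra.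
    + replace (3 / sqrt c / h * (h * (Rpower d (al / 2 - 1) / (1 + B * Rpower d (2 * (al / 2))))))
        with (3 / sqrt c * (Rpower d (al / 2 - 1) / (1 + B * Rpower d (2 * (al / 2))))).
      2:{ field. repeat split; try lra.
          generalize (Rmult_lt_0_compat _ _ HB (Rpower_pos d (2 * (al / 2)))); lra. }
      apply Rmult_le_compat_l; [pos|].
      (* [G] decreases, so D j may be replaced by its lower bound (j + 1) h, a node of
         [atan_sum]. *)
      apply (atan_sum_G_anti (al / 2) B ltac:(lra) HB). lra.
  - right. unfold h, B, wt. rewrite sqrt_mult by lra.
    assert (Hc2 : sqrt c * sqrt c = c) by (apply sqrt_sqrt; lra).
    rewrite <- Hc2 at 3. field. repeat split; lra.
Qed.

Lemma hval_le_abs g w y : in_H2 g -> Cmod w <= y < 1 ->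
  let v := Series (fun n => Cmod (g n) * y ^ n) in
  is_lim_seq (rsum (fun n => Cmod (g n) * y ^ n)) v /\ Cmod (hval g w) <= v.
Proof.
  intros Hg Hy v. assert (Hw0 := Cmod_ge_0 w).
  assert (P : forall n, 0 <= Cmod (g n) * y ^ n).
  { intros; pos. }
  destruct (bounded_ex_series (fun n => Cmod (g n) * y ^ n) (H2norm g * / (1 - y)) P) as [E _].
  - assert (Hm : Cmod y = y) by (rewrite Cmod_R, Rabs_pos_eq; lra).
    intros N. assert (H := H2_abs_bound g (RtoC y) Hg ltac:(rewrite Hm; lra) N). rewrite Hm in H.
    erewrite rsum_ext_lt; [exact H|]. intros k _. simpl. now rewrite Cmod_mult, Cmod_pow, Hm.
  - split; [apply is_series_rsum, Series_correct, E|].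
    apply (cser_Cmod_le _ _ _ (hval_cser g w Hg ltac:(lra))). intros N.
    eapply Rle_trans; [apply Cmod_Csum|]. eapply Rle_trans; [|apply (rsum_le_Series _ N P E)].
    apply rsum_le. intros k _. rewrite Cmod_mult, Cmod_pow.
    apply Rmult_le_compat_l; [apply Cmod_ge_0|]. apply pow_incr. lra.
Qed.

(** Cauchy-Schwarz with p = y^n wt n and q = y^n |g n|^2 / wt n. The row estimate bounds the sum of
    [p] by 6 PI / sqrt x; after exchanging the sums the column estimate cancels [wt n], and 432 = 6
    * 72. *)
Lemma schur_points al c g M (D : nat -> R) K : 0 < al < 1 -> 0 < c < 1 -> (0 < M)%nat -> in_H2 g ->
  (forall j, (j < M)%nat -> INR (S j) * (PI / (12 * INR M)) <= D j <= 2) ->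
  rsum (fun j => Rpower (D j) (- (1 - al)) *
     (rsum (fun n => Cmod (g n) * (/ (1 + c * Rpower (D j) al)) ^ n) K) ^ 2) M
  <= INR M * (432 * PI / (c * al)) * H2norm g ^ 2.
Proof.
  intros Ha Hc HM Hg HD.
  assert (HP := PI_RGT_0).
  assert (HMp : 0 < INR M) by pos.
  assert (Hdj : forall j, (j < M)%nat -> 0 < D j <= 2).
  { intros j Hj. specialize (HD j Hj). destruct (nodes_range M j Hj). lra. }
  set (y := fun j => / (1 + c * Rpower (D j) al)).
  assert (Hcx : forall j, (j < M)%nat -> 0 < c * Rpower (D j) al <= 2).
  { intros j Hj. assert (Hx := Rpower_pos (D j) al).
    assert (Hx2 := Rpower_le_2 al (D j) Ha (Hdj j Hj)). nra. }
  assert (Hy : forall j, (j < M)%nat -> 0 < y j).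
  { intros j Hj. apply Rinv_0_lt_compat. specialize (Hcx j Hj); lra. }
  apply Rle_trans with (rsum (fun j => rsum (fun n => 6 * PI * (Cmod (g n) ^ 2 * / wt n) *
     (Rpower (D j) (- (1 - al)) * / sqrt (c * Rpower (D j) al) * y j ^ n)) K) M).
  - apply rsum_le. intros j Hj. specialize (Hcx j Hj). specialize (Hy j Hj). fold (y j).
    assert (Hw := Rpower_pos (D j) (- (1 - al))). set (w := Rpower (D j) (- (1 - al))) in *.
    assert (Row := schur_row (c * Rpower (D j) al) K Hcx). fold (y j) in Row.
    set (x := c * Rpower (D j) al) in *.
    assert (Hsx : 0 < sqrt x) by (apply sqrt_lt_R0; lra).
    set (p := fun n => y j ^ n * wt n). set (q := fun n => y j ^ n * (Cmod (g n) ^ 2 * / wt n)).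
    assert (Hp : forall n, 0 <= p n).
    { intros n; apply Rmult_le_pos; [apply pow_le; lra|left; apply wt_pos]. }
    assert (Hq : forall n, 0 <= q n).
    { intros n; apply Rmult_le_pos; [apply pow_le; lra|].
      apply Rmult_le_pos; [apply pow2_ge_0|left; apply Rinv_0_lt_compat, wt_pos]. }
    assert (CS := rsum_cauchy_schwarz p q K Hp Hq).
    rewrite (rsum_ext_lt (fun k => sqrt (p k) * sqrt (q k)) (fun n => Cmod (g n) * y j ^ n)) in CS.
    2:{ intros n _. rewrite <- sqrt_mult by auto.
        assert (W := wt_pos n).
        replace (p n * q n) with ((Cmod (g n) * y j ^ n) ^ 2) by (unfold p, q; field; lra).
        apply sqrt_pow2. pos. }
    apply Rle_trans with (w * (6 * PI / sqrt x * rsum q K)).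
    + apply Rmult_le_compat_l; [lra|]. eapply Rle_trans; [exact CS|].
      apply Rmult_le_compat_r; [apply rsum_nonneg; auto|]. exact Row.
    + right. rewrite <- Rmult_assoc, <- rsum_scal. apply rsum_ext_lt. intros n _. unfold q.
      field. split; [lra|apply Rgt_not_eq, wt_pos].
  - rewrite rsum_swap.
    apply Rle_trans with (rsum (fun n => INR M * (432 * PI / (c * al)) * Cmod (g n) ^ 2) K).
    + apply rsum_le. intros n _. rewrite rsum_scal. assert (W := wt_pos n).
      assert (Col := schur_col al c n M D Ha Hc HM HD).
      apply Rle_trans with (6 * PI * (Cmod (g n) ^ 2 * / wt n) * (INR M * (72 / (c * al)) * wt n)).
      * apply Rmult_le_compat_l; [|exact Col].
        apply Rmult_le_pos; [lra|]. apply Rmult_le_pos; [apply pow2_ge_0|left; apply Rinv_0_lt_compat, W].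
      * right. field. lra.
    + rewrite rsum_scal. apply Rmult_le_compat_l.
      * apply Rmult_le_pos; [lra|]. apply Rdiv_le_0_compat; [lra|apply Rmult_lt_0_compat; lra].
      * unfold H2norm. rewrite pow2_sqrt.
        -- apply (rsum_le_Series (fun n => Cmod (g n) ^ 2)); [intros; apply pow2_ge_0|exact Hg].
        -- eapply Rle_trans; [|apply (rsum_le_Series _ O)]; [simpl; lra|intros; apply pow2_ge_0|exact Hg].
Qed.

Lemma carleson al : 0 < al < 1 -> exists C0, 0 < C0 /\
  forall F f nu g D0, psr F f nu -> in_H2 g -> 0 <= D0 ->
    (forall z, Cmod z < 1 ->
       Cmod (f z) <= D0 * Rpower (Cmod (1 - z)) (- ((1 - al) / 2)) * Cmod (hval g (phi_alpha al z))) ->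
    in_H2 F /\ H2norm F <= C0 * D0 * H2norm g.
Proof.
  intros Ha. set (c := cos (al * (PI / 2))).
  assert (Hc : 0 < c < 1) by apply cos_half_pos, Ha.
  assert (HP := PI_RGT_0).
  set (Q := 2 * (432 * PI / (c * al))).
  assert (HQ : 0 < Q).
  { apply Rmult_lt_0_compat; [lra|]. apply Rdiv_lt_0_compat; [lra|apply Rmult_lt_0_compat; lra]. }
  exists (sqrt Q). split; [now apply sqrt_lt_R0|].
  intros F f nu g D0 HF Hg HD0 Hf.
  assert (HN := H2norm_pos g).
  replace (sqrt Q * D0 * H2norm g) with (sqrt (Q * (D0 * H2norm g) ^ 2)).
  2:{ rewrite sqrt_mult_alt by lra. rewrite sqrt_pow2 by pos. ring. }
  apply (parseval_disc F f nu _ HF). intros r M Hr HM.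
  set (D := fun j => Cmod (1 - cpt r (nodes M j))).
  set (y := fun j => / (1 + c * Rpower (D j) al)).
  assert (Hz : forall t, Cmod (cpt r t) < 1) by (intros t; rewrite Cmod_cpt; lra).
  assert (HD : forall j, (j < M)%nat -> INR (S j) * (PI / (12 * INR M)) <= D j <= 2).
  { intros j Hj. destruct (nodes_range M j Hj) as (H1 & H2 & H3). split.
    - eapply Rle_trans; [exact H2|]. apply Cmod_one_minus_cpt; lra.
    - apply one_minus_Cmod, Hz. }
  assert (Hy : forall j, 0 < y j < 1).
  { intros j. assert (0 < c * Rpower (D j) al) by (pos).
    apply inv_lt_1. lra. }
  set (v := fun j => Series (fun n => Cmod (g n) * y j ^ n)).
  assert (Hv2 : forall j, is_lim_seq (rsum (fun n => Cmod (g n) * y j ^ n)) (v j) /\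
    Cmod (f (cpt r (nodes M j))) ^ 2 + Cmod (f (cpt r (- nodes M j))) ^ 2
       <= 2 * D0 ^ 2 * (Rpower (D j) (- (1 - al)) * v j ^ 2)).
  { intros j.
    assert (Hphi1 := phi_mod_le al _ Ha (Hz (nodes M j))).
    assert (Hphi2 := phi_mod_le al _ Ha (Hz (- nodes M j))). rewrite Cmod_one_minus_cpt_neg in Hphi2.
    fold (D j) c (y j) in Hphi1, Hphi2. specialize (Hy j).
    destruct (hval_le_abs g _ (y j) Hg (conj Hphi1 (proj2 Hy))) as (V1 & V2).
    destruct (hval_le_abs g _ (y j) Hg (conj Hphi2 (proj2 Hy))) as (_ & V2').
    split; [exact V1|]. fold (v j) in V2, V2'.
    assert (F1 := Hf _ (Hz (nodes M j))). assert (F2 := Hf _ (Hz (- nodes M j))).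
    rewrite Cmod_one_minus_cpt_neg in F2. fold (D j) in F1, F2.
    assert (Hw := Rpower_pos (D j) (- ((1 - al) / 2))).
    assert (Hw2 : Rpower (D j) (- (1 - al)) = Rpower (D j) (- ((1 - al) / 2)) * Rpower (D j) (- ((1 - al) / 2))).
    { rewrite <- Rpower_plus. f_equal. field. }
    rewrite Hw2. set (w := Rpower (D j) (- ((1 - al) / 2))) in *.
    assert (Hsq : forall t, Cmod (f (cpt r t)) <= D0 * w * Cmod (hval g (phi_alpha al (cpt r t))) ->
       Cmod (hval g (phi_alpha al (cpt r t))) <= v j -> Cmod (f (cpt r t)) ^ 2 <= D0 ^ 2 * (w * w * v j ^ 2)).
    { intros t A1 A2. replace (D0 ^ 2 * (w * w * v j ^ 2)) with ((D0 * w * v j) ^ 2) by ring.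
      apply pow_incr. split; [apply Cmod_ge_0|]. eapply Rle_trans; [exact A1|].
      apply Rmult_le_compat_l; [pos|exact A2]. }
    assert (S1 := Hsq _ F1 V2). assert (S2 := Hsq _ F2 V2'). lra. }
  eapply Rle_trans; [apply rsum_le; intros j _; apply Hv2|].
  rewrite rsum_scal.
  replace (INR M * (Q * (D0 * H2norm g) ^ 2)) with (2 * D0 ^ 2 * (INR M * (432 * PI / (c * al)) * H2norm g ^ 2)).
  2:{ unfold Q. field. lra. }
  apply Rmult_le_compat_l; [generalize (pow2_ge_0 D0); lra|].
  apply (lim_seq_le_const (fun K => rsum (fun j => Rpower (D j) (- (1 - al)) *
     (rsum (fun n => Cmod (g n) * y j ^ n) K) ^ 2) M)).
  - intros K. apply schur_points; assumption.
  - apply is_lim_seq_rsum. intros j _. destruct (Hv2 j) as [L _].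
    generalize (is_lim_seq_scal_l _ (Rpower (D j) (- (1 - al))) _ (is_lim_seq_mult' _ _ _ _ L L)).
    simpl Rbar_mult.
    replace (v j ^ 2) with (v j * v j) by ring. intros H. eapply is_lim_seq_ext; [|exact H].
    intros n. simpl. ring.
Qed.

(** * The Hardy space *)

Lemma one_minus_Cmod2_pos w : Cmod w < 1 -> 0 < 1 - Cmod w ^ 2.
Proof. intros H. assert (0 <= Cmod w) by apply Cmod_ge_0. nra. Qed.

Lemma in_H2_of_bound a M : (forall N, rsum (fun k => Cmod (a k) ^ 2) N <= M ^ 2) -> 0 <= M ->
  in_H2 a /\ H2norm a <= M.
Proof.
  intros H HM.
  destruct (bounded_ex_series (fun k => Cmod (a k) ^ 2) (M ^ 2)) as [E1 E2]; [intros; apply pow2_ge_0|exact H|].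
  split; [exact E1|]. unfold H2norm. rewrite <- (sqrt_pow2 M HM). now apply sqrt_le_1_alt.
Qed.

Lemma H2norm_partial a N : in_H2 a -> rsum (fun k => Cmod (a k) ^ 2) N <= H2norm a ^ 2.
Proof.
  intros H. unfold H2norm. rewrite pow2_sqrt.
  - apply (rsum_le_Series (fun k => Cmod (a k) ^ 2)); [intros; apply pow2_ge_0|exact H].
  - eapply Rle_trans; [|apply (rsum_le_Series (fun k => Cmod (a k) ^ 2) O)];
      [simpl; lra|intros; apply pow2_ge_0|exact H].
Qed.

Lemma in_H2_lin a b (l : C) : in_H2 a -> in_H2 b -> in_H2 (fun k => a k + l * b k)%C.
Proof.
  intros Ha Hb.
  set (M := sqrt (2 * H2norm a ^ 2 + 2 * Cmod l ^ 2 * H2norm b ^ 2)).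
  assert (P : 0 <= 2 * H2norm a ^ 2 + 2 * Cmod l ^ 2 * H2norm b ^ 2).
  { assert (A := pow2_ge_0 (H2norm a)). assert (B := pow2_ge_0 (Cmod l * H2norm b)).
    rewrite Rpow_mult_distr in B. lra. }
  apply (in_H2_of_bound _ M); [|apply sqrt_pos].
  intros N. unfold M. rewrite pow2_sqrt by exact P.
  apply Rle_trans with (rsum (fun k => 2 * Cmod (a k) ^ 2 + 2 * Cmod l ^ 2 * Cmod (b k) ^ 2) N).
  - apply rsum_le. intros k _.
    apply Rle_trans with ((Cmod (a k) + Cmod l * Cmod (b k)) ^ 2).
    + apply pow_incr. split; [apply Cmod_ge_0|]. rewrite <- Cmod_mult. apply Cmod_triangle.
    + assert (H := pow2_ge_0 (Cmod (a k) - Cmod l * Cmod (b k))). nra.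
  - rewrite rsum_plus, !rsum_scal.
    assert (A := H2norm_partial a N Ha). assert (B := H2norm_partial b N Hb).
    apply Rplus_le_compat; [lra|]. apply Rmult_le_compat_l; [|exact B].
    generalize (pow2_ge_0 (Cmod l)); lra.
Qed.

Lemma in_H2_zero : in_H2 (fun _ => RtoC 0).
Proof.
  apply (in_H2_of_bound _ 0); [|lra]. intros N.
  rewrite (rsum_ext_lt _ (fun _ => 0)) by (intros; rewrite Cmod_0; ring).
  rewrite rsum_const. lra.
Qed.

Lemma in_H2_Csum (c : nat -> C) (g : nat -> nat -> C) n :
  (forall i, in_H2 (g i)) -> in_H2 (fun k => Csum (fun i => c i * g i k)%C n).
Proof.
  intros H. induction n as [|n IH]; [apply in_H2_zero|]. apply (in_H2_lin _ _ (c n) IH (H n)).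
Qed.

Lemma hval_lin a b l w : in_H2 a -> in_H2 b -> Cmod w < 1 ->
  hval (fun k => a k + l * b k)%C w = (hval a w + l * hval b w)%C.
Proof.
  intros Ha Hb Hw. apply cser_Cser.
  apply (cser_ext (fun k => a k * w ^ k + l * (b k * w ^ k))%C); [intros; ring|].
  apply cser_plus; [|apply cser_scal]; apply hval_cser; assumption.
Qed.

Lemma hval_Csum (c : nat -> C) (g : nat -> nat -> C) n w :
  (forall i, in_H2 (g i)) -> Cmod w < 1 ->
  hval (fun k => Csum (fun i => c i * g i k)%C n) w = Csum (fun i => c i * hval (g i) w)%C n.
Proof.
  intros H Hw. induction n as [|n IH]; cbn [Csum].
  - apply cser_Cser, (cser_finite _ O). intros; ring.
  - rewrite <- IH. apply hval_lin; auto. now apply in_H2_Csum.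
Qed.

Lemma psr_hval a : in_H2 a -> psr a (hval a) (fun r => H2norm a * / (1 - r)).
Proof.
  intros Ha. apply psr_intro. intros z Hz. split; [now apply hval_cser|now apply H2_abs_bound].
Qed.

(** As |1 - z| <= 2, the weight is at least 1/2, so the trivial multiplier 1 is covered by
    [carleson] with D0 = 2. *)
Lemma Rpower_weight_ge al z : 0 < al < 1 -> Cmod z < 1 ->
  1 <= 2 * Rpower (Cmod (1 - z)) (- ((1 - al) / 2)).
Proof.
  intros Hal Hz. destruct (one_minus_Cmod z Hz) as [D1 D2].
  assert (H : Rpower 2 (- ((1 - al) / 2)) <= Rpower (Cmod (1 - z)) (- ((1 - al) / 2))) by (apply Rpower_anti; lra).
  assert (H2 : Rpower 2 (Ropp 1) <= Rpower 2 (- ((1 - al) / 2))) by (apply Rle_Rpower; lra).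
  rewrite Rpower_Ropp, Rpower_1 in H2 by lra. lra.
Qed.

(** The choice made in [Comp_op] acquires its meaning from the existence of a coefficient sequence:
    [comp_phi_psr] builds it and [carleson] makes it square summable. *)
Lemma Comp_op_spec al a : 0 < al < 1 -> in_H2 a ->
  in_H2 (Comp_op (phi_alpha al) a) /\
  forall z, Cmod z < 1 -> hval (Comp_op (phi_alpha al) a) z = hval a (phi_alpha al z).
Proof.
  intros Hal Ha.
  assert (E : exists b, is_comp (phi_alpha al) a b).
  { destruct (comp_phi_psr al a Hal Ha) as (b & nu & Hb).
    destruct (carleson al Hal) as (C0 & HC0 & HC).
    exists b. split.
    - apply (HC b _ nu a 2 Hb Ha); [lra|]. intros z Hz.
      rewrite <- (Rmult_1_l (Cmod _)) at 1. apply Rmult_le_compat_r; [apply Cmod_ge_0|].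
      now apply Rpower_weight_ge.
    - intros z Hz. exists (hval a (phi_alpha al z)). split; apply is_series_cser.
      + apply hval_cser; [exact Ha|now apply phi_mod_lt].
      + apply Hb, Hz. }
  unfold Comp_op.
  destruct (epsilon_spec (inhabits (fun _ : nat => RtoC 0)) (fun b => is_comp (phi_alpha al) a b) E) as [H1 H2].
  set (b := epsilon _ _) in *. split; [exact H1|].
  intros z Hz. destruct (H2 z Hz) as (v & V1 & V2).
  apply is_series_cser in V1. apply is_series_cser in V2.
  unfold hval. now rewrite (cser_Cser _ _ V1), (cser_Cser _ _ V2).
Qed.

(** * Division by a Blaschke factor *)

Lemma Cconj_R (x : R) : Cconj x = x.
Proof. unfold Cconj, RtoC; simpl. now rewrite Ropp_0. Qed.

Definition blf (lam w : C) : C := ((w - lam) / (1 - Cconj lam * w))%C.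

Lemma one_minus_neq lam w : Cmod lam < 1 -> Cmod w < 1 -> (1 - lam * w)%C <> 0.
Proof.
  intros Hl Hw E.
  assert (H : (lam * w)%C = 1) by (replace (lam * w)%C with (1 - (1 - lam * w))%C by ring; rewrite E; ring).
  apply (f_equal Cmod) in H. rewrite Cmod_mult, Cmod_1 in H.
  assert (0 <= Cmod lam) by apply Cmod_ge_0. assert (0 <= Cmod w) by apply Cmod_ge_0. nra.
Qed.

(** The sequence (1 - lam S)^(-1) f, with S the backward shift; its term of index 0 is f(lam). *)
Definition hseq (lam : R) (f : nat -> C) (k : nat) : C :=
  Cser (fun m => RtoC (lam ^ m) * f (k + m)%nat)%C.

(** The adjoint of multiplication by the Blaschke factor [blf lam]. *)
Definition bshift (lam : R) (f : nat -> C) (k : nat) : C :=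
  (hseq lam f (S k) - RtoC lam * hseq lam f k)%C.

Lemma hseq_bound lam f k M : 0 <= lam < 1 -> (forall m, Cmod (f (k + m)%nat) <= M) ->
  forall N, rsum (fun m => Cmod (RtoC (lam ^ m) * f (k + m)%nat)) N <= M * / (1 - lam).
Proof.
  intros Hl Hf N. assert (HM : 0 <= M) by (eapply Rle_trans; [apply Cmod_ge_0|apply (Hf O)]).
  apply Rle_trans with (rsum (fun m => M * lam ^ m) N).
  - apply rsum_le. intros m _. rewrite Cmod_mult, Cmod_R, Rabs_pos_eq by (apply pow_le; lra).
    rewrite Rmult_comm. apply Rmult_le_compat_r; [apply pow_le; lra|apply Hf].
  - rewrite rsum_scal. apply Rmult_le_compat_l; [exact HM|]. now apply rsum_geom_le.
Qed.

Lemma hseq_cser lam f k : 0 <= lam < 1 -> in_H2 f ->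
  cser (fun m => RtoC (lam ^ m) * f (k + m)%nat)%C (hseq lam f k).
Proof.
  intros Hl Hf. eapply abs_cser, (hseq_bound lam f k (H2norm f) Hl). intros; now apply in_H2_bound.
Qed.

Lemma hseq_rec lam f k : 0 <= lam < 1 -> in_H2 f ->
  hseq lam f k = (f k + RtoC lam * hseq lam f (S k))%C.
Proof.
  intros Hl Hf. apply cser_Cser.
  assert (H := cser_scal (RtoC lam) _ _ (hseq_cser lam f (S k) Hl Hf)).
  apply (cser_ext _ (fun m => RtoC (lam ^ S m) * f (k + S m)%nat)%C) in H.
  - apply (proj1 (cser_shift (fun m => RtoC (lam ^ m) * f (k + m)%nat)%C _)) in H.
    simpl in H. rewrite Nat.add_0_r, Cmult_1_l in H. exact H.
  - intros m. simpl. rewrite RtoC_mult. replace (k + S m)%nat with (S (k + m)) by lia. ring.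
Qed.

Lemma hseq_lin lam a b (l : C) k : 0 <= lam < 1 -> in_H2 a -> in_H2 b ->
  hseq lam (fun k => a k + l * b k)%C k = (hseq lam a k + l * hseq lam b k)%C.
Proof.
  intros Hl Ha Hb. apply cser_Cser.
  apply (cser_ext (fun m => RtoC (lam ^ m) * a (k + m)%nat + l * (RtoC (lam ^ m) * b (k + m)%nat))%C);
    [intros; ring|].
  apply cser_plus; [|apply cser_scal]; apply hseq_cser; assumption.
Qed.

Lemma bshift_lin lam a b (l : C) : 0 <= lam < 1 -> in_H2 a -> in_H2 b ->
  bshift lam (fun k => a k + l * b k)%C = (fun k => bshift lam a k + l * bshift lam b k)%C.
Proof.
  intros Hl Ha Hb. apply functional_extensionality. intros k. unfold bshift.
  rewrite !hseq_lin by assumption. ring.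
Qed.

Lemma Cmod_hseq_lim lam f : 0 <= lam < 1 -> in_H2 f -> is_lim_seq (fun k => Cmod (hseq lam f k) ^ 2) 0.
Proof.
  intros Hl Hf.
  assert (L : is_lim_seq (fun k => Cmod (hseq lam f k)) 0).
  { apply is_lim_seq_spec. intros eps.
    assert (He : 0 < eps * (1 - lam) / 2).
    { apply Rdiv_lt_0_compat; [|lra]. apply Rmult_lt_0_compat; [apply cond_pos|lra]. }
    assert (L0 := ex_series_lim_0 _ Hf). apply is_lim_seq_spec in L0.
    destruct (L0 (mkposreal _ (pow_lt _ 2 He))) as [N HN]. exists N. intros k Hk.
    rewrite Rminus_0_r, Rabs_pos_eq by apply Cmod_ge_0.
    apply Rle_lt_trans with (eps * (1 - lam) / 2 * / (1 - lam)).
    - apply Cmod_Cser_le, hseq_bound; [exact Hl|]. intros m.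
      specialize (HN (k + m)%nat ltac:(lia)). simpl in HN.
      rewrite Rminus_0_r, Rabs_pos_eq in HN by (apply (pow2_ge_0 (Cmod (f (k + m)%nat)))).
      apply Rsqr_incr_0_var; [unfold Rsqr; lra|lra].
    - replace (eps * (1 - lam) / 2 * / (1 - lam)) with (eps / 2) by (field; lra).
      generalize (cond_pos eps); lra. }
  generalize (is_lim_seq_mult' _ _ _ _ L L). rewrite Rmult_0_l. intros H.
  eapply is_lim_seq_ext; [|exact H]. intros; simpl; ring.
Qed.

(** With h = hseq lam f, one has f_k = h_k - lam h_(k+1) and the shifted term is h_(k+1) - lam h_k,
    so the difference of squared moduli telescopes to (1 - lam^2) (|h_0|^2 - |h_N|^2), and h_N tends
    to 0. *)
Lemma bshift_contract lam f : 0 <= lam < 1 -> in_H2 f ->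
  in_H2 (bshift lam f) /\ H2norm (bshift lam f) <= H2norm f.
Proof.
  intros Hl Hf. set (h := hseq lam f).
  assert (T : forall N, rsum (fun k => Cmod (bshift lam f k) ^ 2) N
     = rsum (fun k => Cmod (f k) ^ 2) N - (1 - lam ^ 2) * (Cmod (h O) ^ 2 - Cmod (h N) ^ 2)).
  { induction N as [|N IH]; cbn [rsum]; [ring|]. rewrite IH.
    assert (E : f N = (h N - RtoC lam * h (S N))%C).
    { unfold h. rewrite (hseq_rec lam f N Hl Hf). ring. }
    rewrite E. unfold bshift. fold h. rewrite !Cmod2_dot. unfold dot; simpl. ring. }
  apply in_H2_of_bound; [|apply H2norm_pos].
  intros N. apply le_epsilon. intros e He.
  assert (L := Cmod_hseq_lim lam f Hl Hf). apply is_lim_seq_spec in L.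
  destruct (L (mkposreal e He)) as [N0 HN0]. specialize (HN0 (N + N0)%nat ltac:(lia)). simpl pos in HN0.
  rewrite Rminus_0_r, Rabs_pos_eq in HN0 by apply pow2_ge_0. fold h in HN0.
  apply Rle_trans with (rsum (fun k => Cmod (bshift lam f k) ^ 2) (N + N0)).
  - apply rsum_mono; [intros; apply pow2_ge_0|lia].
  - rewrite T. assert (P := H2norm_partial f (N + N0) Hf).
    assert (A := pow2_ge_0 (Cmod (h O))). assert (B := pow2_ge_0 (Cmod (h (N + N0)%nat))).
    assert (0 <= 1 - lam ^ 2 <= 1) by nra. set (x := Cmod (h O) ^ 2) in *.
    set (y := Cmod (h (N + N0)%nat) ^ 2) in *. nra.
Qed.

(** Division with remainder by a Blaschke factor; the remainder carries the value f(lam). With H the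
    generating function of [hseq] and H = h_0 + w H1, one has f = H - lam H1 and the quotient is H1
    - lam H. *)
Lemma hval_bshift lam f w : 0 <= lam < 1 -> in_H2 f -> Cmod w < 1 ->
  hval f w = (blf lam w * hval (bshift lam f) w
              + hseq lam f O * (RtoC (1 - lam ^ 2) / (1 - RtoC lam * w)))%C.
Proof.
  intros Hl Hf Hw. set (h := hseq lam f).
  assert (Hlm : Cmod lam < 1) by (rewrite Cmod_R, Rabs_pos_eq; lra).
  assert (Hh : forall k, Cmod (h k) <= H2norm f * / (1 - lam)).
  { intros k. apply Cmod_Cser_le, hseq_bound; [exact Hl|]. intros; now apply in_H2_bound. }
  assert (HH : cser (fun k => h k * w ^ k)%C (Cser (fun k => h k * w ^ k)%C)).
  { exact (abs_cser _ _ (rsum_geom_majorized h w _ Hh Hw)). }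
  set (H := Cser (fun k => h k * w ^ k)%C) in *.
  assert (HH1 : exists H1, cser (fun k => h (S k) * w ^ k)%C H1 /\ H = (h O + w * H1)%C).
  { assert (A := abs_cser _ _ (rsum_geom_majorized (fun k => h (S k)) w _ (fun k => Hh (S k)) Hw)).
    exists (Cser (fun k => h (S k) * w ^ k)%C). split; [exact A|].
    apply (cser_unique _ _ _ HH). apply (cser_scal w) in A.
    apply (cser_ext _ (fun k => h (S k) * w ^ S k)%C) in A; [|intros; simpl; ring].
    apply (proj1 (cser_shift (fun k => h k * w ^ k)%C _)) in A. simpl in A.
    rewrite Cmult_1_r in A. exact A. }
  destruct HH1 as (H1 & A1 & A2).
  assert (Ef : hval f w = (H - RtoC lam * H1)%C).
  { apply cser_Cser. apply (cser_ext (fun k => h k * w ^ k - RtoC lam * (h (S k) * w ^ k))%C).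
    - intros k. unfold h. rewrite (hseq_rec lam f k Hl Hf). ring.
    - apply cser_minus; [exact HH|]. apply cser_scal, A1. }
  assert (Eg : hval (bshift lam f) w = (H1 - RtoC lam * H)%C).
  { apply cser_Cser. apply (cser_ext (fun k => h (S k) * w ^ k - RtoC lam * (h k * w ^ k))%C).
    - intros k. unfold bshift. fold h. ring.
    - apply cser_minus; [exact A1|]. apply cser_scal, HH. }
  rewrite Ef, Eg. fold h. unfold blf.
  rewrite Cconj_R.
  rewrite RtoC_minus. replace (lam ^ 2) with (lam * lam) by ring. rewrite RtoC_mult.
  replace (h O) with (H - w * H1)%C by (rewrite A2; ring).
  field. now apply one_minus_neq.
Qed.

(** * Multiplication by a Blaschke factor *)

(** Coefficients of g(w) / (1 - conj lam w); multiplication by w - lam then gives [fshift]. *)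
Fixpoint fseq (lam : C) (g : nat -> C) (k : nat) : C :=
  match k with O => g O | S j => (g (S j) + Cconj lam * fseq lam g j)%C end.

Definition fshift (lam : C) (g : nat -> C) (k : nat) : C :=
  match k with
  | O => (- (lam * g O))%C
  | S j => (fseq lam g j - lam * fseq lam g (S j))%C
  end.

(** The finite form of the fact that a Blaschke factor is unimodular on the circle. The right side
    is the defect of the truncation, and its sign gives the contraction. *)
Lemma fshift_sum lam g N :
  rsum (fun k => Cmod (g k) ^ 2) (S N) - rsum (fun k => Cmod (fshift lam g k) ^ 2) (S N)
  = (1 - Cmod lam ^ 2) * Cmod (fseq lam g N) ^ 2.
Proof.
  induction N as [|N IH].
  - cbn [rsum fshift fseq]. rewrite !Cmod2_dot. unfold dot; simpl. ring.
  - change (rsum (fun k => Cmod (g k) ^ 2) (S (S N))) with (rsum (fun k => Cmod (g k) ^ 2) (S N) + Cmod (g (S N)) ^ 2).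
    change (rsum (fun k => Cmod (fshift lam g k) ^ 2) (S (S N)))
      with (rsum (fun k => Cmod (fshift lam g k) ^ 2) (S N) + Cmod (fshift lam g (S N)) ^ 2).
    replace (g (S N)) with (fseq lam g (S N) - Cconj lam * fseq lam g N)%C by (simpl; ring).
    cbn [fshift].
    match goal with |- ?a + ?b - (?c + ?d) = _ => replace (a + b - (c + d)) with ((a - c) + (b - d)) by ring end.
    rewrite IH. rewrite !Cmod2_dot. unfold dot, Cconj; cbn -[fseq]. ring.
Qed.

Lemma fshift_contract lam g : Cmod lam < 1 -> in_H2 g ->
  in_H2 (fshift lam g) /\ H2norm (fshift lam g) <= H2norm g.
Proof.
  intros Hl Hg. assert (H0 := Cmod_ge_0 lam).
  apply in_H2_of_bound; [|apply H2norm_pos]. intros N.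
  apply Rle_trans with (rsum (fun k => Cmod (fshift lam g k) ^ 2) (S N)).
  - apply rsum_mono; [intros; apply pow2_ge_0|lia].
  - assert (E := fshift_sum lam g N). assert (P := H2norm_partial g (S N) Hg).
    assert (0 <= (1 - Cmod lam ^ 2) * Cmod (fseq lam g N) ^ 2); [|lra].
    apply Rmult_le_pos; [nra|apply pow2_ge_0].
Qed.

Lemma fseq_bound lam g k : Cmod lam < 1 -> in_H2 g ->
  Cmod (fseq lam g k) <= H2norm g * / (1 - Cmod lam).
Proof.
  intros Hl Hg. assert (H0 := Cmod_ge_0 lam). assert (HN := H2norm_pos g).
  assert (Hi : 1 <= / (1 - Cmod lam)).
  { rewrite <- Rinv_1 at 1. apply Rinv_le_contravar; lra. }
  induction k as [|k IH]; cbn [fseq].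
  - eapply Rle_trans; [apply in_H2_bound, Hg|]. nra.
  - eapply Rle_trans; [apply Cmod_triangle|]. rewrite Cmod_mult, Cmod_conj.
    assert (H := in_H2_bound g Hg (S k)).
    replace (H2norm g * / (1 - Cmod lam)) with (H2norm g + Cmod lam * (H2norm g * / (1 - Cmod lam))) by (field; lra).
    apply Rplus_le_compat; [exact H|]. now apply Rmult_le_compat_l.
Qed.

Lemma hval_fshift lam g w : Cmod lam < 1 -> in_H2 g -> Cmod w < 1 ->
  hval (fshift lam g) w = (blf lam w * hval g w)%C.
Proof.
  intros Hl Hg Hw. set (h := fseq lam g).
  assert (HH : cser (fun k => h k * w ^ k)%C (Cser (fun k => h k * w ^ k)%C)).
  { exact (abs_cser _ _ (rsum_geom_majorized h w _ (fun k => fseq_bound lam g k Hl Hg) Hw)). }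
  set (H := Cser (fun k => h k * w ^ k)%C) in *.
  assert (Hs : cser (fun k => match k with O => RtoC 0 | S j => h j * w ^ S j end)%C (w * H)%C).
  { replace (w * H)%C with (RtoC 0 + w * H)%C by ring.
    apply (proj1 (cser_shift (fun k => match k with O => RtoC 0 | S j => h j * w ^ S j end)%C _)).
    apply (cser_ext (fun k => w * (h k * w ^ k))%C); [intros; simpl; ring|]. apply cser_scal, HH. }
  assert (Eg : hval g w = (H - Cconj lam * (w * H))%C).
  { apply cser_Cser.
    apply (cser_ext (fun k => h k * w ^ k - Cconj lam * (match k with O => RtoC 0 | S j => h j * w ^ S j end))%C).
    - intros [|k]; unfold h; simpl; ring.
    - apply cser_minus; [exact HH|]. apply cser_scal, Hs. }
  assert (Ef : hval (fshift lam g) w = (w * H - lam * H)%C).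
  { apply cser_Cser.
    apply (cser_ext (fun k => (match k with O => RtoC 0 | S j => h j * w ^ S j end) - lam * (h k * w ^ k))%C).
    - intros [|k]; unfold h; simpl; ring.
    - apply cser_minus; [exact Hs|]. apply cser_scal, HH. }
  rewrite Ef, Eg. unfold blf. field. apply one_minus_neq; [now rewrite Cmod_conj|exact Hw].
Qed.

(** The reproducing kernel of H^2 at [lam]. *)
Definition kern (lam : C) (k : nat) : C := (Cconj lam ^ k)%C.

Lemma kern_H2 lam : Cmod lam < 1 -> in_H2 (kern lam) /\ H2norm (kern lam) <= / sqrt (1 - Cmod lam ^ 2).
Proof.
  intros Hl. assert (Hp := one_minus_Cmod2_pos lam Hl).
  assert (Hs := sqrt_lt_R0 _ Hp).
  apply in_H2_of_bound; [|pos].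
  intros N. rewrite pow_inv, pow2_sqrt by lra.
  rewrite (rsum_ext_lt _ (fun k => (Cmod lam ^ 2) ^ k)).
  - apply rsum_geom_le. split; [apply pow2_ge_0|lra].
  - intros k _. unfold kern. rewrite Cmod_pow, Cmod_conj, <- !pow_mult. f_equal. lia.
Qed.

Lemma hval_kern lam w : Cmod lam < 1 -> Cmod w < 1 -> hval (kern lam) w = (/ (1 - Cconj lam * w))%C.
Proof.
  intros Hl Hw. apply cser_Cser.
  apply (cser_ext (fun k => (Cconj lam * w) ^ k)%C); [intros; apply Cpow_mult_l|].
  apply cser_geom. rewrite Cmod_mult, Cmod_conj.
  assert (0 <= Cmod lam) by apply Cmod_ge_0. assert (0 <= Cmod w) by apply Cmod_ge_0. nra.
Qed.

(** * Finite Blaschke products and the upper bound for approximation numbers *)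

Fixpoint blp (lam : nat -> C) (n : nat) (w : C) : C :=
  match n with O => RtoC 1 | S m => (blp lam m w * blf (lam m) w)%C end.

Fixpoint blshift (lam : nat -> C) (n : nat) (g : nat -> C) : nat -> C :=
  match n with O => g | S m => fshift (lam m) (blshift lam m g) end.

Lemma blshift_spec lam n g : (forall j, Cmod (lam j) < 1) -> in_H2 g ->
  in_H2 (blshift lam n g) /\ H2norm (blshift lam n g) <= H2norm g /\
  forall w, Cmod w < 1 -> hval (blshift lam n g) w = (blp lam n w * hval g w)%C.
Proof.
  intros Hl Hg. induction n as [|n (I1 & I2 & I3)]; cbn [blshift blp].
  - split; [exact Hg|]. split; [lra|]. intros; ring.
  - destruct (fshift_contract (lam n) _ (Hl n) I1) as [F1 F2]. split; [exact F1|]. split; [lra|].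
    intros w Hw. rewrite hval_fshift, I3 by auto. ring.
Qed.

Fixpoint quot (lam : nat -> R) (n : nat) (f : nat -> C) : nat -> C :=
  match n with O => f | S m => bshift (lam m) (quot lam m f) end.

Lemma quot_H2 lam n f : (forall j, 0 <= lam j < 1) -> in_H2 f ->
  in_H2 (quot lam n f) /\ H2norm (quot lam n f) <= H2norm f.
Proof.
  intros Hl Hf. induction n as [|n [I1 I2]]; cbn [quot].
  - split; [exact Hf|lra].
  - destruct (bshift_contract (lam n) _ (Hl n) I1). split; [assumption|lra].
Qed.

Lemma quot_lin lam n a b (l : C) : (forall j, 0 <= lam j < 1) -> in_H2 a -> in_H2 b ->
  quot lam n (fun k => a k + l * b k)%C = (fun k => quot lam n a k + l * quot lam n b k)%C.
Proof.
  intros Hl Ha Hb. induction n as [|n IH]; cbn [quot]; [reflexivity|].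
  rewrite IH. apply bshift_lin; [apply Hl| |]; now apply quot_H2.
Qed.

Lemma Rlam_lt (lam : nat -> R) j : (forall j, 0 <= lam j < 1) -> Cmod (RtoC (lam j)) < 1.
Proof. intros H. specialize (H j). rewrite Cmod_R, Rabs_pos_eq; lra. Qed.

(** The Takenaka-Malmquist-Walsh system, up to scaling. *)
Definition tmw (lam : nat -> R) (j : nat) : nat -> C :=
  fun k => (RtoC 0 + RtoC (1 - lam j ^ 2) * blshift (fun i => RtoC (lam i)) j (kern (lam j)) k)%C.

Lemma tmw_spec lam j : (forall j, 0 <= lam j < 1) ->
  in_H2 (tmw lam j) /\ forall w, Cmod w < 1 ->
    hval (tmw lam j) w = (blp (fun i => RtoC (lam i)) j w * (RtoC (1 - lam j ^ 2) / (1 - RtoC (lam j) * w)))%C.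
Proof.
  intros Hl. assert (Hj := Rlam_lt lam j Hl).
  destruct (kern_H2 _ Hj) as [K1 _].
  destruct (blshift_spec (fun i => RtoC (lam i)) j _ (fun i => Rlam_lt lam i Hl) K1) as (B1 & _ & B3).
  split.
  - exact (in_H2_lin _ _ _ in_H2_zero B1).
  - intros w Hw. unfold tmw. rewrite (hval_lin (fun _ => RtoC 0)) by (auto using in_H2_zero).
    rewrite B3, hval_kern by auto.
    replace (hval (fun _ => RtoC 0) w) with (RtoC 0).
    + rewrite Cconj_R. unfold Cdiv. ring.
    + symmetry. apply cser_Cser, (cser_finite _ O). intros; ring.
Qed.

(** Iterates [hval_bshift] on the successive quotients. The coefficients of the sum are linear
    functionals of [f], so that the sum is an operator of rank at most n. *)
Lemma hval_expand lam n f w : (forall j, 0 <= lam j < 1) -> in_H2 f -> Cmod w < 1 ->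
  hval f w = (Csum (fun j => hseq (lam j) (quot lam j f) O * hval (tmw lam j) w) n
              + blp (fun i => RtoC (lam i)) n w * hval (quot lam n f) w)%C.
Proof.
  intros Hl Hf Hw. induction n as [|n IH]; cbn [Csum blp quot]; [ring|].
  rewrite IH at 1. destruct (quot_H2 lam n f Hl Hf) as [Q1 _].
  rewrite (hval_bshift (lam n) (quot lam n f) w (Hl n) Q1 Hw).
  destruct (tmw_spec lam n Hl) as [_ T]. rewrite T by exact Hw. ring.
Qed.

Lemma approx_number_upper al : 0 < al < 1 -> exists C0, 0 < C0 /\
  forall n lam D0, (1 <= n)%nat -> (forall j, 0 <= lam j < 1) -> 0 <= D0 ->
    (forall z, Cmod z < 1 -> Cmod (blp (fun i => RtoC (lam i)) (n - 1) (phi_alpha al z))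
       <= D0 * Rpower (Cmod (1 - z)) (- ((1 - al) / 2))) ->
    Rbar_le (approx_number (Comp_op (phi_alpha al)) n) (C0 * D0).
Proof.
  intros Ha. destruct (carleson al Ha) as (C0 & HC0 & HC). exists C0. split; [exact HC0|].
  intros n lam D0 Hn Hl HD0 HB. set (T := Comp_op (phi_alpha al)).
  assert (HT : forall a, in_H2 a -> in_H2 (T a) /\ forall z, Cmod z < 1 -> hval (T a) z = hval a (phi_alpha al z)).
  { intros a; now apply Comp_op_spec. }
  (* The images under composition of the remainders in [hval_expand]. With n - 1 zeros, T a - R a is
     (B o phi) times the quotient composed with the symbol. *)
  set (R := fun a k => Csum (fun j => hseq (lam j) (quot lam j a) O * T (tmw lam j) k)%C (n - 1)).
  assert (HG : forall j, in_H2 (T (tmw lam j))) by (intros j; apply HT, tmw_spec, Hl).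
  apply (proj1 (Glb_Rbar_correct _)). split; [pos|].
  exists R. split; [|split].
  - intros a b l Hia Hib. apply functional_extensionality. intros k. unfold R.
    rewrite <- Csum_scal, <- Csum_plus. apply Csum_ext_lt. intros j _.
    rewrite quot_lin by assumption. rewrite hseq_lin; [ring|apply Hl| |]; now apply quot_H2.
  - exists (fun j => T (tmw lam j)). split; [exact HG|]. intros a Hia.
    exists (fun j => hseq (lam j) (quot lam j a) O). intros k. reflexivity.
  - intros a Hia. destruct (HT a Hia) as [T1 T2].
    assert (HR : in_H2 (R a)) by (apply in_H2_Csum, HG).
    assert (HF : in_H2 (fun k => T a k - R a k)%C).
    { replace (fun k => T a k - R a k)%C with (fun k => T a k + (- (1)) * R a k)%C.
      - now apply in_H2_lin.
      - apply functional_extensionality; intros; ring. }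
    split; [exact HF|].
    destruct (quot_H2 lam (n - 1) a Hl Hia) as [Q1 Q2].
    apply Rle_trans with (C0 * D0 * H2norm (quot lam (n - 1) a)).
    2:{ apply Rmult_le_compat_l; [pos|exact Q2]. }
    apply (HC _ _ _ (quot lam (n - 1) a) D0 (psr_hval _ HF) Q1 HD0).
    intros z Hz. assert (Hp := phi_mod_lt al z Ha Hz).
    replace (hval (fun k => T a k - R a k)%C z)
      with (blp (fun i => RtoC (lam i)) (n - 1) (phi_alpha al z) * hval (quot lam (n - 1) a) (phi_alpha al z))%C.
    + rewrite Cmod_mult. apply Rmult_le_compat_r; [apply Cmod_ge_0|]. now apply HB.
    + replace (fun k => T a k - R a k)%C with (fun k => T a k + (- (1)) * R a k)%C
        by (apply functional_extensionality; intros; ring).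
      rewrite hval_lin by assumption. unfold R. rewrite hval_Csum by assumption.
      rewrite T2, (hval_expand lam (n - 1) a (phi_alpha al z)) by assumption.
      rewrite (Csum_ext_lt (fun i => hseq (lam i) (quot lam i a) O * hval (T (tmw lam i)) z)%C
        (fun i => hseq (lam i) (quot lam i a) O * hval (tmw lam i) (phi_alpha al z))%C).
      * ring.
      * intros i _. f_equal. apply HT; [apply tmw_spec, Hl|exact Hz].
Qed.

(** * Blaschke products with prescribed logarithmic density of zeros *)

Definition Phi (a t : R) : R := atan (sinh t / a).
(** It is the t-derivative of [Phi] and, at a = sin th, minus the th-derivative of [ell]. This
    double role turns the sum over zeros, differentiated in th, into a Riemann sum of an exact
    derivative. *)
Definition pf (a t : R) : R := a * cosh t / (sinh t ^ 2 + a ^ 2).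

Lemma exp_mul_opp t : exp t * exp (- t) = 1.
Proof. rewrite <- exp_plus, Rplus_opp_r. apply exp_0. Qed.

Lemma cosh_sinh_sq t : cosh t ^ 2 = 1 + sinh t ^ 2.
Proof.
  unfold cosh, sinh. assert (H := exp_mul_opp t).
  nra.
Qed.

Lemma cosh_ge_1 t : 1 <= cosh t.
Proof.
  unfold cosh. assert (H := exp_mul_opp t).
  assert (P := exp_pos t). assert (P2 := exp_pos (- t)).
  assert (0 <= (exp t - exp (- t)) ^ 2) by apply pow2_ge_0. nra.
Qed.

Lemma cosh_even t : cosh (- t) = cosh t.
Proof. unfold cosh. rewrite Ropp_involutive. lra. Qed.

Lemma sinh_odd t : sinh (- t) = - sinh t.
Proof. unfold sinh. rewrite Ropp_involutive. lra. Qed.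

Lemma cosh_mono_nonneg s t : 0 <= s <= t -> cosh s <= cosh t.
Proof.
  intros H. unfold cosh.
  assert (Hs := exp_mul_opp s).
  assert (Ht := exp_mul_opp t).
  assert (P1 := exp_pos s). assert (P2 := exp_pos (- s)). assert (P3 := exp_pos t). assert (P4 := exp_pos (- t)).
  assert (M : exp s <= exp t) by (apply exp_mono; lra).
  assert (M1 : 1 <= exp s) by (rewrite <- exp_0; apply exp_mono; lra).
  set (p := exp s) in *. set (q := exp t) in *. set (p' := exp (- s)) in *. set (q' := exp (- t)) in *.
  assert (p' - q' = (q - p) * (p' * q')) by nra.
  assert (p' <= 1) by nra. assert (q' <= 1) by nra. nra.
Qed.

Lemma cosh_Rabs x : cosh (Rabs x) = cosh x.
Proof. unfold Rabs. destruct (Rcase_abs x); [apply cosh_even|reflexivity]. Qed.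

Lemma cosh_mono s t : Rabs s <= Rabs t -> cosh s <= cosh t.
Proof.
  intros H. rewrite <- (cosh_Rabs s), <- (cosh_Rabs t). apply cosh_mono_nonneg. split; [apply Rabs_pos|exact H].
Qed.

Lemma sinh_mono s t : s <= t -> sinh s <= sinh t.
Proof.
  intros H. unfold sinh. assert (exp s <= exp t) by now apply exp_mono.
  assert (exp (- t) <= exp (- s)) by (apply exp_mono; lra). lra.
Qed.

Lemma sinh_nonneg t : 0 <= t -> 0 <= sinh t.
Proof. intros H. rewrite <- sinh_0. now apply sinh_mono. Qed.

Lemma div_le_div p q r s : 0 < q -> 0 < s -> p * s <= r * q -> p / q <= r / s.
Proof.
  intros Hq Hs H. apply Rle_div_l; [exact Hq|].
  replace (r / s * q) with (r * q / s) by (field; lra). now apply Rle_div_r.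
Qed.

Section Kernel.
Variable a : R.
Hypothesis Ha : 0 < a <= 1.

Lemma pf_den_pos t : 0 < sinh t ^ 2 + a ^ 2.
Proof. assert (0 <= sinh t ^ 2) by apply pow2_ge_0. nra. Qed.

Lemma pf_pos t : 0 < pf a t.
Proof.
  unfold pf. apply Rdiv_lt_0_compat; [|apply pf_den_pos].
  apply Rmult_lt_0_compat; [lra|]. generalize (cosh_ge_1 t); lra.
Qed.

Lemma pf_mono s t : Rabs s <= Rabs t -> pf a t <= pf a s.
Proof.
  intros H. assert (M := cosh_mono _ _ H). unfold pf.
  assert (D1 := pf_den_pos s). assert (D2 := pf_den_pos t).
  assert (C1 := cosh_ge_1 s). assert (E1 := cosh_sinh_sq s). assert (E2 := cosh_sinh_sq t).
  apply div_le_div; [exact D2|exact D1|].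
  replace (sinh t ^ 2) with (cosh t ^ 2 - 1) by lra. replace (sinh s ^ 2) with (cosh s ^ 2 - 1) by lra.
  set (c := cosh s) in *. set (d := cosh t) in *.
  (* Cross multiplication of the two fractions leaves (d - c) (c d + 1 - a^2), in terms of
     hyperbolic cosines. *)
  assert (0 <= a * ((d - c) * (c * d + (1 - a ^ 2)))).
  { apply Rmult_le_pos; [lra|]. apply Rmult_le_pos; [lra|]. nra. }
  nra.
Qed.

Lemma pf_le_max t : pf a t <= / a.
Proof.
  apply Rle_trans with (pf a 0).
  - apply pf_mono. rewrite Rabs_R0. apply Rabs_pos.
  - unfold pf. rewrite sinh_0, cosh_0. right. field. lra.
Qed.

Lemma Phi_derive t : is_derive (Phi a) t (pf a t).
Proof.
  unfold Phi, pf. apply is_derive_Reals.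
  replace (a * cosh t / (sinh t ^ 2 + a ^ 2)) with (/ (1 + (sinh t / a) ^ 2) * (cosh t / a)).
  2:{ assert (D := pf_den_pos t). field. split; nra. }
  apply (derivable_pt_lim_comp (fun t => sinh t / a) atan).
  - replace (cosh t / a) with ((cosh t * a - 0 * sinh t) / Rsqr a) by (unfold Rsqr; field; lra).
    apply (derivable_pt_lim_div sinh (fun _ => a)); [apply derivable_pt_lim_sinh|apply derivable_pt_lim_const|lra].
  - apply Ratan.derivable_pt_lim_atan.
Qed.

Lemma Phi_continuous t : continuous (Phi a) t.
Proof. apply (ex_derive_continuous (Phi a)). eexists. apply Phi_derive. Qed.

(** A second primitive of the kernel, which appears because the density of zeros is linear and not
    constant. *)
Definition Psi (t : R) : R := RInt (Phi a) 0 t.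

Lemma Psi_derive t : is_derive Psi t (Phi a t).
Proof.
  unfold Psi. apply (is_derive_RInt (Phi a) _ 0 t).
  - apply filter_forall. intros b. apply (RInt_correct (Phi a)).
    apply (ex_RInt_continuous (Phi a)). intros; apply Phi_continuous.
  - apply Phi_continuous.
Qed.

Lemma Psi_0 : Psi 0 = 0.
Proof. exact (RInt_point 0 (Phi a)). Qed.

End Kernel.

Lemma deriv_nonneg_mono (f df : R -> R) x y :
  (forall t, x <= t <= y -> is_derive f t (df t)) -> (forall t, x <= t <= y -> 0 <= df t) ->
  x <= y -> f x <= f y.
Proof.
  intros D P H. destruct (MVT_gen f x y df) as (c & Hc & E).
  - intros t Ht. rewrite Rmin_left, Rmax_right in Ht by lra. apply D; lra.
  - intros t Ht. rewrite Rmin_left, Rmax_right in Ht by lra.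
    apply continuity_pt_filterlim. apply (ex_derive_continuous f). eexists. apply D; lra.
  - rewrite Rmin_left, Rmax_right in Hc by lra. specialize (P c Hc). nra.
Qed.

Lemma atan_le_id y : 0 <= y -> atan y <= y.
Proof.
  intros Hy. assert (H := deriv_nonneg_mono (fun t => t - atan t) (fun t => 1 - / (1 + t ^ 2)) 0 y).
  cbv beta in H. rewrite atan_0 in H. cut (0 - 0 <= y - atan y); [lra|]. apply H; [| |exact Hy].
  - intros t _. auto_derive; [exact I|]. unfold Rsqr. field. nra.
  - intros t _. assert (0 <= t ^ 2) by apply pow2_ge_0.
    assert (/ (1 + t ^ 2) <= / 1) by (apply Rinv_le_contravar; lra). rewrite Rinv_1 in *. lra.
Qed.

Section KernelBounds.
Variable a : R.
Hypothesis Ha : 0 < a <= 1.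

Lemma atan_mono x y : x <= y -> atan x <= atan y.
Proof. intros [H| ->]; [left; now apply atan_increasing|lra]. Qed.

(** Uses atan w + atan (1 / w) = PI / 2 with w = - sinh t >= 1 / (4 exp t) when exp t < 1/2; for
    larger exp t the right side is nonnegative. The bound is free of [a] because a <= 1. *)
Lemma Phi_neg_bound t : t <= 0 -> Phi a t <= - (PI / 2) + 4 * exp t.
Proof.
  intros Ht. assert (HP := PI_4). assert (He := exp_pos t).
  assert (Hs : 0 <= - sinh t) by (rewrite <- sinh_odd; apply sinh_nonneg; lra).
  destruct (Rle_lt_dec (1 / 2) (exp t)) as [H|H].
  - assert (Phi a t <= 0); [|lra]. unfold Phi. rewrite <- atan_0. apply atan_mono.
    unfold Rdiv. assert (0 < / a) by pos. nra.
  - set (w := - sinh t) in *.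
    assert (Hw : / (4 * exp t) <= w).
    { unfold w, sinh. assert (E := exp_mul_opp t).
      apply Rmult_le_reg_l with (4 * exp t); [lra|]. rewrite Rinv_r by lra. nra. }
    assert (Hw0 : 0 < w) by (eapply Rlt_le_trans; [|exact Hw]; apply Rinv_0_lt_compat; lra).
    assert (Hia : 1 <= / a) by (rewrite <- Rinv_1 at 1; apply Rinv_le_contravar; lra).
    assert (Phi a t <= atan (- w)).
    { unfold Phi. apply atan_mono. replace (sinh t) with (- w) by (unfold w; ring). unfold Rdiv. nra. }
    rewrite atan_opp in H0. replace w with (/ / w) in H0 by (field; lra).
    rewrite atan_inv in H0 by pos.
    assert (atan (/ w) <= / w) by (apply atan_le_id; left; pos).
    assert (/ w <= 4 * exp t).
    { rewrite <- (Rinv_inv (4 * exp t)). apply Rinv_le_contravar; [|exact Hw].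
      apply Rinv_0_lt_compat; lra. }
    lra.
Qed.

(** [Phi_neg_bound] integrated from t to 0. The error 4 does not depend on [a], which is what
    permits the later integration over th. *)
Lemma Psi_lower t : t <= 0 -> - (PI / 2) * t - 4 <= Psi a t.
Proof.
  intros Ht.
  assert (H := deriv_nonneg_mono (fun t => - (Psi a t - (- (PI / 2) * t - 4 + 4 * exp t)))
    (fun t => - (Phi a t - (- (PI / 2) + 4 * exp t))) t 0).
  cbv beta in H. rewrite Psi_0, exp_0 in H.
  assert (- (Psi a t - (- (PI / 2) * t - 4 + 4 * exp t)) <= - (0 - (- (PI / 2) * 0 - 4 + 4 * 1))).
  { apply H; [| |exact Ht].
    - intros s _. apply (is_derive_opp (K := R_AbsRing) (V := R_NormedModule)).
      apply is_derive_Rminus; [now apply Psi_derive|].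
      auto_derive; [exact I|ring].
    - intros s Hs. assert (B := Phi_neg_bound s ltac:(lra)). lra. }
  generalize (exp_pos t); lra.
Qed.

Lemma Phi_bound t : - (PI / 2) < Phi a t < PI / 2.
Proof. unfold Phi. generalize (atan_bound (sinh t / a)). lra. Qed.

Lemma Psi_upper t : Psi a t <= PI / 2 * Rabs t.
Proof.
  destruct (Rle_lt_dec 0 t) as [Ht|Ht].
  - rewrite Rabs_pos_eq by exact Ht.
    assert (H := deriv_nonneg_mono (fun t => PI / 2 * t - Psi a t) (fun t => PI / 2 - Phi a t) 0 t).
    cbv beta in H. rewrite Psi_0 in H.
    assert (PI / 2 * 0 - 0 <= PI / 2 * t - Psi a t); [|lra]. apply H; [| |exact Ht].
    + intros s _. apply is_derive_Rminus; [|now apply Psi_derive].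
      auto_derive; [exact I|ring].
    + intros s _. generalize (Phi_bound s); lra.
  - rewrite Rabs_left by exact Ht.
    assert (H := deriv_nonneg_mono (fun t => PI / 2 * t + Psi a t) (fun t => PI / 2 + Phi a t) t 0).
    cbv beta in H. rewrite Psi_0 in H.
    assert (PI / 2 * t + Psi a t <= PI / 2 * 0 + 0); [|lra]. apply H; [| |lra].
    + intros s _. apply is_derive_Rplus; [|now apply Psi_derive].
      auto_derive; [exact I|ring].
    + intros s _. generalize (Phi_bound s); lra.
Qed.

(** At the edge y = 0 of the density, [Phi] falls short of its limit PI / 2. The defect is dominated
    by the kernel at x itself, so zeros placed at y = 0 compensate it. The constant 20 serves |sinh
    x| <= 2, where the defect is merely bounded by PI <= 4. *)
Lemma Phi_defect x : -1 <= x -> PI / 2 - Phi a x <= 20 / a * pf a x.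
Proof.
  intros Hx. assert (HP := PI_4).
  assert (Hy : - 2 <= sinh x).
  { apply Rle_trans with (sinh (Ropp 1)); [|apply sinh_mono; lra]. rewrite sinh_odd. unfold sinh.
    generalize exp_le_3, (exp_pos (Ropp 1)). lra. }
  unfold Phi, pf. assert (C := cosh_sinh_sq x). assert (C1 := cosh_ge_1 x).
  assert (D := pf_den_pos a Ha x). set (y := sinh x) in *. set (c := cosh x) in *.
  replace (20 / a * (a * c / (y ^ 2 + a ^ 2))) with (20 * c / (y ^ 2 + a ^ 2)) by (field; lra).
  destruct (Rle_lt_dec y 2) as [H|H].
  - apply Rle_trans with 4; [generalize (atan_bound (y / a)); lra|].
    apply (proj1 (Rle_div_r 4 (20 * c) _ D)). nra.
  - assert (Hya : 0 < y / a) by pos.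
    replace (y / a) with (/ (a / y)) by (field; lra).
    rewrite atan_inv by pos.
    assert (atan (a / y) <= a / y) by (apply atan_le_id; apply Rdiv_le_0_compat; lra).
    apply Rle_trans with (a / y); [lra|]. apply div_le_div; [lra|exact D|].
    assert (y <= c) by nra. nra.
Qed.

End KernelBounds.

(** * Riemann sums of the kernel over the quantiles *)

Section Density.
Variables (kap : R) (J : nat).
Hypothesis Hk : 0 < kap.
Hypothesis HJ : (1 <= J)%nat.

Let A := sqrt (2 * kap * INR J).

(** The quantiles of the density [A - kap * y] on [0, A / kap], whose total mass is [J]. *)
Definition quant (j : nat) : R := (A - sqrt (A ^ 2 - 2 * kap * INR j)) / kap.

Lemma dens_A : 0 < A /\ A ^ 2 = 2 * kap * INR J.
Proof.
  assert (H : 0 < 2 * kap * INR J) by (apply Rmult_lt_0_compat; [lra|apply lt_0_INR; lia]).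
  split; [now apply sqrt_lt_R0|]. unfold A. rewrite pow2_sqrt; lra.
Qed.

Lemma quant_spec j : (j <= J)%nat ->
  A * quant j - kap * quant j ^ 2 / 2 = INR j /\ kap * quant j <= A /\ 0 <= quant j.
Proof.
  intros Hj. destruct dens_A as [HA E].
  assert (Hd : 0 <= A ^ 2 - 2 * kap * INR j <= A ^ 2).
  { assert (INR j <= INR J) by now apply le_INR. assert (0 <= INR j) by apply pos_INR. rewrite E. nra. }
  unfold quant. set (r := sqrt (A ^ 2 - 2 * kap * INR j)).
  assert (Hr : r ^ 2 = A ^ 2 - 2 * kap * INR j) by (apply pow2_sqrt; lra).
  assert (Hr0 : 0 <= r) by apply sqrt_pos.
  assert (HrA : r <= A).
  { unfold r. rewrite <- (sqrt_pow2 A) at 2 by lra. apply sqrt_le_1_alt. lra. }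
  split; [|split].
  - replace (A * ((A - r) / kap) - kap * ((A - r) / kap) ^ 2 / 2) with ((A ^ 2 - r ^ 2) / (2 * kap)) by (field; lra).
    rewrite Hr. field. lra.
  - replace (kap * ((A - r) / kap)) with (A - r) by (field; lra). lra.
  - apply Rdiv_le_0_compat; lra.
Qed.

Lemma quant_mono j : (S j <= J)%nat -> quant j <= quant (S j).
Proof.
  intros Hj. unfold quant. unfold Rdiv. apply Rmult_le_compat_r; [pos|].
  apply Rplus_le_compat_l, Ropp_le_contravar, sqrt_le_1_alt. rewrite S_INR. nra.
Qed.

Lemma quant_0 : quant 0 = 0.
Proof.
  unfold quant. simpl INR. destruct dens_A as [HA _].
  rewrite Rmult_0_r, Rminus_0_r, sqrt_pow2 by lra. field. lra.
Qed.

Lemma quant_J : quant J = A / kap.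
Proof.
  unfold quant. destruct dens_A as [HA E]. rewrite E, Rminus_diag, sqrt_0. field. lra.
Qed.

Variables (a x : R).
Hypothesis Ha : 0 < a <= 1.

(** A primitive in y of the density times the kernel, obtained by one integration by parts. *)
Let W y := - (A - kap * y) * Phi a (x - y) + kap * Psi a (x - y).

Lemma dens_W_derive y : is_derive W y ((A - kap * y) * pf a (x - y)).
Proof.
  assert (D1 : is_derive (fun y => Phi a (x - y)) y (- pf a (x - y))).
  { evar_last.
    - apply (is_derive_comp (Phi a) (fun y => x - y)); [now apply Phi_derive|].
      auto_derive; [exact I|reflexivity].
    - unfold scal; simpl; unfold mult; simpl. ring. }
  assert (D2 : is_derive (fun y => Psi a (x - y)) y (- Phi a (x - y))).
  { evar_last.
    - apply (is_derive_comp (Psi a) (fun y => x - y)); [now apply Psi_derive|].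
      auto_derive; [exact I|reflexivity].
    - unfold scal; simpl; unfold mult; simpl. ring. }
  assert (D3 : is_derive (fun y => - (A - kap * y)) y kap) by (auto_derive; [exact I|ring]).
  evar_last.
  - apply is_derive_Rplus.
    + apply (is_derive_mult (K := R_AbsRing)); [exact D3|exact D1|intros; apply Rmult_comm].
    + apply (is_derive_scal (fun y => Psi a (x - y))). exact D2.
  - unfold plus, mult; simpl. unfold scal; simpl; unfold mult; simpl. ring.
Qed.

(** The density gives mass 1 to each cell between consecutive quantiles, so the integral over a cell
    is at most the maximum of the kernel there. *)
Lemma dens_step j m : (S j <= J)%nat ->
  (forall y, quant j <= y <= quant (S j) -> pf a (x - y) <= m) ->
  W (quant (S j)) - W (quant j) <= m.
Proof.
  intros Hj Hm.
  destruct (quant_spec j ltac:(lia)) as (N1 & _ & _). destruct (quant_spec (S j) Hj) as (N2 & N3 & _).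
  assert (H := deriv_nonneg_mono (fun y => m * (A * y - kap * y ^ 2 / 2) - W y)
     (fun y => m * (A - kap * y) - (A - kap * y) * pf a (x - y)) (quant j) (quant (S j))).
  cbv beta in H.
  assert (m * (A * quant j - kap * quant j ^ 2 / 2) - W (quant j) <=
    m * (A * quant (S j) - kap * quant (S j) ^ 2 / 2) - W (quant (S j))).
  { apply H; [| |now apply quant_mono].
    - intros y _. apply is_derive_Rminus; [|apply dens_W_derive].
      auto_derive; [exact I|]. field.
    - intros y Hy. specialize (Hm y Hy).
      replace (m * (A - kap * y) - (A - kap * y) * pf a (x - y)) with ((A - kap * y) * (m - pf a (x - y))) by ring.
      apply Rmult_le_pos; [|lra]. nra. }
  rewrite N1, N2, S_INR in H0. lra.
Qed.

(** The kernel is unimodal with peak at x: a cell left of x is bounded by its value at the right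
    endpoint, a cell right of x by its value at the left endpoint, and the cell containing x by the
    maximum 1 / a. The alternatives record whether x has been passed. *)
Lemma dens_sum_aux i : (i <= J)%nat ->
  (quant i <= x /\ W (quant i) - W 0 <= rsum (fun j => pf a (x - quant j)) (S i)) \/
  (x < quant i /\ W (quant i) - W 0 <= rsum (fun j => pf a (x - quant j)) i + / a).
Proof.
  induction i as [|i IH]; intros Hi.
  - rewrite quant_0. cbn [rsum]. rewrite quant_0.
    assert (P := pf_pos a Ha (x - 0)). assert (0 < / a) by pos.
    destruct (Rle_lt_dec 0 x); [left|right]; split; lra.
  - assert (Hq := quant_mono i Hi). specialize (IH ltac:(lia)).
    change (rsum (fun j => pf a (x - quant j)) (S (S i)))
      with (rsum (fun j => pf a (x - quant j)) (S i) + pf a (x - quant (S i))).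
    destruct (Rle_lt_dec (quant (S i)) x) as [Hx|Hx].
    + left. split; [exact Hx|]. destruct IH as [[I1 I2]|[I1 I2]]; [|lra].
      assert (St := dens_step i (pf a (x - quant (S i))) Hi).
      cut (W (quant (S i)) - W (quant i) <= pf a (x - quant (S i))); [lra|].
      apply St. intros y Hy. apply pf_mono; [exact Ha|]. rewrite !Rabs_pos_eq by lra. lra.
    + right. split; [exact Hx|]. destruct IH as [[I1 I2]|[I1 I2]].
      * assert (St := dens_step i (/ a) Hi). cut (W (quant (S i)) - W (quant i) <= / a); [lra|].
        apply St. intros y Hy. now apply pf_le_max.
      * cbn [rsum]. assert (St := dens_step i (pf a (x - quant i)) Hi).
        cut (W (quant (S i)) - W (quant i) <= pf a (x - quant i)); [lra|].
        apply St. intros y Hy. apply pf_mono; [exact Ha|]. rewrite !Rabs_left by lra. lra.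
Qed.

(** Evaluates [W] at both ends. At y = A / kap the density vanishes and [Psi_lower] gives half of
    the main term; at y = 0 the other half appears, up to the defect of [Phi], which m pf a x pays
    for. The second 4 kap replaces |x| by x for -1 <= x < 0. *)
Lemma dens_sum m : -1 <= x -> kap * x <= A -> 20 / a * A <= m ->
  PI * (A - kap * x) - (/ a + 4 * kap + 4 * kap)
  <= rsum (fun j => pf a (x - quant j)) (S J) + m * pf a x.
Proof.
  intros Hx HxA Hm. destruct dens_A as [HA E]. assert (HP := PI_4). assert (HP0 := PI_RGT_0).
  assert (S1 : W (quant J) - W 0 <= rsum (fun j => pf a (x - quant j)) (S J) + / a).
  { destruct (dens_sum_aux J (le_n J)) as [[_ H]|[_ H]].
    - assert (0 < / a) by pos. lra.
    - cbn [rsum]. assert (P := pf_pos a Ha (x - quant J)). lra. }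
  assert (W1 : W (quant J) = kap * Psi a (x - A / kap)).
  { unfold W. rewrite quant_J. replace (A - kap * (A / kap)) with 0 by (field; lra). ring. }
  assert (W0 : W 0 = - A * Phi a x + kap * Psi a x).
  { unfold W. rewrite Rmult_0_r, !Rminus_0_r. ring. }
  assert (Hx2 : x - A / kap <= 0).
  { assert (x <= A / kap); [|lra]. apply Rle_div_r; lra. }
  assert (L := Psi_lower a Ha _ Hx2). assert (U := Psi_upper a Ha x).
  assert (L2 : kap * (- (PI / 2) * (x - A / kap) - 4) <= kap * Psi a (x - A / kap)) by (apply Rmult_le_compat_l; lra).
  replace (kap * (- (PI / 2) * (x - A / kap) - 4)) with (PI / 2 * (A - kap * x) - 4 * kap) in L2 by (field; lra).
  assert (U2 : kap * Psi a x <= kap * (PI / 2 * Rabs x)) by (apply Rmult_le_compat_l; lra).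
  assert (Habs : kap * (PI / 2 * Rabs x) <= kap * (PI / 2 * x) + 4 * kap).
  { unfold Rabs. destruct (Rcase_abs x); [|lra].
    assert (0 <= kap * (4 - PI * - x)) by (apply Rmult_le_pos; nra). lra. }
  assert (Df := Phi_defect a Ha x Hx). assert (Pp := pf_pos a Ha x).
  assert (Hmm : A * (PI / 2 - Phi a x) <= m * pf a x).
  { apply Rle_trans with (A * (20 / a * pf a x)); [apply Rmult_le_compat_l; lra|].
    replace (A * (20 / a * pf a x)) with (20 / a * A * pf a x) by ring.
    apply Rmult_le_compat_r; lra. }
  lra.
Qed.

End Density.

(** Minus the logarithm of the modulus of a half-plane Blaschke factor with zero on the positive axis,
    at hyperbolic distance [t] and argument [th]. *)
Definition ell (th t : R) : R := / 2 * ln ((cosh t + cos th) / (cosh t - cos th)).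

Lemma is_derive_rsum (f df : nat -> R -> R) N x :
  (forall j, is_derive (f j) x (df j x)) ->
  is_derive (fun t => rsum (fun j => f j t) N) x (rsum (fun j => df j x) N).
Proof.
  intros H. induction N as [|N IH]; cbn [rsum].
  - apply (is_derive_const (K := R_AbsRing) (V := R_NormedModule)).
  - apply is_derive_Rplus; auto.
Qed.

Lemma ell_derive th t : 0 < th <= PI / 2 -> is_derive (fun th => ell th t) th (- pf (sin th) t).
Proof.
  intros Hth. assert (HP := PI_RGT_0).
  assert (Hs : 0 < sin th) by (apply sin_gt_0; lra).
  assert (Hc : 0 <= cos th) by (apply cos_ge_0; lra).
  assert (Hsc : sin th ^ 2 + cos th ^ 2 = 1) by (generalize (sin2_cos2 th); unfold Rsqr; lra).
  assert (C1 := cosh_ge_1 t). assert (E := cosh_sinh_sq t).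
  assert (Hlt : cos th < 1) by nra.
  unfold ell. auto_derive.
  - split; [lra|]. split; [|exact I].
    change (0 < (cosh t + cos th) / (cosh t - cos th)). apply Rdiv_lt_0_compat; lra.
  - unfold pf. replace (sinh t ^ 2) with (cosh t ^ 2 - 1) by lra.
    replace (cosh t ^ 2 - 1 + sin th ^ 2) with ((cosh t + cos th) * (cosh t - cos th)) by nra.
    field. repeat split; lra.
Qed.

(** [ell] vanishes at [th = PI / 2] and has [th]-derivative [- pf (sin th)]. *)
Lemma theta_integration (tt : nat -> R) N th0 B : 0 < th0 <= PI / 2 ->
  (forall th, th0 <= th <= PI / 2 -> B <= rsum (fun j => pf (sin th) (tt j)) N) ->
  (PI / 2 - th0) * B <= rsum (fun j => ell th0 (tt j)) N.
Proof.
  intros Hth HB.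
  assert (H := deriv_nonneg_mono (fun th => - rsum (fun j => ell th (tt j)) N - B * th)
    (fun th => - rsum (fun j => - pf (sin th) (tt j)) N - B) th0 (PI / 2)). cbv beta in H.
  assert (Z : rsum (fun j => ell (PI / 2) (tt j)) N = 0).
  { rewrite (rsum_ext_lt _ (fun _ => 0)); [rewrite rsum_const; ring|]. intros j _.
    unfold ell. rewrite cos_PI2, Rplus_0_r, Rminus_0_r. unfold Rdiv. rewrite Rinv_r, ln_1; [ring|].
    generalize (cosh_ge_1 (tt j)); lra. }
  rewrite Z in H. cut (- rsum (fun j => ell th0 (tt j)) N - B * th0 <= - 0 - B * (PI / 2)); [lra|].
  apply H; [| |lra].
  - intros th Ht. apply is_derive_Rminus.
    + apply (is_derive_opp (K := R_AbsRing) (V := R_NormedModule)).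
      apply (is_derive_rsum (fun j th => ell th (tt j)) (fun j th => - pf (sin th) (tt j))).
      intros j. apply ell_derive. lra.
    + auto_derive; [exact I|ring].
  - intros th Ht. specialize (HB th Ht).
    rewrite (rsum_ext_lt _ (fun j => (-1) * pf (sin th) (tt j))) by (intros; ring).
    rewrite rsum_scal. lra.
Qed.

(** * Blaschke factors in the coordinate u *)

Lemma Cneq_0_fst (c : C) : 0 < fst c -> c <> 0.
Proof. intros H E. rewrite E in H. simpl in H. lra. Qed.

Lemma half_plane_den_neq (u : C) (mu : R) : 0 < fst u -> 0 < mu -> (u + RtoC mu + u * RtoC mu)%C <> 0.
Proof.
  intros Hu Hm. apply Cneq_0_fst. simpl. assert (0 < fst u * mu) by pos. lra.
Qed.

(** Under w = 1 / (1 + u) the disc is |1 + u| > 1, which properly contains the half-plane Re u > 0.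
    This is why u mu is added to the denominator u + mu of the half-plane factor. *)
Lemma blf_half_plane (u : C) (mu : R) : 0 < fst u -> 0 < mu ->
  blf (RtoC (/ (1 + mu))) (/ (1 + u))%C = ((RtoC mu - u) / (u + RtoC mu + u * RtoC mu))%C.
Proof.
  intros Hu Hm. unfold blf.
  rewrite Cconj_R.
  rewrite RtoC_inv, RtoC_plus by lra.
  assert (N1 : (1 + u)%C <> 0) by (apply Cneq_0_fst; simpl; lra).
  assert (N2 : (1 + RtoC mu)%C <> 0) by (apply Cneq_0_fst; simpl; lra).
  assert (N3 := half_plane_den_neq u mu ltac:(assumption) ltac:(assumption)).
  field. repeat split; auto.
Qed.

(** The squared modulus of the half-plane factor is (G - 2 l) / (G + 2 l) with G = |u|^2 + mu^2 and
    l = mu Re u, which decreases in Re u; the term u mu of the disc only increases the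
    denominator. *)
Lemma blf_half_plane_mod (u : C) (mu c : R) : 0 < c < 1 -> 0 < mu -> 0 < Cmod u ->
  c * Cmod u <= fst u ->
  Cmod (blf (RtoC (/ (1 + mu))) (/ (1 + u))%C) ^ 2
  <= (Cmod u ^ 2 + mu ^ 2 - 2 * c * mu * Cmod u) / (Cmod u ^ 2 + mu ^ 2 + 2 * c * mu * Cmod u).
Proof.
  intros Hc Hm Hs Hu.
  assert (Hcs : 0 < c * Cmod u) by pos.
  assert (Hu0 : 0 < fst u) by lra.
  rewrite blf_half_plane by assumption.
  assert (N3 := half_plane_den_neq u mu ltac:(assumption) ltac:(assumption)).
  rewrite Cmod_div by exact N3. unfold Rdiv. rewrite Rpow_mult_distr, pow_inv.
  fold (Rdiv (Cmod (RtoC mu - u) ^ 2) (Cmod (u + RtoC mu + u * RtoC mu) ^ 2)).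
  assert (P : 0 < Cmod (u + RtoC mu + u * RtoC mu) ^ 2) by now apply pow_lt, Cmod_gt_0.
  assert (Hms : 0 < mu * (c * Cmod u)) by pos.
  assert (Q : 0 < Cmod u ^ 2 + mu ^ 2 + 2 * c * mu * Cmod u).
  { assert (0 <= Cmod u ^ 2) by apply pow2_ge_0. assert (0 <= mu ^ 2) by apply pow2_ge_0. lra. }
  apply div_le_div; [exact P|exact Q|].
  assert (E1 : Cmod (RtoC mu - u) ^ 2 = Cmod u ^ 2 + mu ^ 2 - 2 * mu * fst u).
  { rewrite !Cmod2_dot. unfold dot; simpl. ring. }
  assert (E2 : Cmod u ^ 2 + mu ^ 2 + 2 * mu * fst u <= Cmod (u + RtoC mu + u * RtoC mu) ^ 2).
  { rewrite !Cmod2_dot. unfold dot; simpl.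
    assert (A1 : 0 < mu * fst u) by pos.
    assert (A2 := Rle_0_sqr (snd u)). unfold Rsqr in A2.
    assert (0 <= mu * fst u * (2 * (fst u + mu) + mu * fst u)) by pos.
    assert (0 <= mu * (2 + mu) * (snd u * snd u)) by (apply Rmult_le_pos; nra). lra. }
  rewrite E1. set (s := Cmod u) in *. set (p := fst u) in *.
  set (D := Cmod (u + RtoC mu + u * RtoC mu) ^ 2) in *. clearbody D.
  assert (M : mu * (c * s) <= mu * p) by (apply Rmult_le_compat_l; lra).
  set (G := s ^ 2 + mu ^ 2) in *. set (k := mu * (c * s)) in *. set (l := mu * p) in *.
  replace (2 * c * mu * s) with (2 * k) in * by (unfold k; ring).
  replace (2 * mu * p) with (2 * l) in * by (unfold l; ring).
  assert (HG : 0 < G - 2 * k).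
  { unfold G, k. assert (0 <= (s - mu) ^ 2) by apply pow2_ge_0.
    assert (0 < mu * s) by pos. assert (mu * (c * s) < mu * s) by nra. lra. }
  apply Rle_trans with ((G - 2 * k) * (G + 2 * l)); [nra|].
  apply Rmult_le_compat_l; lra.
Qed.

Lemma blf_ell (u : C) x y th : 0 < th < PI / 2 -> Cmod u = exp (- x) -> cos th * Cmod u <= fst u ->
  Cmod (blf (RtoC (/ (1 + exp (- y)))) (/ (1 + u))%C) <= exp (- ell th (x - y)).
Proof.
  intros Hth Hu Hre. assert (HP := PI_RGT_0).
  assert (Hc0 : 0 < cos th) by (apply cos_gt_0; lra).
  assert (Hc1 : cos th < 1) by (rewrite <- cos_0; apply cos_decreasing_1; lra).
  assert (C1 := cosh_ge_1 (x - y)).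
  assert (Hx := exp_pos (- x)). assert (Hy := exp_pos (- y)).
  assert (B := blf_half_plane_mod u (exp (- y)) (cos th) ltac:(lra) Hy ltac:(lra) Hre).
  rewrite Hu in B.
  (* In logarithmic coordinates only the difference x - y matters. *)
  assert (E : exp (- x) ^ 2 + exp (- y) ^ 2 = 2 * exp (- y) * exp (- x) * cosh (x - y)).
  { unfold cosh. replace (exp (x - y)) with (exp (- y) * / exp (- x)).
    2:{ rewrite <- exp_Ropp, <- exp_plus. f_equal. ring. }
    replace (exp (- (x - y))) with (exp (- x) * / exp (- y)).
    2:{ rewrite <- exp_Ropp, <- exp_plus. f_equal. ring. }
    field. lra. }
  rewrite E in B. set (C := cosh (x - y)) in *. set (c := cos th) in *.
  set (a := exp (- y)) in *. set (b := exp (- x)) in *.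
  assert (Hab : 0 < a * b) by pos.
  replace ((2 * a * b * C - 2 * c * a * b) / (2 * a * b * C + 2 * c * a * b)) with ((C - c) / (C + c)) in B.
  2:{ assert (0 < (a * b) * (C + c)) by pos. field. repeat split; lra. }
  apply Rsqr_incr_0_var; [|left; apply exp_pos]. unfold Rsqr. rewrite <- exp_plus.
  replace (- ell th (x - y) + - ell th (x - y)) with (- ln ((C + c) / (C - c))).
  2:{ unfold ell. fold C c. field. }
  rewrite exp_Ropp, exp_ln by pos.
  replace (/ ((C + c) / (C - c))) with ((C - c) / (C + c)) by (field; lra). lra.
Qed.

Lemma blf_mod_le_1 (u : C) (mu : R) : 0 < fst u -> 0 < mu ->
  Cmod (blf (RtoC (/ (1 + mu))) (/ (1 + u))%C) <= 1.
Proof.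
  intros Hu Hm.
  assert (Hs := Cmod_pos_of_fst u Hu).
  assert (Hc : exists c, 0 < c < 1 /\ c * Cmod u <= fst u).
  (* Halving keeps the constant strictly below 1 when u is real. *)
  { exists (fst u / Cmod u / 2). assert (fst u <= Cmod u) by (eapply Rle_trans; [apply Rle_abs|apply fst_le_Cmod]).
    assert (0 < fst u / Cmod u) by pos.
    assert (fst u / Cmod u <= 1) by (apply Rle_div_l; lra).
    split; [lra|]. replace (fst u / Cmod u / 2 * Cmod u) with (fst u / 2) by (field; lra). lra. }
  destruct Hc as (c & Hc & Hcu).
  assert (B := blf_half_plane_mod u mu c Hc Hm Hs Hcu).
  assert (Hk : 0 < c * mu * Cmod u) by pos.
  assert (0 <= Cmod u ^ 2) by apply pow2_ge_0. assert (0 <= mu ^ 2) by apply pow2_ge_0.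
  assert ((Cmod u ^ 2 + mu ^ 2 - 2 * c * mu * Cmod u) / (Cmod u ^ 2 + mu ^ 2 + 2 * c * mu * Cmod u) <= 1).
  { apply Rle_div_l; lra. }
  assert (Hb := Cmod_ge_0 (blf (RtoC (/ (1 + mu))) (/ (1 + u))%C)). nra.
Qed.

Lemma blp_ell (u : C) x (ys : nat -> R) th N : 0 < th < PI / 2 -> Cmod u = exp (- x) -> cos th * Cmod u <= fst u ->
  Cmod (blp (fun j => RtoC (/ (1 + exp (- ys j)))) N (/ (1 + u))%C) <= exp (- rsum (fun j => ell th (x - ys j)) N).
Proof.
  intros Hth Hu Hre. induction N as [|N IH]; cbn [blp rsum].
  - rewrite Cmod_1, Ropp_0, exp_0. lra.
  - rewrite Cmod_mult, Ropp_plus_distr, exp_plus.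
    apply Rmult_le_compat; [apply Cmod_ge_0|apply Cmod_ge_0|exact IH|now apply blf_ell].
Qed.

Lemma blp_mod_le_1 (u : C) (ys : nat -> R) N : 0 < fst u ->
  Cmod (blp (fun j => RtoC (/ (1 + exp (- ys j)))) N (/ (1 + u))%C) <= 1.
Proof.
  intros Hu. induction N as [|N IH]; cbn [blp].
  - rewrite Cmod_1. lra.
  - rewrite Cmod_mult. apply Rle_trans with (1 * 1); [|lra].
    apply Rmult_le_compat; [apply Cmod_ge_0|apply Cmod_ge_0|exact IH|].
    apply blf_mod_le_1; [exact Hu|apply exp_pos].
Qed.

(** * The upper estimate *)

Lemma blaschke_bound al : 0 < al < 1 -> exists K1 K2, 0 < K1 /\ 0 < K2 /\
  forall J N, (1 <= J)%nat -> INR J + 1 + K1 * sqrt (INR J) <= INR N ->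
  exists lam, (forall j, 0 <= lam j < 1) /\
    forall z, Cmod z < 1 -> Cmod (blp (fun i => RtoC (lam i)) N (phi_alpha al z))
      <= K2 * exp (- (PI * (1 - al) * sqrt (INR J / (2 * al)))) * Rpower (Cmod (1 - z)) (- ((1 - al) / 2)).
Proof.
  intros Hal. assert (HP := PI_RGT_0).
  set (th0 := al * (PI / 2)).
  assert (Hth0 : 0 < th0 < PI / 2) by (unfold th0; nra).
  assert (Ha0 : 0 < sin th0) by (apply sin_gt_0; lra).
  (* Makes (PI / 2 - th0) PI kap x equal to (1 - al) x / (2 al), the logarithm of the weight. *)
  set (kap := / (PI ^ 2 * al)).
  assert (Hpa : 0 < PI ^ 2 * al) by (apply Rmult_lt_0_compat; [apply pow_lt; lra|lra]).
  assert (Hkap : 0 < kap) by pos.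
  set (C1 := / sin th0 + 4 * kap + 4 * kap).
  assert (HC1 : 0 < C1).
  { assert (0 < / sin th0) by pos. unfold C1. lra. }
  (* The first witness times sqrt J is 20 A / sin th0, the number of zeros at y = 0 that [dens_sum]
     requires for every th >= th0; the second is the exponential of the bounded error after
     integration in th. *)
  exists (20 / sin th0 * sqrt (2 * kap)), (exp ((PI / 2 - th0) * C1)).
  split; [|split; [apply exp_pos|]].
  { apply Rmult_lt_0_compat; [apply Rdiv_lt_0_compat; lra|apply sqrt_lt_R0; lra]. }
  intros J N HJ HN.
  assert (HJ0 : 1 <= INR J) by (apply (le_INR 1 J HJ)).
  set (A := sqrt (2 * kap * INR J)).
  destruct (dens_A kap J Hkap HJ) as [HA HA2]. fold A in HA, HA2.
  assert (EA : sqrt (2 * kap) * sqrt (INR J) = A) by (unfold A; rewrite <- sqrt_mult by lra; reflexivity).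
  set (L := PI ^ 2 * (1 - al) * A / 2).
  assert (EL : PI * (1 - al) * sqrt (INR J / (2 * al)) = L).
  { unfold L, A. replace (INR J / (2 * al)) with ((PI / 2) ^ 2 * (2 * kap * INR J)) by (unfold kap; field; lra).
    rewrite sqrt_mult_alt by apply pow2_ge_0. rewrite sqrt_pow2 by lra. field. }
  rewrite EL.
  (* The J + 1 quantiles come first; every later zero sits at y = 0. *)
  set (ys := fun j => if (j <=? J)%nat then quant kap J j else 0).
  exists (fun j => / (1 + exp (- ys j))). split.
  { intros j. assert (H := exp_pos (- ys j)). generalize (inv_lt_1 (1 + exp (- ys j))). lra. }
  intros z Hz.
  assert (Hre := one_minus_pos z Hz). destruct (one_minus_Cmod z Hz) as [Hd1 Hd2].
  set (u := Cpowr (1 - z)%C al).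
  set (x := - (al * ln (Cmod (1 - z)))).
  assert (Hu : Cmod u = exp (- x)).
  { unfold u, x. rewrite Cmod_Cpowr by exact Hre. rewrite Ropp_involutive. reflexivity. }
  assert (Hur : cos th0 * Cmod u <= fst u).
  { unfold u. rewrite Cmod_Cpowr by exact Hre. now apply fst_Cpowr_ge. }
  assert (Hc0 : 0 < cos th0) by (apply cos_gt_0; lra).
  assert (Hufst : 0 < fst u).
  { eapply Rlt_le_trans; [|exact Hur]. apply Rmult_lt_0_compat; [lra|]. rewrite Hu. apply exp_pos. }
  assert (Hx : -1 <= x).
  { apply Rnot_lt_le. intros Hlt.
    assert (H2 : Cmod u <= 2) by (unfold u; rewrite Cmod_Cpowr by exact Hre; apply Rpower_le_2; lra).
    rewrite Hu in H2. assert (exp 1 < exp (- x)) by (apply exp_increasing; lra).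
    assert (H3 := exp_ineq1 1 ltac:(lra)). lra. }
  assert (Eph : phi_alpha al z = (/ (1 + u))%C) by reflexivity.
  assert (Ew : Rpower (Cmod (1 - z)) (- ((1 - al) / 2)) = exp ((1 - al) / (2 * al) * x)).
  { unfold Rpower, x. f_equal. field. lra. }
  rewrite Ew, Eph, Rmult_assoc, <- exp_plus.
  assert (HK0 : 0 < (PI / 2 - th0) * C1) by pos.
  (* The potential argument works up to the end A / kap of the density. Beyond it, z is so close to
     1 that the weight alone exceeds exp L and |B| <= 1 suffices. *)
  destruct (Rle_lt_dec (kap * x) A) as [HxA|HxA].
  - eapply Rle_trans; [apply (blp_ell u x ys th0 N Hth0 Hu Hur)|].
    rewrite <- exp_plus. apply exp_mono.
    assert (HNJ : (S J <= N)%nat).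
    { apply INR_le. rewrite S_INR.
      assert (0 <= 20 / sin th0 * sqrt (2 * kap) * sqrt (INR J)).
      { repeat apply Rmult_le_pos; try apply sqrt_pos; try lra. left; pos. }
      lra. }
    assert (HI : (PI / 2 - th0) * (PI * (A - kap * x) - C1) <= rsum (fun j => ell th0 (x - ys j)) N).
    { apply theta_integration; [lra|]. intros th Hth.
      assert (Hsin : sin th0 <= sin th) by (apply sin_incr_1; lra).
      assert (Hsin1 : 0 < sin th <= 1) by (split; [lra|apply SIN_bound]).
      assert (Hinv : / sin th <= / sin th0) by (apply Rinv_le_contravar; lra).
      assert (Hm : 20 / sin th * A <= INR (N - S J)).
      { rewrite minus_INR, S_INR by exact HNJ. rewrite Rmult_assoc, EA in HN.
        assert (20 / sin th * A <= 20 / sin th0 * A); [|lra].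
        apply Rmult_le_compat_r; [lra|]. unfold Rdiv. lra. }
      assert (DS := dens_sum kap J Hkap HJ (sin th) x Hsin1 (INR (N - S J)) Hx HxA Hm). fold A in DS.
      replace N with (S J + (N - S J))%nat at 1 by lia. rewrite rsum_add.
      rewrite (rsum_ext_lt (fun j => pf (sin th) (x - ys j)) (fun j => pf (sin th) (x - quant kap J j)) (S J)).
      2:{ intros j Hj. unfold ys. now rewrite (proj2 (Nat.leb_le j J)) by lia. }
      rewrite (rsum_ext_lt (fun k => pf (sin th) (x - ys (S J + k)%nat)) (fun _ => pf (sin th) x)).
      2:{ intros j Hj. unfold ys. rewrite (proj2 (Nat.leb_gt (S J + j) J)) by lia. now rewrite Rminus_0_r. }
      rewrite rsum_const. unfold C1. lra. }
    apply Rle_trans with (- ((PI / 2 - th0) * (PI * (A - kap * x) - C1))); [lra|].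
    (* An identity: by the choice of [kap] the terms in x cancel. *)
    right. unfold L, th0, kap. field. split; lra.
  - eapply Rle_trans; [now apply blp_mod_le_1|].
    rewrite <- exp_plus. apply Rle_trans with (exp 0); [rewrite exp_0; lra|apply exp_mono].
    assert (L <= (1 - al) / (2 * al) * x); [|lra].
    replace ((1 - al) / (2 * al) * x) with (PI ^ 2 * (1 - al) / 2 * (kap * x)) by (unfold kap; field; split; lra).
    unfold L. replace (PI ^ 2 * (1 - al) * A / 2) with (PI ^ 2 * (1 - al) / 2 * A) by field.
    apply Rmult_le_compat_l; [|lra].
    assert (0 < PI ^ 2) by (apply pow_lt; lra). nra.
Qed.

(** Takes J = m^2 with m = q - k, where q is the integer part of sqrt n: for k > K1 + 2 the n - 1
    zeros available include the surplus 1 + K1 m. As sqrt n <= m + k + 1, passing from sqrt n to m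
    costs only the constant exp (b (k + 1)). *)
Lemma upper_estimate al : 0 < al < 1 -> exists c2, 0 < c2 /\ forall n, (1 <= n)%nat ->
  Rbar_le (approx_number (Comp_op (phi_alpha al)) n) (c2 * exp (- (PI * (1 - al) * sqrt (INR n / (2 * al))))).
Proof.
  intros Hal. assert (HP := PI_RGT_0).
  destruct (approx_number_upper al Hal) as (C0 & HC0 & HU).
  destruct (blaschke_bound al Hal) as (K1 & K2 & HK1 & HK2 & HB).
  set (b := PI * (1 - al) * sqrt (/ (2 * al))).
  assert (Hsa : 0 < sqrt (/ (2 * al))) by (apply sqrt_lt_R0, Rinv_0_lt_compat; lra).
  assert (Hb : 0 < b) by (unfold b; apply Rmult_lt_0_compat; [apply Rmult_lt_0_compat|]; lra).
  assert (Eb : forall m, PI * (1 - al) * sqrt (INR m / (2 * al)) = b * sqrt (INR m)).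
  { intros m. unfold b, Rdiv. rewrite sqrt_mult_alt by apply pos_INR. ring. }
  destruct (INR_unbounded (K1 + 2)) as [k Hk].
  exists (C0 * ((2 + K2) * exp (b * (INR k + 1)))). split.
  { assert (He := exp_pos (b * (INR k + 1))). apply Rmult_lt_0_compat; [|apply Rmult_lt_0_compat]; lra. }
  intros n Hn. rewrite Eb.
  set (q := Nat.sqrt n).
  assert (Hq : (q * q <= n < S q * S q)%nat) by (apply Nat.sqrt_spec; lia).
  assert (Hnq : sqrt (INR n) <= INR q + 1).
  { rewrite <- S_INR. rewrite <- (sqrt_square (INR (S q))) by apply pos_INR.
    apply sqrt_le_1_alt. rewrite <- mult_INR. apply le_INR. lia. }
  assert (He := exp_pos (b * (INR k + 1))).
  destruct (Compare_dec.le_lt_dec (S k) q) as [Hkq|Hkq].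
  - set (m := (q - k)%nat).
    assert (Em : INR q = INR m + INR k) by (unfold m; rewrite minus_INR by lia; ring).
    assert (Hm : 1 <= INR m) by (apply (le_INR 1); unfold m; lia).
    assert (Hs : sqrt (INR (m * m)) = INR m) by (rewrite mult_INR; apply sqrt_square; lra).
    destruct (HB (m * m)%nat (n - 1)%nat) as (lam & L1 & L2).
    { unfold m; nia. }
    { rewrite Hs, mult_INR, minus_INR by lia.
      assert (INR q * INR q <= INR n) by (rewrite <- mult_INR; apply le_INR; lia).
      rewrite Em in H. simpl (INR 1). nra. }
    rewrite Eb, Hs in L2.
    eapply Rbar_le_trans; [apply (HU n lam (K2 * exp (- (b * INR m))) Hn L1)|].
    + pos.
    + exact L2.
    + simpl. rewrite Rmult_assoc. apply Rmult_le_compat_l; [lra|].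
      rewrite Rmult_assoc, <- exp_plus.
      apply Rmult_le_compat; [lra|left; apply exp_pos|lra|]. apply exp_mono. nra.
  (* For the finitely many remaining n any zeros will do: |B| <= 1, which [Rpower_weight_ge] bounds
     by the weight with D0 = 2. *)
  - eapply Rbar_le_trans; [apply (HU n (fun _ => / (1 + exp (- 0))) 2 Hn)|].
    + intros _. rewrite Ropp_0, exp_0. lra.
    + lra.
    + intros z Hz. eapply Rle_trans; [|apply (Rpower_weight_ge al z Hal Hz)].
      apply (blp_mod_le_1 (Cpowr (1 - z)%C al) (fun _ => 0)).
      assert (Hre := one_minus_pos z Hz).
      eapply Rlt_le_trans; [|apply (fst_Cpowr_ge al _ Hal Hre)].
      apply Rmult_lt_0_compat; [apply cos_half_pos, Hal|apply Rpower_pos].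
    + simpl. rewrite Rmult_assoc. apply Rmult_le_compat_l; [lra|].
      assert (INR q <= INR k) by (apply le_INR; lia).
      rewrite Rmult_assoc, <- exp_plus.
      assert (1 <= exp (b * (INR k + 1) + - (b * sqrt (INR n)))); [|nra].
      apply Rle_trans with (exp 0); [rewrite exp_0; lra|apply exp_mono]. nra.
Qed.

(** * Lower bounds for approximation numbers from point evaluations *)

(** Makes the product over all i <> p a [blp] over consecutive indices. *)
Definition skip (p j : nat) : nat := if (j <? p)%nat then j else S j.

Lemma skip_neq p j : skip p j <> p.
Proof. unfold skip. destruct (Nat.ltb_spec j p); lia. Qed.

Lemma skip_lt p j n : (j < n)%nat -> (skip p j < S n)%nat.
Proof. unfold skip. destruct (Nat.ltb_spec j p); lia. Qed.

Lemma skip_surj p i n : (i < S n)%nat -> (p < S n)%nat -> i <> p -> exists j, (j < n)%nat /\ skip p j = i.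
Proof.
  intros Hi Hp Hne. destruct (Compare_dec.lt_dec i p).
  - exists i. split; [lia|]. unfold skip. now rewrite (proj2 (Nat.ltb_lt i p)).
  - exists (i - 1)%nat. split; [lia|]. unfold skip. rewrite (proj2 (Nat.ltb_ge (i - 1) p)) by lia. lia.
Qed.

Lemma Csum_skip f p n : (p < S n)%nat -> Csum f (S n) = (f p + Csum (fun j => f (skip p j)) n)%C.
Proof.
  intros Hp. induction n as [|n IH].
  - replace p with O by lia. simpl. ring.
  - destruct (Nat.eq_dec p (S n)) as [->|Hne].
    + cbn [Csum]. rewrite (Csum_ext_lt (fun j => f (skip (S n) j)) f).
      * unfold skip. rewrite (proj2 (Nat.ltb_lt n (S n))) by lia. ring.
      * intros k Hk. unfold skip. now rewrite (proj2 (Nat.ltb_lt k (S n))) by lia.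
    + change (Csum f (S (S n))) with (Csum f (S n) + f (S n))%C. rewrite IH by lia.
      cbn [Csum]. unfold skip at 3. rewrite (proj2 (Nat.ltb_ge n p)) by lia. ring.
Qed.

(** Gaussian elimination: a nonzero entry of the last row serves as pivot, its column is eliminated
    from the other rows, and [cp] solves the last equation. A vanishing last row imposes nothing. *)
Lemma null_vector m n (v : nat -> nat -> C) : (m < n)%nat ->
  exists c : nat -> C, (exists j, (j < n)%nat /\ c j <> 0) /\
    forall i, (i < m)%nat -> Csum (fun j => c j * v i j)%C n = 0.
Proof.
  revert n v. induction m as [|m IH]; intros n v Hmn.
  - exists (fun _ => RtoC 1). split; [|intros; lia]. exists O. split; [lia|].
    intros E. apply RtoC_inj in E. lra.
  - destruct n as [|n]; [lia|].
    destruct (classic (exists p, (p < S n)%nat /\ v m p <> 0)) as [(p & Hp & Hv)|Hno].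
    + destruct (IH n (fun i j => v i (skip p j) - v i p * v m (skip p j) / v m p)%C ltac:(lia))
        as (c' & (j0 & Hj0 & Hc0) & Hc').
      set (cp := (- (Csum (fun j => c' j * v m (skip p j)) n / v m p))%C).
      set (c := fun i => if (i =? p)%nat then cp else if (i <? p)%nat then c' i else c' (i - 1)%nat).
      assert (Hcs : forall j, c (skip p j) = c' j).
      { intros j. unfold c. rewrite (proj2 (Nat.eqb_neq _ _) (skip_neq p j)). unfold skip.
        destruct (Nat.ltb_spec j p).
        - now rewrite (proj2 (Nat.ltb_lt j p)).
        - rewrite (proj2 (Nat.ltb_ge (S j) p)) by lia. f_equal. lia. }
      assert (Hcp : c p = cp) by (unfold c; now rewrite Nat.eqb_refl).
      exists c. split.
      * exists (skip p j0). split; [now apply skip_lt|]. now rewrite Hcs.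
      * intros i Hi. rewrite (Csum_skip _ p n Hp), Hcp.
        rewrite (Csum_ext_lt _ (fun j => c' j * v i (skip p j))%C) by (intros; now rewrite Hcs).
        unfold cp. destruct (Nat.eq_dec i m) as [->|Him]; [field; exact Hv|].
        assert (H := Hc' i ltac:(lia)). cbv beta in H.
        rewrite (Csum_ext_lt _ (fun j => c' j * v i (skip p j) + (- (v i p / v m p)) * (c' j * v m (skip p j)))%C) in H.
        2:{ intros j _. field. exact Hv. }
        rewrite Csum_plus, Csum_scal in H. rewrite <- H. field. exact Hv.
    + destruct (IH (S n) v ltac:(lia)) as (c & Hc & Hc').
      exists c. split; [exact Hc|]. intros i Hi.
      destruct (Nat.eq_dec i m) as [->|Him]; [|apply Hc'; lia].
      rewrite (Csum_ext_lt _ (fun _ => RtoC 0)); [apply Csum_zero|].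
      intros j Hj. replace (v m j) with (RtoC 0); [ring|].
      apply NNPP. intros E. apply Hno. exists j. split; [exact Hj|]. intros E2. apply E. now rewrite E2.
Qed.

Lemma rsum_argmax (e : nat -> R) n : (1 <= n)%nat -> exists j, (j < n)%nat /\ forall i, (i < n)%nat -> e i <= e j.
Proof.
  induction n as [|n IH]; [lia|]. intros _. destruct n as [|n].
  - exists O. split; [lia|]. intros i Hi. replace i with O by lia. lra.
  - destruct (IH ltac:(lia)) as (j & Hj & Hmax).
    destruct (Rle_lt_dec (e (S n)) (e j)).
    + exists j. split; [lia|]. intros i Hi. destruct (Nat.eq_dec i (S n)) as [->|]; [assumption|apply Hmax; lia].
    + exists (S n). split; [lia|]. intros i Hi. destruct (Nat.eq_dec i (S n)) as [->|]; [lra|].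
      specialize (Hmax i ltac:(lia)). lra.
Qed.

Lemma hval_le_norm a w : in_H2 a -> Cmod w < 1 -> Cmod (hval a w) <= H2norm a / sqrt (1 - Cmod w ^ 2).
Proof.
  intros Ha Hw. assert (H0 := Cmod_ge_0 w). assert (Hp : 0 < 1 - Cmod w ^ 2) by nra.
  assert (Hs := sqrt_lt_R0 _ Hp).
  apply (cser_Cmod_le _ _ _ (hval_cser a w Ha Hw)). intros N.
  eapply Rle_trans; [apply Cmod_Csum|].
  apply Rsqr_incr_0_var; [|apply Rdiv_le_0_compat; [apply H2norm_pos|exact Hs]].
  assert (CS := rsum_cauchy_schwarz (fun k => Cmod (a k) ^ 2) (fun k => (Cmod w ^ 2) ^ k) N).
  rewrite (rsum_ext_lt _ (fun k => Cmod (a k * w ^ k))) in CS.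
  2:{ intros k _. rewrite sqrt_pow2 by apply Cmod_ge_0. rewrite <- pow_mult, Nat.mul_comm, pow_mult.
      rewrite sqrt_pow2 by (apply pow_le, H0). now rewrite Cmod_mult, Cmod_pow. }
  unfold Rsqr. replace (H2norm a / sqrt (1 - Cmod w ^ 2) * (H2norm a / sqrt (1 - Cmod w ^ 2)))
    with (H2norm a ^ 2 * / (1 - Cmod w ^ 2)).
  2:{ rewrite <- (sqrt_sqrt (1 - Cmod w ^ 2)) at 1 by lra. field. lra. }
  eapply Rle_trans; [|apply Rmult_le_compat; [|apply (rsum_nonneg (fun k => (Cmod w ^ 2) ^ k) N)|
     apply (H2norm_partial a N Ha)|apply rsum_geom_le]].
  - eapply Rle_trans; [|apply CS].
    + right. ring.
    + intros; apply pow2_ge_0.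
    + intros; apply pow_le, pow2_ge_0.
  - apply rsum_nonneg. intros; apply pow2_ge_0.
  - intros; apply pow_le, pow2_ge_0.
  - split; [apply pow2_ge_0|lra].
Qed.

Lemma blp_zero lam n w j : (j < n)%nat -> lam j = w -> blp lam n w = 0.
Proof.
  induction n as [|n IH]; intros Hj E; [lia|]. cbn [blp].
  destruct (Nat.eq_dec j n) as [->|Hne].
  - rewrite E. unfold blf, Cdiv. ring.
  - rewrite IH by (auto; lia). ring.
Qed.

(** Choose [c <> 0] such that [sum_i c_i (R f)(z_i) = 0] for all [f], where [R] has rank [< n]; then test [T - R] on
    the function that vanishes at all [w i] except [w j], where [j] maximizes [|c_j| / sqrt (1 - |z_j|^2)]. *)
Lemma approx_number_lower al n (z : nat -> C) (de : R) : 0 < al < 1 -> (1 <= n)%nat ->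
  (forall j, Cmod (z j) < 1) ->
  (forall j, (j < n)%nat ->
     let w := fun i => phi_alpha al (z i) in
     de * INR n * sqrt (1 - Cmod (w j) ^ 2)
       <= sqrt (1 - Cmod (z j) ^ 2) * Cmod (blp (fun i => w (skip j i)) (n - 1) (w j))) ->
  Rbar_le de (approx_number (Comp_op (phi_alpha al)) n).
Proof.
  intros Hal Hn Hz Hde. apply (proj2 (Glb_Rbar_correct _)).
  intros r (Hr & Rop & Rlin & (g & Hg & HRg) & HTR). simpl.
  set (T := Comp_op (phi_alpha al)) in *. set (w := fun i => phi_alpha al (z i)).
  assert (Hw : forall i, Cmod (w i) < 1) by (intros i; now apply phi_mod_lt).
  destruct (null_vector (n - 1) n (fun l i => hval (g l) (z i)) ltac:(lia)) as (c & (j0 & Hj0 & Hc0) & Hc).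
  assert (Hsz : forall i, 0 < sqrt (1 - Cmod (z i) ^ 2)).
  { intros i. apply sqrt_lt_R0, one_minus_Cmod2_pos, Hz. }
  set (e := fun i => Cmod (c i) / sqrt (1 - Cmod (z i) ^ 2)).
  destruct (rsum_argmax e n Hn) as (j & Hj & Hmax).
  assert (Hej : 0 < e j).
  { eapply Rlt_le_trans; [|apply (Hmax j0 Hj0)]. unfold e. apply Rdiv_lt_0_compat; [now apply Cmod_gt_0|apply Hsz]. }
  specialize (Hde j Hj). cbv zeta in Hde. fold w in Hde.
  (* The kernel at [w j] has the value 1 / (1 - |w j|^2) there, while its norm is at most the square
     root of that number; this produces the factor sqrt (1 - |w j|^2) of the hypothesis. *)
  set (f := blshift (fun i => w (skip j i)) (n - 1) (kern (w j))).
  destruct (kern_H2 (w j) (Hw j)) as [K1 K2].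
  destruct (blshift_spec (fun i => w (skip j i)) (n - 1) (kern (w j)) (fun i => Hw _) K1) as (F1 & F2 & F3).
  fold f in F1, F2, F3.
  destruct (HTR f F1) as [D1 D2]. set (D := fun k => (T f k - Rop f k)%C) in *.
  destruct (Comp_op_spec al f Hal F1) as [T1 T2]. fold T in T1, T2.
  destruct (HRg f F1) as [d Hd].
  assert (ER : Rop f = fun k => Csum (fun i => d i * g i k)%C (n - 1)) by (apply functional_extensionality; exact Hd).
  assert (HR : in_H2 (Rop f)) by (rewrite ER; now apply in_H2_Csum).
  assert (HDv : forall i, hval D (z i) = (hval f (w i) - hval (Rop f) (z i))%C).
  { intros i. replace D with (fun k => T f k + (- (1)) * Rop f k)%C
      by (apply functional_extensionality; intros; unfold D; ring).
    rewrite hval_lin by auto. rewrite T2 by apply Hz. fold (w i). ring. }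
  (* Pairing with [c] annihilates the finite-rank part, and [f] vanishes at every [w i] with i <>
     j. *)
  assert (S1 : Csum (fun i => c i * hval D (z i))%C n = (c j * hval f (w j))%C).
  { rewrite (Csum_ext_lt _ (fun i => c i * hval f (w i) + (- (1)) * (c i * hval (Rop f) (z i)))%C).
    2:{ intros i _. rewrite HDv. ring. }
    rewrite Csum_plus, Csum_scal.
    rewrite (Csum_single (fun i => c i * hval f (w i))%C n j Hj).
    2:{ intros i Hi Hne. rewrite F3 by apply Hw.
        destruct (skip_surj j i (n - 1)) as (i' & Hi' & E); [lia|lia|exact Hne|].
        rewrite (blp_zero _ (n - 1) (w i) i' Hi'); [ring|now rewrite E]. }
    replace (Csum (fun i => c i * hval (Rop f) (z i))%C n) with (RtoC 0); [ring|].
    rewrite ER.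
    rewrite (Csum_ext_lt _ (fun i => Csum (fun l => d l * (c i * hval (g l) (z i))) (n - 1))%C).
    2:{ intros i _. rewrite hval_Csum by auto. rewrite <- Csum_scal. apply Csum_ext_lt. intros; ring. }
    rewrite Csum_swap. rewrite (Csum_ext_lt _ (fun _ => RtoC 0)); [now rewrite Csum_zero|].
    intros l Hl. rewrite Csum_scal, Hc by exact Hl. ring. }
  assert (Hsw : 0 < sqrt (1 - Cmod (w j) ^ 2)).
  { apply sqrt_lt_R0, one_minus_Cmod2_pos, Hw. }
  (* Evaluation at [z i] costs the norm divided by sqrt (1 - |z i|^2). By the maximality of [e j]
     each of the n terms has the same bound, whence the factor n. *)
  assert (S2 : Cmod (Csum (fun i => c i * hval D (z i))%C n) <= INR n * (e j * (r * / sqrt (1 - Cmod (w j) ^ 2)))).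
  { eapply Rle_trans; [apply Cmod_Csum|]. rewrite <- rsum_const. apply rsum_le. intros i Hi.
    rewrite Cmod_mult.
    assert (B := hval_le_norm D (z i) D1 (Hz i)).
    assert (B2 : H2norm D <= r * / sqrt (1 - Cmod (w j) ^ 2)).
    { eapply Rle_trans; [exact D2|]. apply Rmult_le_compat_l; [exact Hr|lra]. }
    apply Rle_trans with (Cmod (c i) * (H2norm D / sqrt (1 - Cmod (z i) ^ 2))).
    { apply Rmult_le_compat_l; [apply Cmod_ge_0|exact B]. }
    replace (Cmod (c i) * (H2norm D / sqrt (1 - Cmod (z i) ^ 2))) with (e i * H2norm D).
    2:{ unfold e. field. apply Rgt_not_eq, Hsz. }
    apply Rmult_le_compat; [|apply H2norm_pos|now apply Hmax|exact B2].
    unfold e. apply Rdiv_le_0_compat; [apply Cmod_ge_0|apply Hsz]. }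
  rewrite S1, Cmod_mult, F3, Cmod_mult, hval_kern in S2 by apply Hw.
  assert (Ek : Cmod (/ (1 - Cconj (w j) * w j)) = / (1 - Cmod (w j) ^ 2)).
  { assert (Hn0 := one_minus_neq (Cconj (w j)) (w j) ltac:(rewrite Cmod_conj; apply Hw) (Hw j)).
    rewrite Cmod_inv by exact Hn0. f_equal.
    replace (1 - Cconj (w j) * w j)%C with (RtoC (1 - Cmod (w j) ^ 2)).
    - rewrite Cmod_R, Rabs_pos_eq; [reflexivity|]. left. apply one_minus_Cmod2_pos, Hw.
    - rewrite RtoC_minus. f_equal. rewrite Cmult_comm, Cmod2_conj. reflexivity. }
  rewrite Ek in S2.
  set (P := Cmod (blp (fun i => w (skip j i)) (n - 1) (w j))) in *.
  assert (Hsq : sqrt (1 - Cmod (w j) ^ 2) * sqrt (1 - Cmod (w j) ^ 2) = 1 - Cmod (w j) ^ 2).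
  { apply sqrt_sqrt. left. apply one_minus_Cmod2_pos, Hw. }
  set (sw := sqrt (1 - Cmod (w j) ^ 2)) in *. rewrite <- Hsq in S2.
  assert (Hszj := Hsz j). set (sz := sqrt (1 - Cmod (z j) ^ 2)) in *.
  assert (Ec : Cmod (c j) = e j * sz) by (unfold e; fold sz; field; lra).
  rewrite Ec in S2.
  assert (Hn0 : 0 < INR n) by pos.
  apply Rmult_le_reg_r with (INR n * sw); [now apply Rmult_lt_0_compat|].
  replace (de * (INR n * sw)) with (de * INR n * sw) by ring.
  eapply Rle_trans; [exact Hde|].
  apply Rmult_le_reg_l with (e j); [exact Hej|].
  apply Rmult_le_reg_r with (/ (sw * sw)); [apply Rinv_0_lt_compat; nra|].
  replace (e j * (sz * P) * / (sw * sw)) with (e j * sz * (P * / (sw * sw))) by ring.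
  eapply Rle_trans; [exact S2|]. right. field. lra.
Qed.

(** * Points on a ray *)

(** Minus the logarithm of the half-plane pseudohyperbolic distance of two points on the ray of
    argument [th] at hyperbolic distance [t]. *)
Definition lq (th t : R) : R := / 2 * ln ((cosh t + cos (2 * th)) / (cosh t - 1)).

Lemma cosh_gt_1 t : 0 < t -> 1 < cosh t.
Proof.
  intros Ht. assert (E := cosh_sinh_sq t). assert (C1 := cosh_ge_1 t).
  assert (0 < sinh t).
  { unfold sinh. assert (exp (- t) < exp t) by (apply exp_increasing; lra). lra. }
  nra.
Qed.

Lemma lq_nonneg th t : 0 < t -> 0 <= lq th t.
Proof.
  intros Ht. assert (C := cosh_gt_1 t Ht). assert (B := COS_bound (2 * th)).
  unfold lq. apply Rmult_le_pos; [lra|]. rewrite <- ln_1.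
  assert (H : 1 <= (cosh t + cos (2 * th)) / (cosh t - 1)).
  { apply (proj1 (Rle_div_r 1 (cosh t + cos (2 * th)) (cosh t - 1) (proj2 (Rlt_0_minus _ _) C))). lra. }
  destruct H as [H|<-]; [left; apply ln_increasing; lra|lra].
Qed.

Lemma lq_derive th t : 0 < t -> is_derive (fun th => lq th t) th (- (sin (2 * th) / (cosh t + cos (2 * th)))).
Proof.
  intros Ht. assert (C := cosh_gt_1 t Ht). assert (B := COS_bound (2 * th)).
  unfold lq. auto_derive.
  - change (0 < (cosh t + cos (2 * th)) / (cosh t - 1)). apply Rdiv_lt_0_compat; lra.
  - field. split; lra.
Qed.

(** The fraction with exponentials is tanh (t / 2): this is a primitive in t of minus the
    th-derivative of [lq]. *)
Lemma ray_kernel_derive th t : 0 < th < PI / 2 ->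
  is_derive (fun t => 2 * atan (tan th * ((exp t - 1) / (exp t + 1)))) t (sin (2 * th) / (cosh t + cos (2 * th))).
Proof.
  intros Hth. assert (He := exp_pos t).
  assert (Hs : 0 < sin th) by (apply sin_gt_0; lra).
  assert (Hc : 0 < cos th) by (apply cos_gt_0; lra).
  auto_derive; [lra|].
  rewrite sin_2a, cos_2a. unfold tan, cosh. rewrite exp_Ropp.
  assert (Hsc : sin th * sin th = 1 - cos th * cos th) by (generalize (sin2_cos2 th); unfold Rsqr; lra).
  set (s := sin th) in *. set (c := cos th) in *. set (e := exp t) in *.
  rewrite Hsc.
  assert (D1 : 0 < (c * (e + 1)) ^ 2 + (s * (e - 1)) ^ 2).
  { assert (0 < (c * (e + 1)) ^ 2) by (apply pow_lt, Rmult_lt_0_compat; lra).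
    assert (0 <= (s * (e - 1)) ^ 2) by apply pow2_ge_0. lra. }
  assert (D2 : (c * (e + 1)) ^ 2 + (s * (e - 1)) ^ 2 = e * e + 1 + 2 * e * (c * c - (1 - c * c))).
  { transitivity (c * c * (e + 1) ^ 2 + s * s * (e - 1) ^ 2); [ring|]. rewrite Hsc. ring. }
  rewrite D2 in D1.
  replace (2 * s * c / ((e + / e) / 2 + (c * c - (1 - c * c))))
    with (4 * s * c * e / (e * e + 1 + 2 * e * (c * c - (1 - c * c)))).
  2:{ field. split; [|lra]. lra. }
  rewrite <- D2 in D1 |- *.
  unfold Rsqr. field. repeat split; lra.
Qed.

(** The kernel decreases in t > 0, so the sum lies below its integral over the half-line, which is 2
    th because tanh (t / 2) tends to 1. *)
Lemma ray_kernel_sum th h n : 0 < th < PI / 2 -> 0 < h ->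
  rsum (fun k => h * (sin (2 * th) / (cosh (INR (S k) * h) + cos (2 * th)))) n <= 2 * th.
Proof.
  intros Hth Hh.
  set (V := fun t => 2 * atan (tan th * ((exp t - 1) / (exp t + 1)))).
  assert (Hs : 0 < sin (2 * th)) by (apply sin_gt_0; lra).
  assert (Ht : 0 < tan th) by (apply tan_gt_0; lra).
  assert (HB := COS_bound (2 * th)).
  assert (V0 : V 0 = 0).
  { unfold V. rewrite exp_0. replace (tan th * ((1 - 1) / (1 + 1))) with 0 by field. rewrite atan_0. ring. }
  assert (VM : forall t, V t <= 2 * th).
  { intros t. unfold V. apply Rmult_le_compat_l; [lra|]. rewrite <- (atan_tan th) at 2 by lra.
    apply atan_mono. rewrite <- (Rmult_1_r (tan th)) at 2. apply Rmult_le_compat_l; [lra|].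
    assert (He := exp_pos t). apply Rle_div_l; lra. }
  assert (K : forall m, rsum (fun k => h * (sin (2 * th) / (cosh (INR (S k) * h) + cos (2 * th)))) m <= V (INR m * h)).
  { induction m as [|m IH].
    - simpl. rewrite Rmult_0_l, V0. lra.
    - cbn [rsum]. assert (Hm : 0 <= INR m) by apply pos_INR.
      set (x := INR m * h) in *. assert (Ex : INR (S m) * h = x + h) by (rewrite S_INR; unfold x; ring).
      rewrite Ex. assert (Hx : 0 <= x) by pos.
      set (g := sin (2 * th) / (cosh (x + h) + cos (2 * th))).
      assert (Hst := deriv_nonneg_mono (fun t => V t - g * t)
        (fun t => sin (2 * th) / (cosh t + cos (2 * th)) - g) x (x + h)). cbv beta in Hst.
      cut (V x - g * x <= V (x + h) - g * (x + h)); [lra|]. apply Hst; [| |lra].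
      + intros t _. apply is_derive_Rminus.
        * now apply ray_kernel_derive.
        * auto_derive; [exact I|ring].
      + intros t Htt. assert (M : cosh t <= cosh (x + h)) by (apply cosh_mono_nonneg; lra).
        assert (Hcos : -1 < cos (2 * th)).
        { destruct HB as [[HB|HB] _]; [lra|].
          assert (E := sin2_cos2 (2 * th)). unfold Rsqr in E. rewrite <- HB in E. nra. }
        assert (C := cosh_ge_1 t). unfold g.
        assert (sin (2 * th) / (cosh (x + h) + cos (2 * th)) <= sin (2 * th) / (cosh t + cos (2 * th))); [|lra].
        unfold Rdiv. apply Rmult_le_compat_l; [lra|]. apply Rinv_le_contravar; lra. }
  eapply Rle_trans; [apply K|apply VM].
Qed.

(** [lq] vanishes at th = PI / 2; integrating the bound 2 t / h of [ray_kernel_sum] from th to PI /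
    2 gives the right side. *)
Lemma lq_sum th h n : 0 < th < PI / 2 -> 0 < h ->
  rsum (fun k => lq th (INR (S k) * h)) n <= (PI ^ 2 / 4 - th ^ 2) / h.
Proof.
  intros Hth Hh.
  assert (Hk : forall k, 0 < INR (S k) * h) by (intros k; pos).
  assert (Z : rsum (fun k => lq (PI / 2) (INR (S k) * h)) n = 0).
  { rewrite (rsum_ext_lt _ (fun _ => 0)); [rewrite rsum_const; ring|]. intros k _.
    unfold lq. replace (2 * (PI / 2)) with PI by field. rewrite cos_PI.
    assert (C := cosh_gt_1 _ (Hk k)).
    replace ((cosh (INR (S k) * h) + -1) / (cosh (INR (S k) * h) - 1)) with 1 by (field; lra).
    rewrite ln_1. ring. }
  assert (H := deriv_nonneg_mono
    (fun th => rsum (fun k => lq th (INR (S k) * h)) n - (PI ^ 2 / 4 - th ^ 2) / h)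
    (fun th => rsum (fun k => - (sin (2 * th) / (cosh (INR (S k) * h) + cos (2 * th)))) n - - (2 * th / h))
    th (PI / 2)). cbv beta in H. rewrite Z in H.
  replace (0 - (PI ^ 2 / 4 - (PI / 2) ^ 2) / h) with 0 in H by (field; lra).
  cut (rsum (fun k => lq th (INR (S k) * h)) n - (PI ^ 2 / 4 - th ^ 2) / h <= 0); [lra|].
  apply H; [| |lra].
  - intros t Ht. apply is_derive_Rminus.
    + apply (is_derive_rsum (fun k th => lq th (INR (S k) * h))
        (fun k th => - (sin (2 * th) / (cosh (INR (S k) * h) + cos (2 * th))))).
      intros k. now apply lq_derive.
    + auto_derive; [exact I|]. field. lra.
  - intros t Ht.
    assert (B : rsum (fun k => h * (sin (2 * t) / (cosh (INR (S k) * h) + cos (2 * t)))) n <= 2 * t).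
    { destruct (Rle_lt_or_eq_dec t (PI / 2) (proj2 Ht)) as [Hlt| ->]; [apply ray_kernel_sum; lra|].
      rewrite (rsum_ext_lt _ (fun _ => 0)); [rewrite rsum_const; lra|]. intros k _.
      replace (2 * (PI / 2)) with PI by field. rewrite sin_PI. unfold Rdiv. ring. }
    rewrite rsum_scal in B.
    rewrite (rsum_ext_lt _ (fun k => (-1) * (sin (2 * t) / (cosh (INR (S k) * h) + cos (2 * t))))) by (intros; ring).
    rewrite rsum_scal.
    assert (rsum (fun k => sin (2 * t) / (cosh (INR (S k) * h) + cos (2 * t))) n <= 2 * t / h); [|lra].
    apply (proj1 (Rle_div_r _ _ _ Hh)). lra.
Qed.

Lemma rsum_rev (f : nat -> R) j : rsum (fun k => f (j - k)%nat) j = rsum (fun k => f (S k)) j.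
Proof.
  induction j as [|j IH]; [reflexivity|].
  rewrite rsum_shift. cbn [rsum]. rewrite <- IH. simpl Nat.sub.
  rewrite Rplus_comm. f_equal.
Qed.


(** Here the discrepancy between disc and half-plane has to be paid for: the denominator v + conj u
    + conj u v exceeds v + conj u in modulus by at most the factor 1 + s / cos th, since |v + conj
    u| >= t cos th. *)
Lemma blf_ray s t th : 0 < s -> 0 < t -> s <> t -> 0 < th < PI / 2 ->
  exp (- lq th (Rabs (ln s - ln t)) - s / cos th)
  <= Cmod (blf (/ (1 + cpt s th))%C (/ (1 + cpt t th))%C).
Proof.
  intros Hs Ht Hst Hth.
  assert (Hc : 0 < cos th) by (apply cos_gt_0; lra).
  set (u := cpt s th). set (v := cpt t th).
  assert (Fu : fst u = s * cos th) by reflexivity. assert (Fv : fst v = t * cos th) by reflexivity.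
  assert (Pu : 0 < fst u) by (rewrite Fu; pos).
  assert (Pv : 0 < fst v) by (rewrite Fv; pos).
  assert (N1 : (1 + u)%C <> 0) by (apply Cneq_0_fst; simpl; simpl in Pu; lra).
  assert (N1' : (1 + Cconj u)%C <> 0) by (apply Cneq_0_fst; simpl; simpl in Pu; lra).
  assert (N2 : (1 + v)%C <> 0) by (apply Cneq_0_fst; simpl; simpl in Pv; lra).
  assert (Hmu : Cmod u = s) by (apply Cmod_cpt; lra). assert (Hmv : Cmod v = t) by (apply Cmod_cpt; lra).
  assert (Pre : s * cos th + t * cos th <= Cmod (v + Cconj u)).
  { eapply Rle_trans; [|apply fst_le_Cmod]. eapply Rle_trans; [|apply Rle_abs]. simpl. lra. }
  assert (Psum : 0 < Cmod (v + Cconj u)) by (rewrite Fu in Pu; rewrite Fv in Pv; lra).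
  set (X := (v + Cconj u + Cconj u * v)%C).
  assert (HX : Cmod X <= Cmod (v + Cconj u) * exp (s / cos th)).
  { unfold X. eapply Rle_trans; [apply Cmod_triangle|]. rewrite Cmod_mult, Cmod_conj, Hmu, Hmv.
    apply Rle_trans with (Cmod (v + Cconj u) * (1 + s / cos th)).
    - rewrite Rmult_plus_distr_l, Rmult_1_r. apply Rplus_le_compat_l.
      replace (s * t) with (t * cos th * (s / cos th)) by (field; lra).
      apply Rmult_le_compat_r; [pos|]. rewrite Fu in Pu. lra.
    - apply Rmult_le_compat_l; [lra|]. left. apply exp_ineq1. apply Rgt_not_eq. pos. }
  assert (HXn : X <> 0).
  { intros E.
    assert (E2 : Cmod ((1 + Cconj u) * (1 + v)) = 1).
    { replace ((1 + Cconj u) * (1 + v))%C with (1 + X)%C by (unfold X; ring). rewrite E, Cplus_0_r. apply Cmod_1. }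
    rewrite Cmod_mult in E2.
    assert (1 < Cmod (1 + Cconj u)).
    { eapply Rlt_le_trans; [|apply fst_le_Cmod]. eapply Rlt_le_trans; [|apply Rle_abs]. simpl. simpl in Pu. lra. }
    assert (1 < Cmod (1 + v)).
    { eapply Rlt_le_trans; [|apply fst_le_Cmod]. eapply Rlt_le_trans; [|apply Rle_abs]. simpl. simpl in Pv. lra. }
    nra. }
  assert (HXp : 0 < Cmod X) by now apply Cmod_gt_0.
  assert (EB : Cmod (blf (/ (1 + u))%C (/ (1 + v))%C) = Cmod (u - v) / Cmod X).
  { unfold blf.
    replace (Cconj (/ (1 + u))%C) with (/ (1 + Cconj u))%C.
    2:{ rewrite Cinv_conj by exact N1. f_equal. rewrite Cplus_conj. f_equal.
        unfold Cconj, RtoC; simpl. now rewrite Ropp_0. }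
    replace (1 - / (1 + Cconj u) * / (1 + v))%C with (X / ((1 + Cconj u) * (1 + v)))%C by (unfold X; field; auto).
    replace (/ (1 + v) - / (1 + u))%C with ((u - v) / ((1 + u) * (1 + v)))%C by (field; auto).
    assert (M1 : ((1 + Cconj u) * (1 + v))%C <> 0) by (now apply Cmult_neq_0).
    assert (M2 : ((1 + u) * (1 + v))%C <> 0) by (now apply Cmult_neq_0).
    rewrite Cmod_div.
    2:{ unfold Cdiv. apply Cmult_neq_0; [exact HXn|]. intros E. apply (f_equal (Cmult ((1 + Cconj u) * (1 + v))%C)) in E.
        rewrite Cinv_r, Cmult_0_r in E by exact M1. apply RtoC_inj in E. lra. }
    rewrite !Cmod_div by assumption. rewrite !Cmod_mult.
    replace (Cmod (1 + Cconj u)) with (Cmod (1 + u)).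
    2:{ rewrite <- (Cmod_conj (1 + u)%C). f_equal. rewrite Cplus_conj. f_equal.
        unfold Cconj, RtoC; simpl. now rewrite Ropp_0. }
    assert (Q1 : 0 < Cmod (1 + u)) by now apply Cmod_gt_0.
    assert (Q2 : 0 < Cmod (1 + v)) by now apply Cmod_gt_0.
    field. repeat split; lra. }
  rewrite EB. unfold Rminus at 1. rewrite exp_plus, exp_Ropp with (x := s / cos th).
  assert (EL : exp (- lq th (Rabs (ln s - ln t))) = Cmod (u - v) / Cmod (v + Cconj u)).
  { assert (Ech : cosh (Rabs (ln s - ln t)) = (s ^ 2 + t ^ 2) / (2 * s * t)).
    { rewrite cosh_Rabs. unfold cosh. replace (- (ln s - ln t)) with (ln t - ln s) by ring.
      unfold Rminus. rewrite !exp_plus, !exp_Ropp, !exp_ln by assumption. field. split; lra. }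
    assert (Hcs : cos th * cos th + sin th * sin th = 1) by (generalize (sin2_cos2 th); unfold Rsqr; lra).
    assert (A1 : Cmod (u - v) ^ 2 = (s - t) ^ 2).
    { rewrite Cmod2_dot. unfold dot, u, v, cpt; simpl.
      transitivity ((s - t) ^ 2 * (cos th * cos th + sin th * sin th)); [ring|]. rewrite Hcs; ring. }
    assert (A2 : Cmod (v + Cconj u) ^ 2 = s ^ 2 + t ^ 2 + 2 * s * t * cos (2 * th)).
    { rewrite Cmod2_dot, cos_2a. unfold dot, u, v, cpt; simpl.
      transitivity ((s ^ 2 + t ^ 2) * (cos th * cos th + sin th * sin th) + 2 * s * t * (cos th * cos th - sin th * sin th)); [ring|].
      rewrite Hcs; ring. }
    assert (Pst : 0 < s * t) by pos.
    assert (Pd : 0 < (s - t) ^ 2) by (assert (s - t <> 0) by lra; assert (0 < Rsqr (s - t)) by (now apply Rsqr_pos_lt); unfold Rsqr in *; lra).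
    assert (Pq : 0 < Cmod (v + Cconj u) ^ 2) by now apply pow_lt.
    assert (Puv : 0 <= Cmod (u - v)) by apply Cmod_ge_0.
    assert (Earg : (cosh (Rabs (ln s - ln t)) + cos (2 * th)) / (cosh (Rabs (ln s - ln t)) - 1)
                   = Cmod (v + Cconj u) ^ 2 / Cmod (u - v) ^ 2).
    { rewrite Ech, A1, A2. field. repeat split; try lra. }
    unfold lq. rewrite Earg.
    set (p := Cmod (v + Cconj u)) in *. set (q := Cmod (u - v)) in *.
    assert (Hq : 0 < q) by (rewrite <- A1 in Pd; nra).
    replace (p ^ 2 / q ^ 2) with ((p / q) * (p / q)) by (field; lra).
    assert (Hpq : 0 < p / q) by pos.
    rewrite ln_mult by assumption.
    replace (- (/ 2 * (ln (p / q) + ln (p / q)))) with (- ln (p / q)) by field.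
    rewrite exp_Ropp, exp_ln by exact Hpq. field. lra. }
  rewrite EL.
  assert (He := exp_pos (s / cos th)).
  replace (Cmod (u - v) / Cmod (v + Cconj u) * / exp (s / cos th))
    with (Cmod (u - v) / (Cmod (v + Cconj u) * exp (s / cos th))) by (field; lra).
  unfold Rdiv. apply Rmult_le_compat_l; [apply Cmod_ge_0|]. now apply Rinv_le_contravar.
Qed.

Lemma blp_lower (lam : nat -> C) (d : nat -> R) n w :
  (forall i, (i < n)%nat -> exp (- d i) <= Cmod (blf (lam i) w)) ->
  exp (- rsum d n) <= Cmod (blp lam n w).
Proof.
  induction n as [|n IH]; intros H; cbn [blp rsum].
  - rewrite Cmod_1, Ropp_0, exp_0. lra.
  - rewrite Cmod_mult, Ropp_plus_distr, exp_plus.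
    apply Rmult_le_compat; try (left; apply exp_pos); auto.
Qed.

Lemma rsum_exp_le h n : 0 < h -> rsum (fun i => exp (- (INR i * h))) n <= 1 + / h.
Proof.
  intros Hh. assert (H1 := exp_ineq1 h ltac:(lra)).
  assert (Hx : 0 < exp (- h) < 1) by (rewrite exp_Ropp; apply inv_lt_1; lra).
  rewrite (rsum_ext_lt _ (fun i => exp (- h) ^ i)).
  - eapply Rle_trans; [apply rsum_geom_le; lra|].
    assert (H2 : exp (- h) <= / (1 + h)).
    { rewrite exp_Ropp. apply Rinv_le_contravar; lra. }
    replace (1 + / h) with (/ (1 - / (1 + h))) by (field; repeat split; lra).
    apply Rinv_le_contravar; [|lra].
    generalize (inv_lt_1 (1 + h) ltac:(lra)). lra.
  - intros i _. rewrite <- Rpower_pow by lra. unfold Rpower. rewrite ln_exp. f_equal. ring.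
Qed.

(** The argument of [f] is the distance from [skip j i] to [j], and each distance occurs at most
    twice. *)
Lemma skip_dist_sum (f : nat -> R) j n : (forall k, 0 <= f k) -> (j < S n)%nat ->
  rsum (fun i => f (if (i <? j)%nat then j - i else S i - j)%nat) n <= 2 * rsum (fun k => f (S k)) n.
Proof.
  intros Hf Hj. replace n with (j + (n - j))%nat at 1 by lia. rewrite rsum_add.
  rewrite (rsum_ext_lt _ (fun i => f (j - i)%nat) j).
  2:{ intros i Hi. now rewrite (proj2 (Nat.ltb_lt i j) Hi). }
  rewrite rsum_rev.
  rewrite (rsum_ext_lt _ (fun k => f (S k)) (n - j)).
  2:{ intros k _. rewrite (proj2 (Nat.ltb_ge (j + k) j)) by lia. f_equal. lia. }
  assert (rsum (fun k => f (S k)) j <= rsum (fun k => f (S k)) n) by (apply rsum_mono; [auto|lia]).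
  assert (rsum (fun k => f (S k)) (n - j) <= rsum (fun k => f (S k)) n) by (apply rsum_mono; [auto|lia]).
  lra.
Qed.

Lemma phi_on_ray al s psi : 0 < al < 1 -> 0 < s -> 0 < psi < PI / 2 ->
  phi_alpha al (1 - cpt (Rpower s (/ al)) psi)%C = (/ (1 + cpt s (al * psi)))%C.
Proof.
  intros Hal Hs Hpsi. assert (Hc : 0 < cos psi) by (apply cos_gt_0; lra).
  assert (Hr := Rpower_pos s (/ al)).
  unfold phi_alpha. f_equal. f_equal.
  replace (1 - (1 - cpt (Rpower s (/ al)) psi))%C with (cpt (Rpower s (/ al)) psi) by ring.
  rewrite Cpowr_right by (simpl; pos).
  rewrite Cmod_cpt by lra. rewrite Rpower_mult, Rinv_l, Rpower_1 by lra.
  assert (E : snd (cpt (Rpower s (/ al)) psi) / fst (cpt (Rpower s (/ al)) psi) = tan psi).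
  { unfold cpt, tan. simpl. field. repeat split; lra. }
  rewrite E, atan_tan by lra. reflexivity.
Qed.

(** The points satisfy [1 - z_i = s_i^(1/al) e^(i psi)] with [s_i = s0 e^(-i h)], so that
    [w_i = 1 / (1 + s_i e^(i al psi))]. *)
Lemma lower_general al psi s0 h n : 0 < al < 1 -> 0 < psi < PI / 2 -> 0 < s0 <= cos psi -> 0 < h -> (1 <= n)%nat ->
  let th := al * psi in
  Rbar_le (/ INR n * (sqrt (cos psi / 3) * Rpower s0 ((1 - al) / (2 * al)) * exp (- ((1 - al) / (2 * al) * (INR n * h))))
            * exp (- (2 * (PI ^ 2 / 4 - th ^ 2) / h + s0 / cos th * (1 + / h))))
    (approx_number (Comp_op (phi_alpha al)) n).
Proof.
  intros Hal Hpsi Hs0 Hh Hn th. assert (HP := PI_RGT_0).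
  assert (Hth : 0 < th < PI / 2) by (unfold th; nra).
  assert (Hcp : 0 < cos psi < 1).
  { split; [apply cos_gt_0; lra|]. rewrite <- cos_0. apply cos_decreasing_1; lra. }
  assert (Hct : 0 < cos th) by (apply cos_gt_0; lra).
  set (s := fun i => s0 * exp (- (INR i * h))).
  assert (Hs : forall i, 0 < s i <= s0).
  { intros i. unfold s. assert (He := exp_pos (- (INR i * h))).
    assert (exp (- (INR i * h)) <= exp 0).
    { apply exp_mono. assert (0 <= INR i * h) by (apply Rmult_le_pos; [apply pos_INR|lra]). lra. }
    rewrite exp_0 in H. split; [pos|]. nra. }
  set (rho := fun i => Rpower (s i) (/ al)).
  assert (Hrho : forall i, 0 < rho i <= cos psi).
  { intros i. split; [apply Rpower_pos|]. apply Rle_trans with (s i); [|specialize (Hs i); lra].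
    rewrite <- (Rpower_1 (s i)) by apply Hs. unfold rho, Rpower. apply exp_mono.
    assert (Hln : ln (s i) <= 0).
    { rewrite <- ln_1. left. apply ln_increasing; specialize (Hs i); lra. }
    assert (1 <= / al). { apply Rle_trans with (/ 1); [rewrite Rinv_1; lra|apply Rinv_le_contravar; lra]. }
    nra. }
  set (z := fun i => (1 - cpt (rho i) psi)%C).
  assert (Hzm : forall i, Cmod (z i) ^ 2 = 1 - 2 * rho i * cos psi + rho i ^ 2).
  { intros i. rewrite Cmod2_dot. unfold dot, z, cpt; simpl.
    transitivity (1 - 2 * rho i * cos psi + rho i ^ 2 * (sin psi * sin psi + cos psi * cos psi)); [ring|].
    generalize (sin2_cos2 psi). unfold Rsqr. intros ->. ring. }
  (* From 1 - |z|^2 = 2 rho cos psi - rho^2 with rho <= cos psi; this is the origin of the condition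
     s0 <= cos psi. *)
  assert (Hzb : forall i, rho i * cos psi <= 1 - Cmod (z i) ^ 2).
  { intros i. rewrite Hzm. specialize (Hrho i). nra. }
  assert (Hz : forall i, Cmod (z i) < 1).
  { intros i. assert (H := Hzb i). specialize (Hrho i). assert (0 <= Cmod (z i)) by apply Cmod_ge_0.
    assert (0 < rho i * cos psi) by pos. nra. }
  assert (Hphi : forall i, phi_alpha al (z i) = (/ (1 + cpt (s i) th))%C).
  { intros i. apply phi_on_ray; [exact Hal|apply Hs|exact Hpsi]. }
  apply (approx_number_lower al n z _ Hal Hn Hz).
  intros j Hj w.
  assert (HN : 0 < INR n) by pos.
  set (a := (1 - al) / (2 * al)).
  assert (Ha : 0 < a) by pos.
  assert (Hw : sqrt (1 - Cmod (w j) ^ 2) <= sqrt (3 * s j)).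
  { apply sqrt_le_1_alt. unfold w. rewrite Hphi.
    assert (Hs1 : 0 < s j <= 1) by (specialize (Hs j); lra).
    assert (HB := COS_bound th).
    assert (E : Cmod (1 + cpt (s j) th) ^ 2 = 1 + 2 * s j * cos th + s j ^ 2).
    { rewrite Cmod2_dot. unfold dot, cpt; simpl.
      transitivity (1 + 2 * s j * cos th + s j ^ 2 * (sin th * sin th + cos th * cos th)); [ring|].
      generalize (sin2_cos2 th). unfold Rsqr. intros ->. ring. }
    assert (Hne : (1 + cpt (s j) th)%C <> 0).
    { intros E0. rewrite E0, Cmod_0 in E. nra. }
    rewrite Cmod_inv by exact Hne. rewrite pow_inv, E.
    assert (D : 1 <= 1 + 2 * s j * cos th + s j ^ 2) by nra.
    replace (1 - / (1 + 2 * s j * cos th + s j ^ 2)) with ((2 * s j * cos th + s j ^ 2) / (1 + 2 * s j * cos th + s j ^ 2))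
      by (field; lra).
    apply Rle_div_l; [lra|]. nra. }
  assert (Hzs : sqrt (rho j * cos psi) <= sqrt (1 - Cmod (z j) ^ 2)) by apply sqrt_le_1_alt, Hzb.
  assert (HB : exp (- (2 * (PI ^ 2 / 4 - th ^ 2) / h + s0 / cos th * (1 + / h)))
      <= Cmod (blp (fun i => w (skip j i)) (n - 1) (w j))).
  (* The two costs in [blf_ray]: the half-plane distance, and the correction for the disc, which is
     summable because [s] is geometric. *)
  { set (dd := fun i => lq th (INR (if (i <? j)%nat then j - i else S i - j)%nat * h) + s (skip j i) / cos th).
    eapply Rle_trans; [|apply (blp_lower _ dd)].
    - apply exp_mono, Ropp_le_contravar. unfold dd. rewrite rsum_plus. apply Rplus_le_compat.
      (* The value at 0 is a default: all distances that occur are positive, and [lq] is singular at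
         0. *)
      + set (f := fun k => match k with O => 0 | S _ => lq th (INR k * h) end).
        assert (Hf : forall k, 0 <= f k).
        { intros [|k]; unfold f; [lra|]. apply lq_nonneg, Rmult_lt_0_compat; [apply lt_0_INR; lia|lra]. }
        rewrite (rsum_ext_lt _ (fun i => f (if (i <? j)%nat then j - i else S i - j)%nat)).
        * eapply Rle_trans; [apply (skip_dist_sum f j (n - 1) Hf); lia|].
          unfold f. replace (2 * (PI ^ 2 / 4 - th ^ 2) / h) with (2 * ((PI ^ 2 / 4 - th ^ 2) / h)) by (field; lra).
          apply Rmult_le_compat_l; [lra|]. now apply lq_sum.
        * intros i Hi. unfold f. destruct (Nat.ltb_spec i j).
          -- destruct (j - i)%nat eqn:E; [lia|reflexivity].
          -- destruct (S i - j)%nat eqn:E; [lia|reflexivity].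
      + rewrite (rsum_ext_lt _ (fun i => / cos th * s (skip j i))) by (intros; unfold Rdiv; ring).
        rewrite rsum_scal. unfold Rdiv. rewrite (Rmult_comm s0), Rmult_assoc.
        apply Rmult_le_compat_l; [pos|].
        apply Rle_trans with (rsum s n).
        * assert (Hsk : forall m, (m <= n - 1)%nat -> rsum (fun i => s (skip j i)) m <= rsum s (S m)).
          { intros m Hm. induction m as [|m IH]; cbn [rsum].
            - specialize (Hs O). lra.
            - unfold skip at 2. destruct (Nat.ltb_spec m j) as [Hmj|Hmj].
              + assert (Heq : rsum (fun i => s (skip j i)) m = rsum s m).
                { apply rsum_ext_lt. intros k Hk. unfold skip. now rewrite (proj2 (Nat.ltb_lt k j)) by lia. }
                rewrite Heq. assert (Hs1 := Hs (S m)). lra.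
              + specialize (IH ltac:(lia)). cbn [rsum] in IH. lra. }
          replace n with (S (n - 1)) at 2 by lia. apply Hsk. lia.
        * unfold s. rewrite rsum_scal. apply Rmult_le_compat_l; [lra|]. now apply rsum_exp_le.
    - intros i Hi. unfold dd. rewrite Ropp_plus_distr.
      set (i' := skip j i). assert (Hne : i' <> j) by apply skip_neq.
      unfold w. rewrite !Hphi.
      assert (Hln : forall k, ln (s k) = ln s0 - INR k * h).
      { intros k. unfold s. rewrite ln_mult by (try apply exp_pos; lra). rewrite ln_exp. ring. }
      assert (Hss : s i' <> s j).
      { intros E. apply (f_equal ln) in E. rewrite !Hln in E. assert (INR i' * h = INR j * h) by lra.
        apply Rmult_eq_reg_r in H; [|lra]. now apply INR_eq in H. }
      assert (R1 := blf_ray (s i') (s j) th (proj1 (Hs i')) (proj1 (Hs j)) Hss Hth).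
      replace (Rabs (ln (s i') - ln (s j))) with (INR (if (i <? j)%nat then j - i else S i - j)%nat * h) in R1; [exact R1|].
      rewrite !Hln. replace (ln s0 - INR i' * h - (ln s0 - INR j * h)) with ((INR j - INR i') * h) by ring.
      rewrite Rabs_mult, (Rabs_pos_eq h) by lra. f_equal. unfold i', skip.
      destruct (Nat.ltb_spec i j).
      + rewrite minus_INR by lia. rewrite Rabs_pos_eq; [reflexivity|].
        assert (INR i <= INR j) by (apply le_INR; lia). lra.
      + rewrite minus_INR by lia. rewrite Rabs_left1; [ring|].
        assert (INR j <= INR (S i)) by (apply le_INR; lia). lra. }
  set (Q := exp (- (2 * (PI ^ 2 / 4 - th ^ 2) / h + s0 / cos th * (1 + / h)))) in *.
  assert (HQ : 0 < Q) by apply exp_pos.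
  (* A lower bound, uniform in j, for the ratio of the square roots: (rho cos psi) / (3 s) = (cos
     psi / 3) s^(2 a), and s_j >= s0 exp (- n h). *)
  set (G := sqrt (cos psi / 3) * Rpower s0 a * exp (- (a * (INR n * h)))).
  assert (HG : G * sqrt (3 * s j) <= sqrt (rho j * cos psi)).
  { assert (Hsj : 0 < s j) by apply Hs.
    assert (E1 : sqrt (rho j * cos psi) = sqrt (cos psi / 3) * Rpower (s j) a * sqrt (3 * s j)).
    { replace (rho j * cos psi) with ((cos psi / 3) * (Rpower (s j) a * Rpower (s j) a) * (3 * s j)).
      - rewrite sqrt_mult, sqrt_mult, sqrt_square; try lra.
        + pos.
        + pos.
        + apply Rmult_le_pos; [lra|]. pos.
      - rewrite <- Rpower_plus. unfold rho.
        replace (Rpower (s j) (/ al)) with (Rpower (s j) (a + a) * Rpower (s j) 1).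
        + rewrite Rpower_1 by exact Hsj. field.
        + rewrite <- Rpower_plus. f_equal. unfold a. field. lra. }
    rewrite E1. apply Rmult_le_compat_r; [apply sqrt_pos|]. unfold G. rewrite Rmult_assoc.
    apply Rmult_le_compat_l; [apply sqrt_pos|].
    unfold s. rewrite <- Rpower_mult_distr by (try apply exp_pos; lra).
    apply Rmult_le_compat_l; [pos|]. unfold Rpower at 1. rewrite ln_exp. apply exp_mono.
    assert (Hjn : INR j * h <= INR n * h) by (apply Rmult_le_compat_r; [lra|apply le_INR; lia]).
    assert (0 <= a * (INR n * h - INR j * h)) by pos. lra. }
  assert (HG0 : 0 <= G).
  { unfold G. apply Rmult_le_pos; [|left; apply exp_pos]. apply Rmult_le_pos; [apply sqrt_pos|pos]. }
  fold G.
  replace (/ INR n * G * Q * INR n * sqrt (1 - Cmod (w j) ^ 2)) with (G * sqrt (1 - Cmod (w j) ^ 2) * Q) by (field; lra).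
  apply Rmult_le_compat; [apply Rmult_le_pos; [exact HG0|apply sqrt_pos]|lra| |exact HB].
  apply Rle_trans with (G * sqrt (3 * s j)); [apply Rmult_le_compat_l; assumption|lra].
Qed.

(** * The lower estimate *)

Lemma lower_estimate al : 0 < al < 1 -> exists c1, 0 < c1 /\ forall n, (1 <= n)%nat ->
  Rbar_le (c1 * exp (- (PI * (1 - al) * sqrt (2 * INR n / al)))) (approx_number (Comp_op (phi_alpha al)) n).
Proof.
  intros Hal. assert (HP := PI_RGT_0). assert (HP3 : 3 < PI) by (generalize PI2_3_2; lra).
  (* Tilting the ray away from the boundary costs at most PI^2 ep in the exponent, and the disc
     correction at most (1 - al)^2 <= PI^2 ep. *)
  set (ep := (1 - al) ^ 2 / 8).
  assert (Hep : 0 < ep < 1 / 8) by (unfold ep; nra).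
  set (psi := PI / 2 * (1 - ep)).
  assert (Hpsi : 0 < psi < PI / 2) by (unfold psi; nra).
  assert (Hcp : 0 < cos psi < 1).
  { split; [apply cos_gt_0; lra|]. rewrite <- cos_0. apply cos_decreasing_1; lra. }
  (* Small enough for s0 / cos th <= (1 - al)^2, as cos psi <= cos th. *)
  set (s0 := cos psi * (1 - al) ^ 2).
  assert (Hs0 : 0 < s0 <= cos psi).
  { unfold s0. assert (0 < (1 - al) ^ 2 <= 1) by nra. split; [pos|nra]. }
  set (th := al * psi).
  assert (Hth : 0 < th < psi) by (unfold th; nra).
  assert (Hct : cos psi <= cos th) by (apply cos_decr_1; lra).
  assert (Hsc : s0 / cos th <= (1 - al) ^ 2).
  { apply Rle_div_l; [lra|]. unfold s0. rewrite Rmult_comm. apply Rmult_le_compat_l; [apply pow2_ge_0|lra]. }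
  assert (Hsc0 : 0 < s0 / cos th) by pos.
  (* The ideal cost PI^2 (1 - al^2) / 2 increased by the two losses 2 PI^2 ep. In the final exponent
     1 + al becomes (3 + al) / 2, halfway to the permitted value 2. *)
  set (E := PI ^ 2 * (1 - al) * (3 + al) / 4).
  assert (HP9 : 9 < PI ^ 2) by nra.
  assert (HE0 : 0 < E).
  { unfold E. assert (0 < PI ^ 2 * ((1 - al) * (3 + al))) by (apply Rmult_lt_0_compat; nra). lra. }
  assert (HE : 2 * (PI ^ 2 / 4 - th ^ 2) + s0 / cos th <= E).
  { assert (T : PI ^ 2 * (al ^ 2 * (1 - 2 * ep)) / 4 <= th ^ 2).
    { unfold th, psi. replace ((al * (PI / 2 * (1 - ep))) ^ 2) with (PI ^ 2 * (al ^ 2 * (1 - ep) ^ 2) / 4) by field.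
      apply Rmult_le_compat_r; [lra|]. apply Rmult_le_compat_l; [lra|].
      apply Rmult_le_compat_l; [apply pow2_ge_0|]. nra. }
    assert (T2 : (1 - al) ^ 2 <= PI ^ 2 * ep) by (unfold ep; assert (0 <= (1 - al) ^ 2) by apply pow2_ge_0; nra).
    assert (T3 : PI ^ 2 * (al ^ 2 * ep) <= PI ^ 2 * ep).
    { apply Rmult_le_compat_l; [lra|]. assert (al ^ 2 <= 1) by nra. nra. }
    assert (T4 : PI ^ 2 * ep = PI ^ 2 * (1 - al) ^ 2 / 8) by (unfold ep; field).
    assert (T5 : PI ^ 2 / 2 - PI ^ 2 * al ^ 2 / 2 + PI ^ 2 * (1 - al) ^ 2 / 8 + PI ^ 2 * (1 - al) ^ 2 / 8 = E) by (unfold E; field).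
    lra. }
  set (a := (1 - al) / (2 * al)).
  assert (Ha : 0 < a) by pos.
  assert (HaE : 0 < a * E) by pos.
  set (b1 := 2 * sqrt (a * E)). set (b2 := PI * (1 - al) * sqrt (2 / al)).
  assert (Hb : b1 < b2).
  { assert (H2 : 0 < 2 / al) by pos.
    assert (X : b2 = 2 * sqrt ((PI * (1 - al) / 2) ^ 2 * (2 / al))).
    { unfold b2. rewrite sqrt_mult_alt by apply pow2_ge_0. rewrite sqrt_pow2; [field|].
      apply Rmult_le_pos; [pos|lra]. }
    unfold b1. rewrite X. apply Rmult_lt_compat_l; [lra|]. apply sqrt_lt_1_alt. split; [lra|].
    unfold a, E.
    replace ((1 - al) / (2 * al) * (PI ^ 2 * (1 - al) * (3 + al) / 4)) with (PI ^ 2 * (1 - al) ^ 2 / (8 * al) * (3 + al)) by (field; lra).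
    replace ((PI * (1 - al) / 2) ^ 2 * (2 / al)) with (PI ^ 2 * (1 - al) ^ 2 / (8 * al) * 4) by (field; lra).
    apply Rmult_lt_compat_l; [|lra]. apply Rdiv_lt_0_compat; [|lra]. apply Rmult_lt_0_compat; [lra|nra]. }
  set (k0 := sqrt (cos psi / 3) * Rpower s0 a * exp (- (s0 / cos th))).
  assert (Hk0 : 0 < k0).
  { unfold k0. apply Rmult_lt_0_compat; [apply Rmult_lt_0_compat|apply exp_pos];
      [apply sqrt_lt_R0; lra|apply Rpower_pos]. }
  (* The gap between [b1] and [b2] absorbs the factor 1 / n: exp t >= (t / 2)^2 at t = (b2 - b1)
     sqrt n. *)
  exists (k0 * ((b2 - b1) / 2) ^ 2). split.
  { apply Rmult_lt_0_compat; [exact Hk0|apply pow_lt; lra]. }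
  intros n Hn.
  assert (HN : 0 < INR n) by pos.
  assert (Hsn : 0 < sqrt (INR n)) by now apply sqrt_lt_R0.
  assert (Esn : sqrt (INR n) * sqrt (INR n) = INR n) by (apply sqrt_sqrt; lra).
  assert (Esa : sqrt (a * E) * sqrt (a * E) = a * E) by (apply sqrt_sqrt; lra).
  assert (Hsa : 0 < sqrt (a * E)) by now apply sqrt_lt_R0.
  (* The minimizer of a n h + E / h; both terms then equal sqrt (a E n). *)
  set (h := sqrt (a * E) / (a * sqrt (INR n))).
  assert (Hasn : 0 < a * sqrt (INR n)) by pos.
  assert (Hh : 0 < h) by pos.
  assert (E1 : a * (INR n * h) = sqrt (a * E) * sqrt (INR n)).
  { unfold h. rewrite <- Esn at 1. field. split; lra. }
  assert (E2 : E / h = sqrt (a * E) * sqrt (INR n)).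
  { unfold h. replace E with (sqrt (a * E) * sqrt (a * E) / a) at 1 by (rewrite Esa; field; lra). field. repeat split; lra. }
  assert (L := lower_general al psi s0 h n Hal Hpsi Hs0 Hh Hn). cbv zeta in L. fold th a in L.
  eapply Rbar_le_trans; [|exact L]. unfold Rbar_le.
  replace (PI * (1 - al) * sqrt (2 * INR n / al)) with (b2 * sqrt (INR n)).
  2:{ unfold b2. replace (2 * INR n / al) with (2 / al * INR n) by (field; lra).
      rewrite sqrt_mult_alt; [ring|]. left. apply Rdiv_lt_0_compat; lra. }
  rewrite E1.
  set (X := sqrt (INR n)) in *. set (Y := sqrt (a * E)) in *.
  apply Rle_trans with (/ INR n * (k0 * exp (- (b1 * X)))).
  - replace (- (b2 * X)) with (- (b1 * X) + - ((b2 - b1) * X)) by ring. rewrite exp_plus.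
    assert (Hd : 0 < (b2 - b1) * X) by pos.
    assert (Hexp : ((b2 - b1) / 2) ^ 2 * exp (- ((b2 - b1) * X)) <= / INR n).
    { rewrite exp_Ropp. apply Rmult_le_reg_r with (INR n * exp ((b2 - b1) * X)).
      { apply Rmult_lt_0_compat; [lra|apply exp_pos]. }
      assert (Hp := exp_pos ((b2 - b1) * X)).
      replace (((b2 - b1) / 2) ^ 2 * / exp ((b2 - b1) * X) * (INR n * exp ((b2 - b1) * X)))
        with (((b2 - b1) / 2) ^ 2 * INR n) by (field; lra).
      replace (/ INR n * (INR n * exp ((b2 - b1) * X))) with (exp ((b2 - b1) * X)) by (field; lra).
      rewrite <- Esn. set (t := (b2 - b1) * X) in *.
      replace (((b2 - b1) / 2) ^ 2 * (X * X)) with ((t / 2) ^ 2) by (unfold t; field).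
      replace t with (t / 2 + t / 2) at 2 by field. rewrite exp_plus.
      assert (H1 := exp_ineq1 (t / 2) ltac:(lra)). nra. }
    replace (k0 * ((b2 - b1) / 2) ^ 2 * (exp (- (b1 * X)) * exp (- ((b2 - b1) * X))))
      with (k0 * exp (- (b1 * X)) * (((b2 - b1) / 2) ^ 2 * exp (- ((b2 - b1) * X)))) by ring.
    rewrite (Rmult_comm (/ INR n)). apply Rmult_le_compat_l; [|exact Hexp].
    pos.
  - rewrite (Rmult_assoc (/ INR n)). apply Rmult_le_compat_l; [pos|].
    unfold k0. rewrite !Rmult_assoc.
    apply Rmult_le_compat_l; [apply sqrt_pos|]. apply Rmult_le_compat_l; [pos|].
    rewrite <- !exp_plus. apply exp_mono. unfold b1. fold Y.
    assert (Hfin : 2 * (PI ^ 2 / 4 - th ^ 2) / h + s0 / cos th * / h <= Y * X).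
    { rewrite <- E2. replace (2 * (PI ^ 2 / 4 - th ^ 2) / h + s0 / cos th * / h)
        with ((2 * (PI ^ 2 / 4 - th ^ 2) + s0 / cos th) / h) by (field; lra).
      apply Rmult_le_compat_r; [pos|exact HE]. }
    rewrite Rmult_plus_distr_l, Rmult_1_r. lra.
Qed.

Theorem theorem1p3 (alpha : R) (Halpha : 0 < alpha < 1) :
  exists c1 c2 : R, 0 < c1 /\ 0 < c2 /\
    forall n : nat, (1 <= n)%nat ->
      Rbar_le (c1 * exp (- (PI * (1 - alpha) * sqrt (2 * INR n / alpha))))
              (approx_number (Comp_op (phi_alpha alpha)) n) /\
      Rbar_le (approx_number (Comp_op (phi_alpha alpha)) n)
              (c2 * exp (- (PI * (1 - alpha) * sqrt (INR n / (2 * alpha))))).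
Proof.
  destruct (lower_estimate alpha Halpha) as (c1 & Hc1 & H1).
  destruct (upper_estimate alpha Halpha) as (c2 & Hc2 & H2).
  exists c1, c2. repeat split; auto.
Qed.
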